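(* For any $N\in\mathbb{N}$ there exists an explicit set $\diamond_{\mathrm{gen}}(N)$ of $N$ points on $\mathbb{S}^2$, depending on certain random parameters (for $N\ge 241$, the set constructed in the context, whose random parameters are the phases $\theta_1,\dots,\theta_{2M-1}$), whose expected logarithmic energy is, as $N\to\infty$, $$W_{\log}(\mathbb{S}^2)N^2-\frac12 N\log N+c_\diamond N+O\left(\sqrt N\log N\right),$$ where $W_{\log}(\mathbb S^2)=\frac12-\log 2$ and $c_\diamond=-0.049222\ldots$ is the constant given in the context. Moreover, there are universal constants $c_1,c_2>0$ such that, for every $N$ and for any choice of the random parameters, its spherical cap discrepancy satisfies $$\frac{c_1}{\sqrt N}\le D_{\mathrm{sup},\mathrm{cap}}\left(\diamond_{\mathrm{gen}}(N)\right)\le\frac{c_2}{\sqrt N}.$$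
   Context: $\mathbb{S}^2$ is the unit sphere in $\mathbb{R}^3$. The logarithmic energy of $\omega_N=\{x_1,\dots,x_N\}\subset\mathbb{S}^2$ is $\mathscr{E}_{\log}(\omega_N)=\sum_{i\ne j}\log\|x_i-x_j\|^{-1}$ (sum over ordered pairs). For $z\in\mathbb S^2$, $t\in[-1,1]$, the spherical cap is $C(z,t)=\{y\in\mathbb{S}^2:\langle z,y\rangle>t\}$; with $\mu$ the Lebesgue (surface) measure on $\mathbb S^2$, the spherical cap discrepancy is $$D_{\mathrm{sup},\mathrm{cap}}(\omega_N)=\sup_{C}\left|\frac{\#(\omega_N\cap C)}{N}-\frac{\mu(C)}{\mu(\mathbb{S}^2)}\right|,$$ the supremum being over all spherical caps $C$. The constant $c_\diamond$ is defined by $$14340\,c_\diamond=19120\log239-2270\log227-1460\log73-265\log53-1935\log43-930\log31-1710\log19-1938\log17+19825\log13+1750\log7-4250\log5-131307\log3+56586\log2-7170.$$ Construction of $\diamond_{\mathrm{gen}}(N)$ for $N\ge 241$. Put $$m=\left\lfloor\sqrt{\tfrac{N-2}{239}}\right\rfloor,\quad \gamma=\left\lfloor\tfrac{N-239m^2-2}{2m-1}\right\rfloor,\quad \eta=(N-239m^2-2)\bmod(2m-1),\quad M=7m.$$ Define integers $d$ (written $\delta m$ in the paper) and $\varepsilon$ by: if $\eta=0$ (in particular if $N=239m^2+2$), $d=7m-1$ and $\varepsilon=-1$; if $\eta\neq0$ is odd, $d=7m-1-\frac{\eta-1}{2}$ and $\varepsilon=0$; if $\eta\ne0$ is even, $d=7m-1-\frac{\eta-2}{2}$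 and $\varepsilon=1$. Let $$r(x)=\begin{cases}6x&0<x\le2m\\2m+5x&2m<x\le3m\\5m+4x&3m<x\le4m\\9m+3x&4m<x\le5m\\14m+2x&5m<x\le6m\\20m+x+\gamma&6m<x\le d\\20m+x+\gamma+1&d<x\le7m-1\\20m+x+\gamma+1+\varepsilon&7m-1<x\le7m\end{cases}$$ and, for $1\le j\le M-1$, $r_j=r(j)$ and $$z_j=1-\frac{1+r_j+2\sum_{k=1}^{j-1}r_k}{N-1},$$ together with $r_M=r(M)$, $z_M=0$, and $r_{2M-j}=r_j$, $z_{2M-j}=-z_j$ for $1\le j\le M-1$. Then $\diamond_{\mathrm{gen}}(N)$ consists of the north and south poles $(0,0,\pm1)$ and, for each $1\le j\le 2M-1$, the $r_j$ points $$\left(\sqrt{1-z_j^2}\cos\left(\tfrac{2\pi i}{r_j}+\theta_j\right),\ \sqrt{1-z_j^2}\sin\left(\tfrac{2\pi i}{r_j}+\theta_j\right),\ z_j\right),\quad 1\le i\le r_j.$$ The random parameters are the phases $\theta_1,\dots,\theta_{2M-1}$, independent and uniform in $[0,2\pi]$; the expectation is taken with respect to them. *)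

(* Defs.v *)
From HB Require Import structures.
From mathcomp Require Import all_boot all_order all_algebra.
From mathcomp Require Import finmap.
From mathcomp Require Import all_classical all_reals all_analysis.

Set Implicit Arguments.
Unset Strict Implicit.
Unset Printing Implicit Defensive.

Import Order.TTheory GRing.Theory Num.Theory.
Import numFieldNormedType.Exports.

Local Open Scope classical_set_scope.
Local Open Scope ring_scope.

Section Sphere.
Context {R : realType}.

Definition space3 : Type := (R * R * R)%type.

Definition dot (p q : space3) : R := p.1.1 * q.1.1 + p.1.2 * q.1.2 + p.2 * q.2.

(* The norm that the library puts on a product type is the sup norm, hence
   this Euclidean norm. *)
Definition enorm (p : space3) : R := Num.sqrt (dot p p).

Definition sphere : set space3 := [set p | enorm p = 1].

Definition log_energy (w : {fset space3}) : R :=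
  \sum_(x <- w) \sum_(y <- w | x != y) ln (enorm (x - y))^-1.

Definition cap (z : space3) (t : R) : set space3 :=
  [set y | sphere y /\ t < dot z y].

Definition volume : set space3 -> \bar R :=
  ((@lebesgue_measure R \x @lebesgue_measure R) \x @lebesgue_measure R)%E.

(* Surface measure, normalised by dx = r^2 dr dmu in polar coordinates: the
   cone {r x : 0 < r <= 1, x in A} has volume mu(A) / 3, so that the whole
   sphere has measure 4 pi. *)
Definition surface_measure (A : set space3) : \bar R :=
  (3%:E * volume [set p | exists r x, [/\ (0 < r <= 1)%R, A x &
                            p = (r * x.1.1, r * x.1.2, r * x.2)%R]])%E.

Definition cap_discrepancy (w : {fset space3}) : R :=
  sup [set D | exists z t, [/\ sphere z, -1 <= t <= 1 &
    D = `| #|` [fset x in w | x \in cap z t]%fset |%:R / #|` w |%:R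
           - fine (surface_measure (cap z t))
             / fine (surface_measure sphere) | ] ].

End Sphere.
Arguments space3 : clear implicits.

Section Diamond.
Context (R : realType) (N : nat).

Definition dm : nat := Num.truncn (Num.sqrt ((N - 2)%N%:R / 239 : R)).

Definition dgamma : nat := ((N - 239 * dm ^ 2 - 2) %/ (2 * dm - 1))%N.

Definition deta : nat := ((N - 239 * dm ^ 2 - 2) %% (2 * dm - 1))%N.

Definition dM : nat := (7 * dm)%N.

Definition ddelta : nat :=
  (if deta == 0 then 7 * dm - 1
   else if odd deta then 7 * dm - 1 - (deta - 1) %/ 2
   else 7 * dm - 1 - (deta - 2) %/ 2)%N.

Definition depsilon : int :=
  if deta == 0%N then - 1 else if odd deta then 0 else 1.

(* In the last case the integer is nonnegative, so that the absolute value is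
   only a cast to nat. *)
Definition rfun (x : nat) : nat :=
  (if x <= 2 * dm then 6 * x
   else if x <= 3 * dm then 2 * dm + 5 * x
   else if x <= 4 * dm then 5 * dm + 4 * x
   else if x <= 5 * dm then 9 * dm + 3 * x
   else if x <= 6 * dm then 14 * dm + 2 * x
   else if x <= ddelta then 20 * dm + x + dgamma
   else if x <= 7 * dm - 1 then 20 * dm + x + dgamma + 1
   else `|((20 * dm + x + dgamma + 1)%N%:Z + depsilon)%R|)%N.

Definition dr (j : nat) : nat :=
  (if j <= dM then rfun j else rfun (2 * dM - j))%N.

Definition dz_north (j : nat) : R :=
  1 - (1 + dr j + 2 * \sum_(1 <= k < j) dr k)%N%:R / (N - 1)%N%:R.

Definition dz (j : nat) : R :=
  if (j < dM)%N then dz_north j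
  else if j == dM then 0
  else - dz_north (2 * dM - j)%N.

Definition dpoint (theta : nat -> R) (j i : nat) : space3 R :=
  let s := Num.sqrt (1 - dz j ^+ 2) in
  let a := 2 * pi * i%:R / (dr j)%:R + theta j in
  (s * cos a, s * sin a, dz j).

Definition diamond_gen (theta : nat -> R) : {fset space3 R} :=
  [fset p in [:: (0, 0, 1); (0, 0, -1)] ++
     [seq dpoint theta j i | j <- iota 1 (2 * dM - 1)%N, i <- iota 1 (dr j)]]%fset.

End Diamond.

Section Constants.
Context {R : realType}.

Definition Wlog : R := 1 / 2 - ln 2.

(* Numerals of R are injected from unary nat, so the large coefficients are
   written in base k = 1000. *)
Definition c_diamond : R :=
  let k : R := 1000 in
  ((19 * k + 120) * ln 239 - (2 * k + 270) * ln 227 - (1 * k + 460) * ln 73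
   - 265 * ln 53 - (1 * k + 935) * ln 43 - 930 * ln 31 - (1 * k + 710) * ln 19
   - (1 * k + 938) * ln 17 + (19 * k + 825) * ln 13 + (1 * k + 750) * ln 7
   - (4 * k + 250) * ln 5 - (131 * k + 307) * ln 3 + (56 * k + 586) * ln 2
   - (7 * k + 170)) / (14 * k + 340).

End Constants.

Section Phases.
Context {d : measure_display} {T : measurableType d} {R : realType}
  (P : probability T R).

Lemma lt0_2pi : 0 < 2 * pi :> R.
Proof. by rewrite mulr_gt0// pi_gt0. Qed.

Definition uniform_phase (X : {RV P >-> R}) : Prop :=
  forall A : set R, measurable A ->
    distribution P X A = uniform_prob lt0_2pi A.

Definition mutually_independent (I : set nat) (X : nat -> {RV P >-> R}) : Prop :=
  forall (J : {fset nat}) (B : nat -> set R), [set` J] `<=` I ->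
    (forall j, measurable (B j)) ->
    P (\bigcap_(j in [set` J]) (X j @^-1` B j)) =
    (\prod_(j <- J) P (X j @^-1` B j))%E.

Definition random_phases (n : nat) (X : nat -> {RV P >-> R}) : Prop :=
  (forall j, (1 <= j <= n)%N -> uniform_phase (X j)) /\
  mutually_independent [set j | (1 <= j <= n)%N] X.

End Phases.

(* Main.v *)
(** Energy. For fixed rings the expected interaction of two rings at heights
    z > z' is explicit because the circle mean of ln |A - B e^(ix)|^2 is 2 ln A
    for A > B >= 0, and the interaction inside a ring of r points is explicit
    because the product of the chords from one of the r-th roots of unity to
    the others is r. With n = N - 1 and u_j = n (1 - z_j) this gives the
    expectation as - 2 n ln 2 + n (n - 1) ln n minus the sum over the rings of
    r ln r + r (u ln u + (2 n - u) ln (2 n - u)) / 2. If G is the primitive of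
    x ln x, then r u ln u = (G (u + r) - G (u - r)) / 2 - r^3 / (6 u) + O(1),
    the jumps of G telescope because u_j + r_j = u_(j+1) - r_(j+1), and the
    remaining sums of r ln r and r^3 / u are Riemann sums with explicit
    primitives on the six pieces where r_j is affine up to O(1).

    Discrepancy. Each ring point lies in a cell, a piece of a zone cut by a
    wedge; the cells are disjoint, have normalised area at least 1 / n and
    diameter O(1 / sqrt N), so a cap contains at most n times the area of a
    slightly larger cap, and complementary caps give the converse bound. From
    below, the cap through a ring of r points and a slightly larger one have
    nearly the same area but differ by r points. Areas of caps are ratios of
    volumes of cones; their invariance under rotations comes from Fubini, as a
    rotation is a composition of shears. *)

Require Import Defs.
From HB Require Import structures.
From mathcomp Require Import all_boot all_order all_algebra.
From mathcomp Require Import finmap.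
From mathcomp Require Import all_classical all_reals all_analysis.
From mathcomp Require Import measurable_realfun ring lra zify.
From mathcomp Require complex.

Set Implicit Arguments.
Unset Strict Implicit.
Unset Printing Implicit Defensive.

Import Order.TTheory GRing.Theory Num.Theory.
Import numFieldNormedType.Exports.

Local Open Scope classical_set_scope.
Local Open Scope ring_scope.

(** * Derivatives and trigonometry *)

Section PointwiseDerivatives.
Context {R : realType}.
Implicit Types (f g : R -> R) (x a b c : R).

(** There are fewer than [14 m] rings and [m] is of order [sqrt N], so an error [O(1 + ln m)] per
    ring is exactly what the remainder [O(sqrt N log N)] allows; every replacement in the energy
    estimate is measured against this budget. Ring sizes are [m] times a continuous piecewise affine
    function of [j / m], up to a bounded excess; by the trapezoidal rule [u_j] is then [m ^ 2] times
    a piecewise quadratic function, up to [O(j)]. Its value at the equator is [239 m ^ 2], which is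
    where 239 comes from. Writing [r ln r = r ln (r / m) + r ln m] isolates the scale: the second
    part sums exactly to [(N - 2) ln m] and produces [- (1 / 2) N ln N]. The quadratic function
    vanishes at the poles, so the comparison with a primitive fails on the first ring, which is
    estimated separately. The circle mean of the logarithm comes from an angle-doubling identity
    instead of Fourier series, and volumes are only compared, so that neither the area of the disc
    nor that of the sphere is ever computed. *)

Lemma pderiv_cst c x : is_derive x (1 : R) (fun=> c) 0.
Proof. exact: is_derive_cst. Qed.

Lemma pderiv_id x : is_derive x (1 : R) (fun y => y) 1.
Proof. exact: is_derive_id. Qed.

Lemma pderiv_add f g x a b : is_derive x (1 : R) f a -> is_derive x (1 : R) g b ->
  is_derive x (1 : R) (fun y => f y + g y) (a + b).
Proof. exact: is_deriveD. Qed.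

Lemma pderiv_sub f g x a b : is_derive x (1 : R) f a -> is_derive x (1 : R) g b ->
  is_derive x (1 : R) (fun y => f y - g y) (a - b).
Proof. exact: is_deriveB. Qed.

Lemma pderiv_opp f x a : is_derive x (1 : R) f a -> is_derive x (1 : R) (fun y => - f y) (- a).
Proof. exact: is_deriveN. Qed.

Lemma pderiv_mul f g x a b : is_derive x (1 : R) f a -> is_derive x (1 : R) g b ->
  is_derive x (1 : R) (fun y => f y * g y) (f x * b + g x * a).
Proof. exact: is_deriveM. Qed.

Lemma pderiv_scale c f x a : is_derive x (1 : R) f a ->
  is_derive x (1 : R) (fun y => c * f y) (c * a).
Proof. exact: is_deriveZ. Qed.

Lemma pderiv_eq f x a b : is_derive x (1 : R) f a -> a = b -> is_derive x (1 : R) f b.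
Proof. by move=> h <-. Qed.

Lemma pderiv_pow f n x a : is_derive x (1 : R) f a ->
  is_derive x (1 : R) (fun y => f y ^+ n.+1) ((n.+1)%:R * f x ^+ n * a).
Proof.
move=> df; elim: n => [|n IHn].
  by apply: pderiv_eq df _; rewrite expr0 mulr1 mul1r.
have := pderiv_mul df IHn; under eq_fun do rewrite -exprS.
have E : f x * (n.+1%:R * f x ^+ n * a) + f x ^+ n.+1 * a = n.+2%:R * f x ^+ n.+1 * a.
  by rewrite -[n.+2]addn1 natrD exprS; move: (n.+1%:R : R) => k; ring.
by rewrite E.
Qed.

Lemma pderiv_ln f x a : 0 < f x -> is_derive x (1 : R) f a ->
  is_derive x (1 : R) (fun y => ln (f y)) (a / f x).
Proof.
move=> fx df; have dl := is_derive1_ln fx.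
by have := is_derive1_comp dl df; rewrite mulrC.
Qed.

Lemma is_derive_continuous f x a : is_derive x (1 : R) f a -> {for x, continuous f}.
Proof. by move=> df; apply/differentiable_continuous/derivable1_diffP; have [] := df. Qed.

Lemma mean_value f (f' : R -> R) a b : a < b ->
  (forall x, a <= x <= b -> is_derive x (1 : R) f (f' x)) ->
  exists2 c, a < c < b & f b - f a = f' c * (b - a).
Proof.
move=> ab df; have [||c cab ->] := @MVT _ f f' a b ab.
- by move=> x /[!in_itv] /= /andP[h1 h2]; apply: df; rewrite !ltW.
- apply: derivable_within_continuous => x /[!in_itv] /= h.
  by have [] := df x h.
by exists c => //; rewrite in_itv in cab.
Qed.

Lemma derive_ge0_le f (f' : R -> R) a b : a <= b ->
  (forall x, a <= x <= b -> is_derive x (1 : R) f (f' x)) ->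
  (forall x, a <= x <= b -> 0 <= f' x) -> f a <= f b.
Proof.
rewrite le_eqVlt => /orP[/eqP -> //|ab] df f0.
have [c /andP[h1 h2] E] := mean_value ab df.
by rewrite -subr_ge0 E mulr_ge0 ?subr_ge0 ?f0 ?ltW // h1.
Qed.

Notation mu := (@lebesgue_measure R).

Lemma integral_primitive f (F : R -> R) a b : a <= b -> continuous f ->
  (forall x, is_derive x (1 : R) F (f x)) ->
  (\int[mu]_(x in `[a, b]) (f x)%:E = (F b - F a)%:E)%E.
Proof.
rewrite le_eqVlt => /orP[/eqP <- cf dF|ab cf dF].
  by rewrite subrr set_itv1 integral_set1.
have cF : continuous F by move=> x; exact: is_derive_continuous (dF x).
rewrite (@continuous_FTC2 _ f F) //.
- by apply: continuous_subspaceT.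
- split.
  + by move=> x _; have [] := dF x.
  + by apply: cvg_at_right_filter; exact: cF.
  + by apply: cvg_at_left_filter; exact: cF.
- by move=> x _; rewrite derive1E; have [_ ] := dF x.
Qed.

End PointwiseDerivatives.

Ltac pderiv :=
  cbv beta;
  lazymatch goal with
  | |- is_derive _ _ (fun _ => ?c) _ => exact: pderiv_cst
  | |- is_derive _ _ (fun y => y) _ => exact: pderiv_id
  | |- is_derive _ _ (fun y => @?f y + @?g y) _ => notypeclasses refine (@pderiv_add _ f g _ _ _ _ _); pderiv
  | |- is_derive _ _ (fun y => - @?f y) _ => notypeclasses refine (@pderiv_opp _ f _ _ _); pderiv
  | |- is_derive _ _ (fun y => @?f y * @?g y) _ => notypeclasses refine (@pderiv_mul _ f g _ _ _ _ _); pderiv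
  | |- is_derive _ _ (fun y => (@?f y) ^+ (S ?n)) _ => notypeclasses refine (@pderiv_pow _ f n _ _ _); pderiv
  | |- is_derive _ _ (fun y => ln (@?f y)) _ => notypeclasses refine (@pderiv_ln _ f _ _ _ _); [|pderiv]
  | _ => idtac
  end.

Ltac derive_by := notypeclasses refine (pderiv_eq _ _); [pderiv|cbv beta].

(** * Periodicity, polar coordinates and angular sectors *)

Section Angles.
Context {R : realType}.
Implicit Types x y a w : R.

Lemma sin_periodz (k : int) x : sin (x + k%:~R * (2 * pi)) = sin x.
Proof.
have nat_case (n : nat) (u : R) : sin (u + n%:R * (2 * pi)) = sin u.
  by rewrite !mulr_natl; exact: (periodicn (@sinD2pi R) n u).
case: k => n; first exact: nat_case.
rewrite -[in RHS](subrK ((n.+1)%:R * (2 * pi)) x) nat_case NegzE.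
by rewrite mulrNz mulNr.
Qed.

Lemma cos_periodz (k : int) x : cos (x + k%:~R * (2 * pi)) = cos x.
Proof.
by rewrite -!sinDpihalf addrAC sin_periodz.
Qed.

Lemma euclid_mod x w : 0 < w -> exists k : int, 0 <= x - k%:~R * w < w.
Proof.
move=> w0; exists (Num.floor (x / w)).
have /andP[h1 h2] := floor_itv (x / w).
rewrite subr_ge0 -ler_pdivlMr // h1 /= ltrBlDl.
by rewrite intrD ltr_pdivrMr // mulrDl mul1r in h2.
Qed.

Lemma polar x y : exists rho a, [/\ 0 <= rho, x = rho * cos a & y = rho * sin a].
Proof.
have s0 : 0 <= x ^+ 2 + y ^+ 2 by rewrite addr_ge0 // sqr_ge0.
have [s|s] := eqVneq (x ^+ 2 + y ^+ 2) 0.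
  have /andP[/eqP x0 /eqP y0] : (x == 0) && (y == 0).
    by rewrite -(sqrf_eq0 x) -(sqrf_eq0 y) -paddr_eq0 ?sqr_ge0 // s.
  by exists 0, 0; rewrite x0 y0 !mul0r.
have sp : 0 < x ^+ 2 + y ^+ 2 by rewrite lt_neqAle eq_sym s s0.
pose rho := Num.sqrt (x ^+ 2 + y ^+ 2); have r0 : 0 < rho by rewrite sqrtr_gt0.
have r2 : rho ^+ 2 = x ^+ 2 + y ^+ 2 by rewrite sqr_sqrtr.
have hx : -1 <= x / rho <= 1.
  by rewrite ler_pdivlMr // ler_pdivrMr //; apply/andP; split; nra.
have sE : 1 - (x / rho) ^+ 2 = (y / rho) ^+ 2.
  have r20 : rho ^+ 2 != 0 by rewrite r2.
  by rewrite !expr_div_n; apply: (mulIf r20); rewrite mulrBl !divfK // r2; ring.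
(* [acos] only reaches angles in [[0, pi]], so a point of the lower half plane takes the opposite
   angle. *)
have [y0|y0] := leP 0 y.
  exists rho, (acos (x / rho)); split; first exact: ltW.
    by rewrite acosK ?in_itv // mulrC divfK ?gt_eqF.
  rewrite sin_acos // sE sqrtr_sqr ger0_norm ?divr_ge0 // ?ltW //.
  by rewrite mulrC divfK ?gt_eqF.
exists rho, (- acos (x / rho)); split; first exact: ltW.
  by rewrite cosN acosK ?in_itv // mulrC divfK ?gt_eqF.
rewrite sinN sin_acos // sE sqrtr_sqr ler0_norm ?opprK; last first.
  by rewrite mulr_le0_ge0 ?invr_ge0 ?ltW.
by rewrite mulrC divfK ?gt_eqF.
Qed.

(** [1 - cos x = 2 sin (x / 2) ^ 2], and [x / 2] lies strictly between 0 and [pi]. This later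
    separates distinct points of a ring, distinct sectors and distinct roots of unity. *)
Lemma cos_lt1 x : 0 < x < 2 * pi -> cos x < 1.
Proof.
move=> /andP[x0 x2]; have -> : x = (x / 2) *+ 2 by rewrite -mulr_natr divfK.
have s0 : 0 < sin (x / 2).
  by apply: sin_gt0_pi; rewrite divr_gt0 //= ltr_pdivrMr // mulrC.
rewrite cos_mulr2n cos2sin2; have : 0 < sin (x / 2) ^+ 2 by rewrite exprn_gt0.
by move: (sin (x / 2) ^+ 2) => s hs; rewrite -mulr_natl; lra.
Qed.

Lemma lipschitz_cos x y : `|cos x - cos y| <= `|x - y|.
Proof.
wlog xy : x y / x < y.
  move=> h; case: (ltgtP x y) => [||->]; [exact: h| |by rewrite !subrr].
  by move=> /h; rewrite distrC (distrC y x).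
have [c _] := @MVT _ (@cos R) (fun x => - sin x) _ _ xy (fun x _ => is_derive_cos x) (continuous_subspaceT (@continuous_cos R)).
rewrite distrC => ->; rewrite normrM (distrC x y) normrN ler_piMl //; exact: sin_max.
Qed.

Lemma lipschitz_sin x y : `|sin x - sin y| <= `|x - y|.
Proof.
rewrite -!cosBpihalf; apply: le_trans (lipschitz_cos _ _) _.
by rewrite opprB addrA subrK.
Qed.

Lemma sin_lt0_pi x : pi < x < 2 * pi -> sin x < 0.
Proof.
move=> /andP[h1 h2]; rewrite -(subrK pi x) sinDpi oppr_lt0; apply: sin_gt0_pi.
by rewrite subr_gt0 h1 ltrBlDr -mulr2n -mulr_natl.
Qed.

(** With [t] the remainder of [x] modulo [2 pi], the first sign forces [t <= pi]; if moreover
    [w <= t], then [t - w] lies in [[0, pi]] and its sine cannot be negative. This turns two linear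
    inequalities into an interval of angles. *)
Lemma angle_in_sector x w : 0 < w <= pi -> 0 <= sin x -> sin (x - w) < 0 ->
  exists (k : int), 0 <= x - k%:~R * (2 * pi) < w.
Proof.
move=> /andP[w0 wpi] h1 h2; have p0 := @pi_gt0 R.
have [|k hk] := @euclid_mod x (2 * pi); first by rewrite mulr_gt0.
exists k; move: hk; set t := x - _ => /andP[t0 t2].
have xE : x = t + k%:~R * (2 * pi) by rewrite /t subrK.
rewrite xE sin_periodz in h1; rewrite xE addrAC sin_periodz in h2.
rewrite t0 /= ltNge; apply/negP => wt.
have tpi : t <= pi.
  by rewrite leNgt; apply/negP => h; move: h1; rewrite leNgt sin_lt0_pi // h.
by move: h2; rewrite ltNge sin_ge0_pi // subr_ge0 wt lerBlDr (le_trans tpi) // lerDl ltW.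
Qed.

End Angles.

(** * Measure-preserving maps and areas of spherical regions *)

Section SkewProduct.
Context d1 d2 (T1 : measurableType d1) (T2 : measurableType d2) (R : realType).
Variables (m1 : {sigma_finite_measure set T1 -> \bar R})
  (m2 : {sigma_finite_measure set T2 -> \bar R}).

(** The product measure integrates the measures of the sections over the first factor, and the
    section of the preimage over [x] is the preimage under [tau x] of a section. *)
Lemma product_measure_skewr (tau : T1 -> T2 -> T2) (A : set (T1 * T2)) :
  (forall x B, measurable B -> m2 (tau x @^-1` B) = m2 B) -> measurable A ->
  (m1 \x m2)%E ((fun p => (p.1, tau p.1 p.2)) @^-1` A) = (m1 \x m2)%E A.
Proof.
move=> htau mA; rewrite /product_measure1; apply: eq_integral => x _ /=.
rewrite -[RHS](htau x); last exact: measurable_xsection.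
by congr (m2 _); apply/seteqP; split => y /=; rewrite /xsection /= !inE.
Qed.

Lemma product_measure12 (A : set (T1 * T2)) : measurable A ->
  (m1 \x m2)%E A = (m1 \x^ m2)%E A.
Proof.
by move=> mA; apply: product_measure_unique => // B C mB mC /=; rewrite product_measure2E.
Qed.

(** The other iterated integral is needed here. Its agreement with the first is available for
    measurable sets, and the measurability of the whole map supplies it for the preimage. *)
Lemma product_measure_skewl (tau : T2 -> T1 -> T1) (A : set (T1 * T2)) :
  measurable_fun setT (fun p : T1 * T2 => (tau p.2 p.1, p.2)) ->
  (forall y B, measurable B -> m1 (tau y @^-1` B) = m1 B) -> measurable A ->
  (m1 \x m2)%E ((fun p => (tau p.2 p.1, p.2)) @^-1` A) = (m1 \x m2)%E A.
Proof.
move=> mtau htau mA; rewrite !product_measure12 //; last first.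
  by rewrite -[X in measurable X]setTI; exact: mtau.
rewrite /product_measure2; apply: eq_integral => x _ /=.
rewrite -[RHS](htau x); last exact: measurable_ysection.
by congr (m1 _); apply/seteqP; split => y /=; rewrite /ysection /= !inE.
Qed.

End SkewProduct.

Definition preserves d (T : measurableType d) (R : realType)
    (m : set T -> \bar R) (f : T -> T) : Prop :=
  measurable_fun setT f /\ forall A, measurable A -> m (f @^-1` A) = m A.

Lemma preserves_comp d (T : measurableType d) (R : realType)
    (m : set T -> \bar R) (f g : T -> T) :
  preserves m g -> preserves m f -> preserves m (g \o f).
Proof.
move=> [mg hg] [mf hf]; split; first exact: measurableT_comp.
move=> A mA; rewrite -[RHS](hg A mA) -[RHS]hf //.
by rewrite -[X in measurable X]setTI; exact: mg.
Qed.

Ltac mfun := repeat first [ exact: measurable_cst | exact: measurable_id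
  | exact: measurable_fst | exact: measurable_snd | assumption
  | exact: measurable_expR | exact: measurable_ln
  | apply: measurable_fun_pair | apply: measurable_funD | apply: measurable_funB
  | apply: measurable_funM | apply: measurable_funN | apply: measurable_funX
  | exact: (measurableT_comp measurable_fst) | exact: (measurableT_comp measurable_snd)
  | progress (apply: (measurableT_comp measurable_fst))
  | progress (apply: (measurableT_comp measurable_snd)) ].

(** Allows the product with a third copy of the line to be treated by the same lemmas. The
    exhausting sequences increase, so a point of [F i] and [G j] lies in the rectangle of index
    [maxn i j]. *)
Lemma product_measure_sigma_finite d1 d2 (T1 : measurableType d1) (T2 : measurableType d2)
    (R : realType) (m1 : {sigma_finite_measure set T1 -> \bar R})
    (m2 : {sigma_finite_measure set T2 -> \bar R}) : sigma_finite setT (m1 \x m2)%E.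
Proof.
have /sigma_finiteP[F [TF ndF Foo]] := sigma_finiteT m1.
have /sigma_finiteP[G [TG ndG Goo]] := sigma_finiteT m2.
exists (fun n => F n `*` G n); last first.
  move=> k; have [mF Fk] := Foo k; have [mG Gk] := Goo k.
  split; first exact: measurableX.
  by rewrite product_measure1E // lte_mul_pinfty // ge0_fin_numE.
apply/esym; rewrite -subTset => -[x y] _.
have [i _ Fi] : (\bigcup_k F k) x by rewrite -TF.
have [j _ Gj] : (\bigcup_k G k) y by rewrite -TG.
exists (maxn i j) => //; split => /=.
  exact: (subsetPset _ _ (ndF _ _ (leq_maxl i j))).
exact: (subsetPset _ _ (ndG _ _ (leq_maxr i j))).
Qed.

(** * Shears, rotations and dilations acting on Lebesgue measure *)

Section Lebesgue.
Context {R : realType}.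
Notation mu := (@lebesgue_measure R).
Notation RR := (measurableTypeR R).

Lemma measurable_fun_pairR d (T : measurableType d) (f g : T -> RR) :
  measurable_fun setT f -> measurable_fun setT g ->
  measurable_fun setT (fun x => (f x, g x)).
Proof. by move=> mf mg; exact: measurable_fun_pair. Qed.

(** A measure that agrees with Lebesgue measure on half-open intervals is equal to it; the same
    argument, with a factor, handles dilations. *)
Lemma lebesgue_measure_translate (c : R) (A : set R) : measurable A ->
  mu ((fun x : R => x + c) @^-1` A) = mu A.
Proof.
move=> mA; have mf : measurable_fun setT ((fun x => x + c) : RR -> RR).
  by apply: measurable_funD => //; exact: measurable_id.
apply/esym.
transitivity (pushforward mu ((fun x => x + c) : RR -> RR) A) => //.
apply/lebesgue_measure_unique => //= _ [[a b]] _ <- /=.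
rewrite /pushforward.
have -> : (fun x : RR => x + c) @^-1` [set` `]a, b]] = [set` `]a - c, b - c]].
  by apply/seteqP; split => x /=; rewrite !in_itv /= ltrBlDr lerBrDr.
rewrite !lebesgue_measure_itv /= !lte_fin ltrD2r.
by case: ifP => // _; rewrite -!EFinD opprB addrA subrK.
Qed.

Lemma lebesgue_measure_dilate (c : R) (A : set R) : 0 < c -> measurable A ->
  mu ((fun x : R => c * x) @^-1` A) = (c^-1%:E * mu A)%E.
Proof.
move=> c0 mA; have mf : measurable_fun setT ((fun x => c * x) : RR -> RR).
  by apply: measurable_funM => //; exact: measurable_id.
have ci : 0 <= c by exact: ltW.
suff -> : mu A = (c%:E * mu ((fun x : R => (c * x)%R) @^-1` A))%E.
  by rewrite muleA -EFinM mulVf ?gt_eqF // mul1e.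
pose m' := mscale (NngNum ci) (pushforward mu ((fun x => c * x) : RR -> RR)).
transitivity (m' mf A) => //.
apply/lebesgue_measure_unique => //= _ [[a b]] _ <- /=.
rewrite /m' /mscale /= /pushforward.
have -> : (fun x : RR => c * x) @^-1` [set` `]a, b]] = [set` `]c^-1 * a, c^-1 * b]].
  by apply/seteqP; split => x /=; rewrite !in_itv /= ltr_pdivrMl // ler_pdivlMl.
rewrite !lebesgue_measure_itv /= !lte_fin ltr_pM2l ?invr_gt0 //.
case: ifP => // _; last by rewrite mule0.
by rewrite -!EFinD -EFinM mulrBr !mulrA divff ?gt_eqF // !mul1r.
Qed.

Notation mu2 := (mu \x mu)%E.


Lemma preserves_plane_skewl (tau : RR -> RR -> RR) :
  measurable_fun setT (fun p : RR * RR => (tau p.2 p.1, p.2)) ->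
  (forall y, preserves mu (tau y)) ->
  preserves mu2 (fun p : RR * RR => (tau p.2 p.1, p.2)).
Proof.
move=> mtau htau; split => // A mA.
by apply: product_measure_skewl => // y B mB; exact: (htau y).2.
Qed.

Lemma preserves_plane_skewr (tau : RR -> RR -> RR) :
  measurable_fun setT (fun p : RR * RR => (p.1, tau p.1 p.2)) ->
  (forall y, preserves mu (tau y)) ->
  preserves mu2 (fun p : RR * RR => (p.1, tau p.1 p.2)).
Proof.
move=> mtau htau; split => // A mA.
by apply: product_measure_skewr => // y B mB; exact: (htau y).2.
Qed.

Lemma preserves_translate (c : R) : preserves mu ((fun x => x + c) : RR -> RR).
Proof.
split; first by mfun.
by move=> A mA; exact: lebesgue_measure_translate.
Qed.

Lemma preserves_plane_translate (b1 b2 : R) :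
  preserves mu2 ((fun p => (p.1 + b1, p.2 + b2)) : RR * RR -> RR * RR).
Proof.
apply: (@preserves_comp _ _ _ mu2 (fun p => (p.1 + b1, p.2)) (fun p => (p.1, p.2 + b2))).
- apply: (@preserves_plane_skewr (fun _ y => y + b2)); last by move=> _; exact: preserves_translate.
  by apply: measurable_fun_pairR; mfun.
- apply: (@preserves_plane_skewl (fun _ y => y + b1)); last by move=> _; exact: preserves_translate.
  by apply: measurable_fun_pairR; mfun.
Qed.

Lemma preserves_shear_x (a : R) :
  preserves mu2 ((fun p => (p.1 + a * p.2, p.2)) : RR * RR -> RR * RR).
Proof.
apply: (@preserves_plane_skewl (fun x y => y + a * x)).
  by apply: measurable_fun_pairR; mfun.
by move=> x; exact: preserves_translate.
Qed.

Lemma preserves_shear_y (a : R) :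
  preserves mu2 ((fun p => (p.1, p.2 + a * p.1)) : RR * RR -> RR * RR).
Proof.
apply: (@preserves_plane_skewr (fun x y => y + a * x)).
  by apply: measurable_fun_pairR; mfun.
by move=> x; exact: preserves_translate.
Qed.

Lemma preserves_plane_rotate (co si : R) : co ^+ 2 + si ^+ 2 = 1 ->
  preserves mu2 ((fun p => (co * p.1 - si * p.2, si * p.1 + co * p.2)) : RR * RR -> RR * RR).
Proof.
(* three shears with [t = si / (1 + co)], the tangent of the half angle *)
have rot c s : c ^+ 2 + s ^+ 2 = 1 -> c != - 1 ->
    preserves mu2 ((fun p => (c * p.1 - s * p.2, s * p.1 + c * p.2)) : RR * RR -> RR * RR).
  move=> cs cN; have c1 : 1 + c != 0 by rewrite addrC -subr_eq0 opprK in cN *.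
  have sE : s ^+ 2 = (1 - c) * (1 + c) by transitivity (c ^+ 2 + s ^+ 2 - c ^+ 2); [ring|rewrite cs; ring].
  pose t := s / (1 + c).
  have := preserves_comp (preserves_shear_x (- t)) (preserves_comp (preserves_shear_y s) (preserves_shear_x (- t))).
  congr preserves; apply/funext => -[x y] /=.
  have ts : s * t = 1 - c by rewrite /t mulrA -expr2 sE mulfK.
  have tc : t * (1 + c) = s by rewrite /t divfK.
  congr (_, _).
    transitivity ((1 - s * t) * x - (t * (1 + (1 - s * t))) * y); first by ring.
    rewrite ts; congr (_ * _ - _ * _); first by ring.
    by rewrite -[RHS]tc; congr (_ * _); ring.
  transitivity (s * x + (1 - s * t) * y); first by ring.
  by rewrite ts; congr (_ + _ * _); ring.
move=> cs; have [cE|] := eqVneq co (- 1); last exact: rot.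
have s0 : si = 0.
  by apply/eqP; rewrite -sqrf_eq0; apply/eqP; move: cs; rewrite cE sqrrN expr1n => /(congr1 (fun x => x - 1)); rewrite addrAC subrr add0r.
(* The half turn has no half-angle tangent; it is the square of the quarter turn. *)
have h : preserves mu2 ((fun p => (0 * p.1 - 1 * p.2, 1 * p.1 + 0 * p.2)) : RR * RR -> RR * RR).
  by apply: rot; [ring|rewrite eq_sym oppr_eq0 oner_eq0].
have := preserves_comp h h; congr preserves; apply/funext => -[x y] /=.
by rewrite cE s0; congr (_, _); ring.
Qed.

Lemma plane_dilate (c : R) (A : set (RR * RR)) : 0 < c -> measurable A ->
  mu2 ((fun p => (c * p.1, c * p.2)) @^-1` A) = ((c^-1 ^+ 2)%:E * mu2 A)%E.
Proof.
move=> c0 mA.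
have ci : 0 <= c ^+ 2 by rewrite exprn_ge0 // ltW.
have mf : measurable_fun setT ((fun p => (c * p.1, c * p.2)) : RR * RR -> RR * RR).
  by apply: measurable_fun_pairR => //; mfun.
suff -> : mu2 A = ((c ^+ 2)%:E * mu2 ((fun p => (c * p.1, c * p.2)%R) @^-1` A))%E.
  by rewrite muleA -EFinM -exprMn mulVf ?gt_eqF // expr1n mul1e.
pose m' := mscale (NngNum ci) (pushforward mu2
  ((fun p => (c * p.1, c * p.2)) : RR * RR -> RR * RR)).
transitivity (m' mf A) => //.
apply: product_measure_unique => // B C mB mC.
rewrite /m' /mscale /= /pushforward.
have mfc : measurable_fun setT ((fun x => c * x) : RR -> RR) by mfun.
have mc B' : measurable B' -> measurable ((fun x : RR => c * x) @^-1` B').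
  by move=> mB'; rewrite -[X in measurable X]setTI; exact: mfc.
transitivity ((c ^+ 2)%:E * mu2 (((fun x : RR => (c * x)%R) @^-1` B) `*` ((fun x : RR => (c * x)%R) @^-1` C)))%E; first by [].
rewrite product_measure1E; [|exact: mc..].
transitivity ((c ^+ 2)%:E * ((c^-1%:E * mu B) * (c^-1%:E * mu C)))%E.
  by rewrite -!lebesgue_measure_dilate.
rewrite muleACA -EFinM !muleA -EFinM -expr2 -exprMn.
by rewrite mulfV ?gt_eqF // expr1n mul1e.
Qed.


(* The library's canonical instance on [mu \x mu] only fires for
   subprobabilities, hence this explicit packing. *)
Definition plane_measure : {sigma_finite_measure set (RR * RR)%type -> \bar R} :=
  HB.pack_for {sigma_finite_measure set (RR * RR)%type -> \bar R} (mu \x mu)%E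
    (Measure_isSigmaFinite.Build _ _ _ (mu \x mu)%E (product_measure_sigma_finite mu mu)).

Notation mu3 := ((mu \x mu) \x mu)%E.
Notation R3 := (RR * RR * RR)%type.

Lemma preserves_vshear (c1 c2 : R) :
  preserves mu3 ((fun p => (p.1, p.2 + (c1 * p.1.1 + c2 * p.1.2))) : R3 -> R3).
Proof.
split; first by apply: measurable_fun_pair; mfun.
move=> A mA.
apply: (@product_measure_skewr _ _ _ _ _ plane_measure mu (fun q z => z + (c1 * q.1 + c2 * q.2))) => //.
by move=> q B mB; exact: lebesgue_measure_translate.
Qed.

Lemma preserves_vneg : preserves mu3 ((fun p => (p.1, - p.2)) : R3 -> R3).
Proof.
split; first by apply: measurable_fun_pair; mfun.
move=> A mA; apply: (@product_measure_skewr _ _ _ _ _ plane_measure mu (fun q z => - z)) => //.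
by move=> q B mB; exact: lebesgue_measureN.
Qed.

Lemma preserves_space_skewl (tau : RR -> RR * RR -> RR * RR) :
  measurable_fun setT (fun p : R3 => (tau p.2 p.1, p.2)) ->
  (forall y, preserves mu2 (tau y)) ->
  preserves mu3 (fun p : R3 => (tau p.2 p.1, p.2)).
Proof.
move=> mtau htau; split => // A mA.
apply: (@product_measure_skewl _ _ _ _ _ plane_measure mu tau) => //.
by move=> y B mB; exact: (htau y).2.
Qed.

Lemma preserves_hshear (b1 b2 : R) :
  preserves mu3 ((fun p => ((p.1.1 + b1 * p.2, p.1.2 + b2 * p.2), p.2)) : R3 -> R3).
Proof.
apply: (@preserves_space_skewl (fun z q => (q.1 + b1 * z, q.2 + b2 * z))).
  by apply: measurable_fun_pair; mfun.
by move=> z; exact: preserves_plane_translate.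
Qed.

Lemma preserves_rotate (co si : R) : co ^+ 2 + si ^+ 2 = 1 ->
  preserves mu3 ((fun p => ((co * p.1.1 - si * p.1.2, si * p.1.1 + co * p.1.2), p.2)) : R3 -> R3).
Proof.
move=> cs; apply: (@preserves_space_skewl (fun z q => (co * q.1 - si * q.2, si * q.1 + co * q.2))).
  by apply: measurable_fun_pair; mfun.
by move=> z; exact: preserves_plane_rotate.
Qed.

(** The rotation about a horizontal axis that takes the north pole to [z] factors into a horizontal,
    a vertical and a horizontal shear, as in the plane; [(u, v)] plays the role of the half-angle
    tangent. It is undefined at the south pole, where the reflection in the equatorial plane serves
    instead. *)
Lemma exists_tilt (z : space3 R) : dot z z = 1 ->
  exists T : R3 -> R3, [/\ preserves mu3 T,
    (forall p, dot z (T p) = p.2) & (forall p, dot (T p) (T p) = dot p p)].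
Proof.
case: z => [[a b] g]; rewrite /dot /= => zz.
have [gE|gN] := eqVneq g (- 1).
  have ab0 : a ^+ 2 + b ^+ 2 = 0.
    by transitivity (a * a + b * b + g * g - g * g); [ring|rewrite zz gE; ring].
  have a0 : a = 0.
    apply/eqP; rewrite -sqrf_eq0; apply/eqP/le_anti; rewrite sqr_ge0 andbT -ab0 lerDl sqr_ge0 //.
  have b0 : b = 0.
    apply/eqP; rewrite -sqrf_eq0; apply/eqP/le_anti; rewrite sqr_ge0 andbT -ab0 lerDr sqr_ge0 //.
  exists (fun p => (p.1, - p.2)); split; first exact: preserves_vneg.
    by move=> p /=; rewrite a0 b0 gE; ring.
  by move=> p /=; ring.
have g1 : 1 + g != 0 by rewrite addrC -subr_eq0 opprK in gN *.
pose u := a / (1 + g); pose v := b / (1 + g).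
have au : a = u * (1 + g) by rewrite /u divfK.
have bv : b = v * (1 + g) by rewrite /v divfK.
have uv : (u ^+ 2 + v ^+ 2) * (1 + g) = 1 - g.
  apply: (mulIf g1); transitivity (a * a + b * b + g * g - g * g).
    by rewrite {1 2}au {1 2}bv; ring.
  by rewrite zz; ring.
have gu : g * (1 + u ^+ 2 + v ^+ 2) = 1 - u ^+ 2 - v ^+ 2.
  transitivity ((u ^+ 2 + v ^+ 2) * (1 + g) - (u ^+ 2 + v ^+ 2) + g); first by ring.
  by rewrite uv; ring.
have s0 : 1 + u ^+ 2 + v ^+ 2 != 0.
  by rewrite gt_eqF // -addrA ltr_pwDl // addr_ge0 // sqr_ge0.
have gE : g = (1 - u ^+ 2 - v ^+ 2) / (1 + u ^+ 2 + v ^+ 2) by rewrite -gu mulfK.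
have := preserves_comp (preserves_hshear u v) (preserves_comp (preserves_vshear (- a) (- b)) (preserves_hshear u v)).
set T := (_ \o _) => pT; exists T; split => //.
  move=> [[x y] w]; rewrite /T /= au bv gE; field.
  by [].
move=> [[x y] w]; rewrite /T /= au bv gE; field.
by [].
Qed.

End Lebesgue.

(** * Volumes of cones over caps *)

Section ConeVolume.
Context {R : realType}.
Notation mu := (@lebesgue_measure R).
Notation RR := (measurableTypeR R).
Notation mu2 := (mu \x mu)%E.
Notation mu3 := ((mu \x mu) \x mu)%E.
Notation R3 := (RR * RR * RR)%type.

Lemma measurable_set_lt d (T : measurableType d) (f g : T -> RR) :
  measurable_fun setT f -> measurable_fun setT g -> measurable [set x | (f x < g x)%R].
Proof.
move=> mf mg; have := measurable_fun_ltr mf mg => /(_ measurableT [set true] I).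
by rewrite setTI; congr measurable; apply/seteqP; split => x /=.
Qed.

Lemma measurable_set_le d (T : measurableType d) (f g : T -> RR) :
  measurable_fun setT f -> measurable_fun setT g -> measurable [set x | (f x <= g x)%R].
Proof.
move=> mf mg; have := measurable_fun_ler mf mg => /(_ measurableT [set true] I).
by rewrite setTI; congr measurable; apply/seteqP; split => x /=.
Qed.

Definition odisc (r : R) : set (RR * RR) := [set q | q.1 ^+ 2 + q.2 ^+ 2 < r].
Definition cdisc (r : R) : set (RR * RR) := [set q | q.1 ^+ 2 + q.2 ^+ 2 <= r].

Lemma measurable_odisc r : measurable (odisc r).
Proof. by apply: measurable_set_lt; mfun. Qed.

Lemma measurable_cdisc r : measurable (cdisc r).
Proof. by apply: measurable_set_le; mfun. Qed.

(* Only ratios of areas matter below, so that its value [pi] is never needed. *)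
Definition disc_area : R := fine (mu2 (odisc 1)).

(** An inscribed and a circumscribed square suffice: the area must only be finite and nonzero, since
    it cancels in every ratio. *)
Lemma odisc1_bounds : (1%:E <= mu2 (odisc 1) <= 4%:E)%E.
Proof.
apply/andP; split.
  have <- : mu2 ([set` `[-(2^-1), 2^-1]] `*` [set` `[-(2^-1), 2^-1]] : set (RR * RR)) = 1%:E.
    rewrite product_measure1E //= [X in (X * _)%E]lebesgue_measure_itv [X in (_ * X)%E]lebesgue_measure_itv /= lte_fin.
    rewrite ifT; last by lra.
    by rewrite -!EFinD -EFinM; congr (_%:E); field.
  apply: le_measure; rewrite ?inE; [exact: measurableX|exact: measurable_odisc|].
  move=> [x y] /= [] /=; rewrite !in_itv /= => /andP[? ?] /andP[? ?].
  by rewrite /odisc /=; nra.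
have <- : mu2 ([set` `[-1, 1]] `*` [set` `[-1, 1]] : set (RR * RR)) = 4%:E.
  rewrite product_measure1E //= [X in (X * _)%E]lebesgue_measure_itv [X in (_ * X)%E]lebesgue_measure_itv /= lte_fin.
  rewrite ifT; last by lra.
  by rewrite -!EFinD -EFinM; congr (_%:E); ring.
apply: le_measure; rewrite ?inE; [exact: measurable_odisc|exact: measurableX|].
move=> [x y]; rewrite /odisc /= => h; split; rewrite /= in_itv /=.
  by apply/andP; split; nra.
by apply/andP; split; nra.
Qed.

Lemma disc_areaE : mu2 (odisc 1) = disc_area%:E.
Proof.
have /andP[h1 h2] := odisc1_bounds.
rewrite /disc_area fineK // ge0_fin_numE //; first exact: le_lt_trans h2 (ltry _).
Qed.

Lemma disc_area_ge1 : 1 <= disc_area.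
Proof. by have /andP[+ _] := odisc1_bounds; rewrite disc_areaE lee_fin. Qed.

Lemma odisc_area r : 0 <= r -> mu2 (odisc r) = (disc_area * r)%:E.
Proof.
rewrite le_eqVlt => /orP[/eqP <-|r0].
  rewrite mulr0 (_ : odisc 0 = set0) ?measure0 // -subset0 => -[x y].
  by rewrite /odisc /= => h; have := addr_ge0 (sqr_ge0 x) (sqr_ge0 y); rewrite leNgt h.
have s0 : 0 < (Num.sqrt r)^-1 by rewrite invr_gt0 sqrtr_gt0.
have := plane_dilate s0 (measurable_odisc 1).
rewrite disc_areaE invrK sqr_sqrtr ?ltW // -EFinM mulrC => <-.
congr (mu2 _); apply/seteqP; split => -[x y]; rewrite /odisc /=.
  by rewrite !exprMn -mulrDr exprVn sqr_sqrtr ?ltW // ltr_pdivrMl // mulr1.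
by rewrite !exprMn -mulrDr exprVn sqr_sqrtr ?ltW // ltr_pdivrMl // mulr1.
Qed.

(** From above, the closed disc lies in an open disc whose squared radius is larger by
    [e / disc_area], hence whose area is larger by [e]. *)
Lemma cdisc_area r : 0 <= r -> mu2 (cdisc r) = (disc_area * r)%:E.
Proof.
move=> r0; have k1 := disc_area_ge1; have k0 : 0 < disc_area by exact: lt_le_trans k1.
apply/eqP; rewrite eq_le; apply/andP; split; last first.
  rewrite -odisc_area //; apply: le_measure; rewrite ?inE; [exact: measurable_odisc|exact: measurable_cdisc|].
  by move=> q; exact: ltW.
apply/lee_addgt0Pr => e e0.
have -> : ((disc_area * r)%:E + e%:E = mu2 (odisc (r + e / disc_area)))%E.
  rewrite odisc_area; first by rewrite -EFinD mulrDr mulrCA divff ?mulr1 ?gt_eqF.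
  by rewrite addr_ge0 // divr_ge0 // ltW.
apply: le_measure; rewrite ?inE; [exact: measurable_cdisc|exact: measurable_odisc|].
by move=> q; rewrite /odisc /cdisc /= => h; apply: le_lt_trans h _; rewrite ltrDl divr_gt0.
Qed.

(** The origin is left out because the cone over a set of unit vectors only contains multiples [r x]
    with [r > 0]. *)
Definition ball3 : set R3 := [set p | 0 < dot p p <= 1].
Definition ocone (z : R3) (t : R) : set R3 := [set p | 0 < dot p p <= 1 /\ t * enorm p < dot z p].
Definition ccone (z : R3) (t : R) : set R3 := [set p | 0 < dot p p <= 1 /\ t * enorm p <= dot z p].

Lemma measurable_dot (z : R3) : measurable_fun setT (fun p : R3 => dot z p : RR).
Proof. by rewrite /dot; mfun. Qed.

Lemma measurable_sqnorm : measurable_fun setT (fun p : R3 => dot p p : RR).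
Proof. by rewrite /dot; mfun. Qed.

Lemma measurable_enorm : measurable_fun setT (fun p : R3 => enorm p : RR).
Proof.
apply: (measurableT_comp _ measurable_sqnorm).
exact: continuous_measurable_fun (@sqrt_continuous R).
Qed.

Lemma measurable_ball3 : measurable ball3.
Proof.
have -> : ball3 = [set p | 0 < dot p p] `&` [set p | dot p p <= 1].
  by apply/seteqP; split => p /=; [move=> /andP[]|move=> [h1 h2]; apply/andP].
apply: measurableI; [apply: measurable_set_lt|apply: measurable_set_le] => //; exact: measurable_sqnorm.
Qed.

Lemma measurable_ocone z t : measurable (ocone z t).
Proof.
apply: measurableI; first exact: measurable_ball3.
apply: measurable_set_lt; last exact: measurable_dot.
by apply: measurable_funM => //; exact: measurable_enorm.
Qed.

Lemma measurable_ccone z t : measurable (ccone z t).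
Proof.
apply: measurableI; first exact: measurable_ball3.
apply: measurable_set_le; last exact: measurable_dot.
by apply: measurable_funM => //; exact: measurable_enorm.
Qed.

Lemma mul_sqrt_lt (t s w : R) : 0 <= t -> 0 <= s -> 0 < w ->
  (t * Num.sqrt s < w) = (t ^+ 2 * s < w ^+ 2).
Proof.
move=> t0 s0 w0; have h0 : 0 <= t * Num.sqrt s by rewrite mulr_ge0 // sqrtr_ge0.
have -> : t ^+ 2 * s = (t * Num.sqrt s) ^+ 2 by rewrite exprMn sqr_sqrtr.
by rewrite ltr_pXn2r // nnegrE ltW.
Qed.

Let e3 : R3 := (0, 0, 1).

Lemma dot_e3 (p : R3) : dot e3 p = p.2.
Proof. by rewrite /dot /= !mul0r !add0r mul1r. Qed.

(** At heights up to [t] the section is bounded by the lateral surface of the cone; the bound on the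
    norm is then automatic, since it is less than [w / t <= 1]. *)
Lemma ysection_ocone_lo t w : 0 < w -> w <= t -> t <= 1 ->
  ysection (ocone e3 t) w = odisc (w ^+ 2 * (t ^- 2 - 1)).
Proof.
move=> w0 wt t1; have t0 : 0 < t by exact: lt_le_trans wt.
have t20 : 0 < t ^+ 2 by rewrite exprn_gt0.
have tt : t ^+ 2 * t ^- 2 = 1 by rewrite divff ?gt_eqF.
have w2t : w ^+ 2 <= t ^+ 2 by rewrite ler_pXn2r ?nnegrE // ltW.
have w20 : 0 < w ^+ 2 by rewrite exprn_gt0.
apply/seteqP; split => -[x y]; rewrite /ysection /= !inE /ocone /odisc /= dot_e3 /= /enorm.
  move=> [/andP[h1 h2]]; rewrite mul_sqrt_lt //; last exact: ltW.
    by rewrite -(ltr_pdivlMl _ _ t20) /dot /= -!expr2 mulrBr mulr1 [t ^- 2 * _]mulrC; lra.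
  exact: ltW.
have s0 : 0 < dot (x, y, w) (x, y, w) by rewrite /dot /=; nra.
move=> h; have h' : t ^+ 2 * dot (x, y, w) (x, y, w) < w ^+ 2.
  by rewrite -(ltr_pdivlMl _ _ t20) /dot /= -!expr2 [t ^- 2 * _]mulrC; move: h; rewrite mulrBr mulr1; lra.
split; last by rewrite mul_sqrt_lt // ltW.
rewrite s0 /= -(@ler_pM2l _ (t ^+ 2)) // mulr1; apply: le_trans _ w2t; exact: ltW.
Qed.

(** Above height [t] the section is bounded by the sphere, and the cone inequality is automatic
    because [t * enorm p <= t < w]. *)
Lemma ysection_ocone_hi t w : 0 <= t -> t < w -> w <= 1 ->
  ysection (ocone e3 t) w = cdisc (1 - w ^+ 2).
Proof.
move=> t0 tw w1; have w0 : 0 < w by exact: le_lt_trans tw.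
apply/seteqP; split => -[x y]; rewrite /ysection /= !inE /ocone /cdisc /= dot_e3 /= /enorm.
  by move=> [/andP[h1 h2]] _; move: h2; rewrite /dot /= -!expr2; lra.
move=> h; have s1 : dot (x, y, w) (x, y, w) <= 1 by rewrite /dot /= -!expr2; lra.
have s0 : 0 < dot (x, y, w) (x, y, w) by rewrite /dot /=; nra.
rewrite s0 s1; split => //; rewrite mul_sqrt_lt //; last exact: ltW.
apply: (@le_lt_trans _ _ (t ^+ 2)); first by rewrite ler_piMr // exprn_ge0.
by rewrite ltr_pXn2r ?nnegrE // ltW.
Qed.

Lemma is_derive_cubic (a b x : R) :
  is_derive x (1 : R) (fun w => a * w + b * (w ^+ 3 / 3)) (a + b * x ^+ 2).
Proof.
by derive_by; field.
Qed.

Lemma continuous_quadratic (a b : R) : continuous (fun w : R => a + b * w ^+ 2).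
Proof.
move=> x; apply: cvgD; first exact: cvg_cst.
by apply: cvgM; [exact: cvg_cst|exact: exprn_continuous].
Qed.

Lemma integral_quadratic (a b u v : R) : u <= v ->
  (\int[mu]_(w in `]u, v]) (a + b * w ^+ 2)%:E = (a * (v - u) + b * (v ^+ 3 - u ^+ 3) / 3)%:E)%E.
Proof.
move=> uv; rewrite integral_itv_obnd_cbnd; last first.
  by apply/measurable_EFinP; apply: measurable_funTS; mfun.
have /= -> := @integral_primitive R _ _ _ _ uv (@continuous_quadratic a b) (@is_derive_cubic a b).
by congr (_%:E); field.
Qed.

(** Cavalieri's principle along the axis: the areas of the horizontal sections are quadratic in the
    height, with different coefficients below and above [t]. *)
Lemma volume_ocone_ge0 t : 0 <= t <= 1 -> mu3 (ocone e3 t) = (2 / 3 * disc_area * (1 - t))%:E.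
Proof.
move=> /andP[t0 t1]; have k1 := disc_area_ge1.
transitivity ((plane_measure \x mu)%E (ocone e3 t)) => //.
rewrite product_measure12; last exact: measurable_ocone.
rewrite /product_measure2.
have mf : measurable_fun setT (fun w => mu2 (ysection (ocone e3 t) w)).
  by apply: (measurable_fun_ysection plane_measure); exact: measurable_ocone.
transitivity (\int[mu]_(w in `]0%R, 1%R]) (mu2 (ysection (ocone e3 t) w)))%E.
  rewrite [RHS]integral_mkcond; apply: eq_integral => w _ /=.
  rewrite /patch; case: ifPn => //; rewrite notin_setE /= in_itv /= => /negP.
  rewrite negb_and -!leNgt -ltNge => hw.
  rewrite (_ : ysection _ _ = set0) ?measure0 // -subset0 => -[x y].
  rewrite /ysection /= !inE /ocone /= dot_e3 /= => -[/andP[h1 h2] h3].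
  case/orP: hw => hw; last by move: h2; rewrite /dot /=; nra.
  by have := le_lt_trans (mulr_ge0 t0 (sqrtr_ge0 _)) h3; lra.
have -> : [set` `]0%R, 1%R]] = [set` `]0, t]] `|` [set` `]t, 1]] :> set R.
  by rewrite -itv_bndbnd_setU.
rewrite ge0_integral_setU //; [|by apply: measurable_funTS|]; last first.
  rewrite disj_set2E; apply/eqP; rewrite -subset0 => x [] /=; rewrite !in_itv /= => /andP[_ h1] /andP[h2 _].
  by move: h1; rewrite leNgt h2.
transitivity ((disc_area * (t - t ^+ 3) / 3)%:E + (disc_area * (1 - t - (1 - t ^+ 3) / 3))%:E)%E; last first.
  by rewrite -EFinD; congr (_%:E); field.
congr (_ + _)%E.
  (* For [t = 0] the lower range is empty, while the formula for its sections would involve the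
     meaningless [t ^- 2]. *)
  have [->|tn0] := eqVneq t 0.
    by rewrite set_itvoc0 integral_set0 // !expr0n /= subrr mulr0 mul0r.
  transitivity (\int[mu]_(w in `]0%R, t]) (0 + (disc_area * (t ^- 2 - 1)) * w ^+ 2)%:E)%E.
    apply: eq_integral => w; rewrite inE /= in_itv /= => /andP[w0 wt].
    rewrite ysection_ocone_lo // odisc_area; first by congr (_%:E); ring.
    rewrite mulr_ge0 ?exprn_ge0 ?(ltW w0) // subr_ge0 invf_ge1 ?exprn_gt0 // ?exprn_ile1 //.
    by rewrite lt_neqAle eq_sym tn0.
  by rewrite integral_quadratic //; congr (_%:E); field.
transitivity (\int[mu]_(w in `]t, 1%R]) (disc_area + (- disc_area) * w ^+ 2)%:E)%E.
  apply: eq_integral => w; rewrite inE /= in_itv /= => /andP[w0 wt].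
  rewrite ysection_ocone_hi // cdisc_area; first by congr (_%:E); ring.
  by rewrite subr_ge0 exprn_ile1 // ltW // (le_lt_trans t0).
by rewrite integral_quadratic //; congr (_%:E); field.
Qed.


Lemma plane_null : mu3 [set p : R3 | p.2 = 0] = 0%E.
Proof.
have -> : [set p : R3 | p.2 = 0] = setT `*` [set 0].
  by apply/seteqP; split => -[q w] /= => [->//|[]].
by rewrite product_measure1E //= lebesgue_measure_set1 mule0.
Qed.

Let vneg : R3 -> R3 := fun p => (p.1, - p.2).

Lemma dot_vneg p : dot (vneg p) (vneg p) = dot p p.
Proof. by rewrite /dot /= mulrNN. Qed.

Lemma enorm_gt0 (p : R3) : 0 < dot p p -> 0 < enorm p.
Proof. by rewrite /enorm sqrtr_gt0. Qed.

Lemma volumeU (A B : set R3) : measurable A -> measurable B -> A `&` B = set0 ->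
  mu3 (A `|` B) = (mu3 A + mu3 B)%E.
Proof. exact: measureU. Qed.

Lemma volume_le (A B : set R3) : measurable A -> measurable B -> A `<=` B ->
  (mu3 A <= mu3 B)%E.
Proof. by move=> mA mB AB; apply: le_measure; rewrite ?inE. Qed.

Lemma volume_preimage T A (B : set R3) : preserves mu3 T -> measurable A ->
  T @^-1` A = B -> mu3 B = mu3 A.
Proof. by move=> pT mA <-; exact: pT.2. Qed.

Lemma measurable_preimage (T : R3 -> R3) A : preserves mu3 T -> measurable A -> measurable (T @^-1` A).
Proof. by move=> pT mA; rewrite -[X in measurable X]setTI; exact: pT.1. Qed.

(** Two mirror-image open half balls and an equatorial disc of measure zero. *)
Lemma volume_ball3 : mu3 ball3 = (4 / 3 * disc_area)%:E.
Proof.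
have E : ball3 = (ocone e3 0 `|` vneg @^-1` (ocone e3 0)) `|` (ball3 `&` [set p | p.2 = 0]).
  apply/seteqP; split => p; rewrite /ball3 /ocone /= !dot_e3 dot_vneg mul0r /=.
    by move=> h; case: (ltrgt0P p.2) => h2; [left; left|left; right|right]; rewrite ?mul0r ?oppr_gt0.
  by case=> [[[]|[]]|[]].
have m1 := measurable_ocone e3 0.
have m2 : measurable (vneg @^-1` (ocone e3 0)) by apply: measurable_preimage => //; exact: preserves_vneg.
have m3 : measurable (ball3 `&` [set p | p.2 = 0]).
  apply: measurableI; first exact: measurable_ball3.
  have -> : [set p : R3 | p.2 = 0] = setT `*` [set 0].
    by apply/seteqP; split => -[q w] /= => [->//|[]].
  exact: measurableX.
rewrite E volumeU //; [|exact: measurableU|]; last first.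
  rewrite -subset0 => p [] [] [_ +] [_ /= h].
    by rewrite dot_e3 h mul0r ltxx.
  by rewrite dot_e3 /= h mul0r oppr0 ltxx.
rewrite volumeU //; last first.
  rewrite -subset0 => p [] [_ +] [_]; rewrite !dot_e3 !mul0r /= oppr_gt0 => h1 h2.
  by move: (lt_trans h1 h2); rewrite ltxx.
have -> : mu3 (ball3 `&` [set p | p.2 = 0]) = 0%E.
  apply: (@subset_measure0 _ _ _ _ _ [set p : R3 | p.2 = 0]) => //; last exact: plane_null.
  have -> : [set p : R3 | p.2 = 0] = setT `*` [set 0].
    by apply/seteqP; split => -[q w] /= => [->//|[]].
  exact: measurableX.
rewrite adde0 [X in (_ + X)%E](_ : _ = mu3 (ocone e3 0)); last first.
  by apply: preserves_vneg.2.
rewrite volume_ocone_ge0; last by rewrite lexx ler01.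
by rewrite -EFinD; congr (_%:E); field.
Qed.

Lemma volume_ccone_gt0 t : 0 < t <= 1 -> mu3 (ccone e3 t) = (2 / 3 * disc_area * (1 - t))%:E.
Proof.
move=> /andP[t0 t1]; have k1 := disc_area_ge1.
have k0 : 0 < disc_area by exact: lt_le_trans k1.
apply/eqP; rewrite eq_le; apply/andP; split; last first.
  rewrite -volume_ocone_ge0 ?(ltW t0) ?t1 //; apply: volume_le; [exact: measurable_ocone|exact: measurable_ccone|].
  by move=> p [h1 h2]; split => //; exact: ltW.
apply/lee_addgt0Pr => e e0.
(* Lowering the level by [e / (2 / 3 * disc_area)] costs the volume [e]. If that would make the
   level negative, level 0 is already within the tolerance, and [volume_ocone_ge0] applies in both
   cases. *)
have [s [s0 st se]] : exists s, [/\ 0 <= s, s < t & 2 / 3 * disc_area * (1 - s) <= 2 / 3 * disc_area * (1 - t) + e].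
  have [h|h] := leP (t * (2 / 3 * disc_area)) e.
    by exists 0; split => //; nra.
  exists (t - e / (2 / 3 * disc_area)); split.
  - by rewrite subr_ge0 ler_pdivrMr ?mulr_gt0 // ltW.
  - by rewrite ltrBlDr ltrDl divr_gt0 // mulr_gt0.
  - by rewrite le_eqVlt; apply/orP; left; apply/eqP; field; rewrite gt_eqF.
apply: (@le_trans _ _ (mu3 (ocone e3 s))); last first.
  by rewrite volume_ocone_ge0 ?s0 ?(le_trans (ltW st)) // -EFinD lee_fin.
apply: volume_le; [exact: measurable_ccone|exact: measurable_ocone|].
move=> p [h1 h2]; split => //; apply: lt_le_trans h2.
by rewrite ltr_pM2r // enorm_gt0 //; case/andP: h1.
Qed.

(** For negative [t] the complement in the ball is the reflection of the closed cone of level [- t];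
    this is the purpose of [ccone]. *)
Lemma volume_ocone_e3 t : -1 <= t <= 1 -> mu3 (ocone e3 t) = (2 / 3 * disc_area * (1 - t))%:E.
Proof.
move=> /andP[tN t1]; have [t0|t0] := leP 0 t; first by apply: volume_ocone_ge0; rewrite t0.
have m1 := measurable_ocone e3 t; have m2 := measurable_ccone e3 (- t).
have m3 : measurable (vneg @^-1` (ccone e3 (- t))).
  by apply: measurable_preimage => //; exact: preserves_vneg.
have E : ball3 = ocone e3 t `|` vneg @^-1` (ccone e3 (- t)).
  apply/seteqP; split => p; rewrite /ball3 /ocone /ccone /= !dot_e3 dot_vneg /enorm dot_vneg /= mulNr lerN2.
    by move=> h; case: (ltP (t * Num.sqrt (dot p p)) p.2) => h2; [left|right].
  by case=> [[]|[]].
have := volume_ball3; rewrite E volumeU //; last first.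
  rewrite -subset0 => p [] [_ +] [_]; rewrite !dot_e3 /enorm dot_vneg /= mulNr lerN2.
  by rewrite ltNge => /negP.
have -> : mu3 (vneg @^-1` ccone e3 (- t)) = mu3 (ccone e3 (- t)) by apply: preserves_vneg.2.
rewrite volume_ccone_gt0 ?oppr_gt0 ?t0 1?lerNl // => h.
have -> : mu3 (ocone e3 t) = ((4 / 3 * disc_area)%:E - (2 / 3 * disc_area * (1 - - t))%:E)%E.
  by rewrite -h addeK.
by rewrite -EFinB; congr (_%:E); field.
Qed.

Lemma volume_ocone z t : dot z z = 1 -> -1 <= t <= 1 ->
  mu3 (ocone z t) = (2 / 3 * disc_area * (1 - t))%:E.
Proof.
move=> zz ht; have [T [pT hz hn]] := exists_tilt zz.
have E : T @^-1` ocone z t = ocone e3 t.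
  by apply/seteqP; split => p; rewrite /ocone /= hz /enorm hn dot_e3.
by rewrite -(volume_ocone_e3 ht) -(@volume_preimage T _ _ pT (measurable_ocone z t) E).
Qed.

Lemma sphereE (z : R3) : sphere z <-> dot z z = 1.
Proof.
rewrite /sphere /= /enorm; split => [h|->]; last by rewrite sqrtr1.
have d0 : 0 <= dot z z by rewrite /dot -!expr2 !addr_ge0 // sqr_ge0.
by rewrite -(sqr_sqrtr d0) h expr1n.
Qed.

Lemma dot_scale (r : R) (z x : R3) : dot z (r * x.1.1, r * x.1.2, r * x.2) = r * dot z x.
Proof. by rewrite /dot /=; ring. Qed.

Lemma dot_scale2 (r : R) (x : R3) :
  dot (r * x.1.1, r * x.1.2, r * x.2) (r * x.1.1, r * x.1.2, r * x.2) = r ^+ 2 * dot x x.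
Proof. by rewrite /dot /=; ring. Qed.

Definition cone (A : set R3) : set R3 := [set p | exists r x, [/\ (0 < r <= 1)%R, A x &
  p = (r * x.1.1, r * x.1.2, r * x.2)%R]].

(** A point of the cone determines its unit vector, so the existential description becomes a
    condition on the normalised point. *)
Lemma coneE (A : set R3) : A `<=` sphere ->
  cone A = ball3 `&` [set p | A ((enorm p)^-1 * p.1.1, (enorm p)^-1 * p.1.2, (enorm p)^-1 * p.2)].
Proof.
move=> AS; apply/seteqP; split => p.
  move=> [r [x [/andP[r0 r1] Ax ->]]]; have /sphereE xx := AS _ Ax.
  split => /=; first by rewrite /ball3 /= dot_scale2 xx mulr1 exprn_gt0 // exprn_ile1 // ltW.
  rewrite /enorm dot_scale2 xx mulr1 sqrtr_sqr gtr0_norm // !mulKf ?gt_eqF //.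
  by case: x Ax {xx} => [[]].
move=> [/andP[p0 p1] Ap]; have n0 := enorm_gt0 p0.
exists (enorm p), ((enorm p)^-1 * p.1.1, (enorm p)^-1 * p.1.2, (enorm p)^-1 * p.2); split => //.
  by rewrite n0 /= -(sqrtr1 R) ler_sqrt.
by rewrite /= !mulVKf ?gt_eqF //; case: p {p0 p1 Ap n0} => [[]].
Qed.

Lemma cone_cap z t : cone (cap z t) = ocone z t.
Proof.
rewrite coneE; last by move=> x [].
apply/seteqP; split => p [hb /=].
  move=> [_ h]; split => //; case/andP: hb => /enorm_gt0 n0 _.
  by move: h; rewrite dot_scale ltr_pdivlMl // [enorm p * _]mulrC.
move=> h; split => //; case/andP: hb => p0 _; have n0 := enorm_gt0 p0.
rewrite /cap /= dot_scale ltr_pdivlMl // [enorm p * _]mulrC; split => //.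
by apply/sphereE; rewrite dot_scale2 exprVn /enorm sqr_sqrtr ?mulVf ?gt_eqF // ltW.
Qed.

Lemma cone_sphere : cone sphere = ball3.
Proof.
rewrite coneE //; apply/seteqP; split => p; first by case.
move=> hb; split => //=; case/andP: hb => p0 _; apply/sphereE.
by rewrite dot_scale2 exprVn /enorm sqr_sqrtr ?mulVf ?gt_eqF // ltW.
Qed.

(** Archimedes: the area of a cap is proportional to its height. The factor 3 and [disc_area] cancel
    in the quotient. *)
Lemma cap_area_ratio z t : sphere z -> -1 <= t <= 1 ->
  fine (surface_measure (cap z t)) / fine (surface_measure (@sphere R)) = (1 - t) / 2.
Proof.
move=> /sphereE zz ht; have k1 := disc_area_ge1.
have -> : surface_measure (cap z t) = (3%:E * mu3 (cone (cap z t)))%E by [].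
have -> : surface_measure (@sphere R) = (3%:E * mu3 (cone sphere))%E by [].
rewrite cone_cap cone_sphere volume_ocone // volume_ball3 -!EFinM /=.
by field; rewrite gt_eqF //; lra.
Qed.

End ConeVolume.

(** * Wedges of spherical zones, and packing by volume *)

Section Wedges.
Context {R : realType}.
Notation mu := (@lebesgue_measure R).
Notation RR := (measurableTypeR R).
Notation mu2 := (mu \x mu)%E.
Notation mu3 := ((mu \x mu) \x mu)%E.
Notation R3 := (RR * RR * RR)%type.

(** Half-open in height, so that successive zones are disjoint. *)
Definition zone (lo hi : R) : set R3 :=
  ball3 `&` [set p | lo * enorm p < p.2 /\ p.2 <= hi * enorm p].

(** The azimuths from [al] (included) to [al + om] (excluded), when [0 < om <= pi], expressed by two
    linear inequalities so that no choice of argument is involved. *)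
Definition wedge (al om lo hi : R) : set R3 :=
  zone lo hi `&` [set p | 0 <= cos al * p.1.2 - sin al * p.1.1 /\
                          cos (al + om) * p.1.2 - sin (al + om) * p.1.1 < 0].

Let e3 : R3 := (0, 0, 1).

Lemma measurable_zone lo hi : measurable (zone lo hi).
Proof.
apply: measurableI; first exact: measurable_ball3.
apply: measurableI; [apply: measurable_set_lt|apply: measurable_set_le]; mfun;
  exact: measurable_enorm.
Qed.

Lemma measurable_wedge al om lo hi : measurable (wedge al om lo hi).
Proof.
apply: measurableI; first exact: measurable_zone.
by apply: measurableI; [apply: measurable_set_le|apply: measurable_set_lt]; mfun.
Qed.

Lemma zone_volume lo hi : -1 <= lo -> lo <= hi -> hi <= 1 ->
  mu3 (zone lo hi) = (2 / 3 * @disc_area R * (hi - lo))%:E.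
Proof.
move=> h1 h2 h3.
have E : ocone e3 lo = zone lo hi `|` ocone e3 hi.
  apply/seteqP; split => p; rewrite /ocone /zone /= !dot_e3.
    by move=> [hb h]; case: (leP p.2 (hi * enorm p)) => h'; [left|right].
  move=> [[hb [h _]]|[hb h]]; split => //; apply: le_lt_trans h.
  by rewrite ler_wpM2r // sqrtr_ge0.
have := @volume_ocone_e3 R lo; rewrite h1 (le_trans h2 h3) => /(_ isT).
rewrite E volumeU; [|exact: measurable_zone|exact: measurable_ocone|]; last first.
  rewrite -subset0 => p; rewrite /ocone /zone /= !dot_e3 => -[[_ [_ +]] [_]].
  by rewrite leNgt => /negP.
rewrite volume_ocone_e3 ?h3 ?andbT ?(le_trans h1) // => h.
have -> : mu3 (zone lo hi) = ((2 / 3 * @disc_area R * (1 - lo))%:E - (2 / 3 * @disc_area R * (1 - hi))%:E)%E.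
  by rewrite -h addeK.
by rewrite -EFinB; congr (_%:E); ring.
Qed.

Lemma wedge_volume_rotate al om lo hi : mu3 (wedge al om lo hi) = mu3 (wedge 0 om lo hi).
Proof.
have cs : cos al ^+ 2 + (- sin al) ^+ 2 = 1 by rewrite sqrrN cos2Dsin2.
rewrite -((preserves_rotate cs).2 _ (measurable_wedge 0 om lo hi)).
have dE (p : R3) : dot (cos al * p.1.1 - - sin al * p.1.2, - sin al * p.1.1 + cos al * p.1.2, p.2)
  (cos al * p.1.1 - - sin al * p.1.2, - sin al * p.1.1 + cos al * p.1.2, p.2) = dot p p.
  rewrite /dot /=; have := cos2Dsin2 al; move: (cos al) (sin al) => c s h.
  transitivity ((c ^+ 2 + s ^+ 2) * (p.1.1 * p.1.1 + p.1.2 * p.1.2) + p.2 * p.2); first by ring.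
  by rewrite h; ring.
have eE (p : R3) : enorm (cos al * p.1.1 - - sin al * p.1.2, - sin al * p.1.1 + cos al * p.1.2, p.2) = enorm p.
  by rewrite /enorm dE.
have e1 (p : R3) : cos 0 * (- sin al * p.1.1 + cos al * p.1.2) - sin 0 * (cos al * p.1.1 - - sin al * p.1.2)
  = cos al * p.1.2 - sin al * p.1.1 by rewrite cos0 sin0; ring.
have e2 (p : R3) : cos (0 + om) * (- sin al * p.1.1 + cos al * p.1.2) - sin (0 + om) * (cos al * p.1.1 - - sin al * p.1.2)
  = cos (al + om) * p.1.2 - sin (al + om) * p.1.1 by rewrite add0r cosD sinD; ring.
congr (mu3 _); apply/seteqP; split => p; rewrite /wedge /zone /ball3 /= !dE !eE e1 e2; by [].
Qed.

Lemma axis_null : mu3 [set p : R3 | p.1 = (0, 0)] = 0%E.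
Proof.
have -> : [set p : R3 | p.1 = (0, 0)] = ([set 0] `*` [set 0]) `*` setT.
  apply/seteqP; split => -[[a b] w] /=; first by move=> [-> ->].
  by move=> [[-> ->]].
rewrite product_measure1E //; last exact: measurableX.
by rewrite [X in (X * _)%E]product_measure1E //= lebesgue_measure_set1 !mul0e.
Qed.

Lemma volumeU_le (A B : set R3) : measurable A -> measurable B -> (mu3 (A `|` B) <= mu3 A + mu3 B)%E.
Proof. by move=> mA mB; exact: measureU2. Qed.

Lemma wedge_polar al om lo hi (p : R3) : 0 < om <= pi -> wedge al om lo hi p ->
  exists tau rho, [/\ 0 <= tau < om, 0 < rho & p.1 = (rho * cos (al + tau), rho * sin (al + tau))].
Proof.
move=> hom [_ [/= h1 h2]]; have [rho [a [r0 ex ey]]] := polar p.1.1 p.1.2.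
have {}h1 : 0 <= rho * sin (a - al).
  have -> : rho * sin (a - al) = cos al * p.1.2 - sin al * p.1.1 by rewrite ex ey sinB; ring.
  exact: h1.
have {}h2 : rho * sin (a - al - om) < 0.
  have -> : rho * sin (a - al - om) = cos (al + om) * p.1.2 - sin (al + om) * p.1.1.
    by rewrite ex ey -addrA -opprD sinB; ring.
  exact: h2.
have r1 : 0 < rho.
  by rewrite lt_neqAle r0 andbT eq_sym; apply/eqP => r00; move: h2; rewrite r00 mul0r ltxx.
rewrite pmulr_rge0 // in h1; rewrite pmulr_rlt0 // in h2.
have [k hk] := angle_in_sector hom h1 h2.
exists (a - al - k%:~R * (2 * pi)), rho; split => //.
have -> : al + (a - al - k%:~R * (2 * pi)) = a + (- k)%:~R * (2 * pi) by rewrite mulrNz mulNr; ring.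
by rewrite sin_periodz cos_periodz -ex -ey; case: (p.1).
Qed.

(** At a common point the two azimuths have the same cosine and sine, so their difference has cosine
    1; but that difference [d om + tau' - tau] lies strictly between 0 and [2 pi]. *)
Lemma wedge_disjoint al om lo hi lo' hi' (d : nat) (p : R3) : 0 < om <= pi ->
  (0 < d)%N -> d.+1%:R * om <= 2 * pi ->
  wedge al om lo hi p -> wedge (al + d%:R * om) om lo' hi' p -> False.
Proof.
move=> hom d0 dom /(wedge_polar hom) [tau [rho [/andP[t0 t1] r0 E]]].
move=> /(wedge_polar hom) [tau' [rho' [/andP[t0' t1'] r0']]]; rewrite E => -[E1 E2].
have om0 : 0 < om by case/andP: hom.
have rr : rho = rho'.
  have : rho ^+ 2 = rho' ^+ 2.
    rewrite -[LHS]mulr1 -(cos2Dsin2 (al + tau)) -[RHS]mulr1 -(cos2Dsin2 (al + d%:R * om + tau')).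
    by rewrite !mulrDr -!exprMn E1 E2.
  by move/eqP; rewrite eqrXn2 ?ltW // => /eqP.
have rN : rho != 0 by rewrite gt_eqF.
rewrite -rr in E1 E2; move/(mulfI rN) in E1; move/(mulfI rN) in E2.
pose D := (al + d%:R * om + tau') - (al + tau).
have DE : D = d%:R * om + tau' - tau by rewrite /D; ring.
have d1 : om <= d%:R * om by rewrite ler_peMl ?(ltW om0) // ler1n.
have dS : d.+1%:R * om = d%:R * om + om by rewrite -natr1 mulrDl mul1r.
have : cos D < 1 by apply: cos_lt1; rewrite DE; apply/andP; split; lra.
rewrite /D cosB E1 E2 -!expr2 cos2Dsin2; lra.
Qed.

(** Divide the azimuth, measured from [al], by [om]: since [r om = 2 pi], the quotient modulo [r]
    numbers the wedge. The axis is set apart because it has no azimuth; [r > 2] makes [om < pi]. *)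
Lemma zone_cover al om lo hi (r : nat) : (2 < r)%N -> r%:R * om = 2 * pi ->
  zone lo hi `<=` [set p : R3 | p.1 = (0, 0)] `|` \big[setU/set0]_(i < r) wedge (al + i%:R * om) om lo hi.
Proof.
move=> r2 rom p hp; have [rho [a [r0 ex ey]]] := polar p.1.1 p.1.2.
have p0 := @pi_gt0 R.
have rR : 0 < r%:R :> R by rewrite ltr0n (ltn_trans _ r2).
have omE : om = 2 * pi / r%:R by rewrite -rom mulrAC divff ?mul1r ?gt_eqF.
have om0 : 0 < om by rewrite omE divr_gt0 // mulr_gt0.
have ompi : om < pi.
  by rewrite omE ltr_pdivrMr // mulrC ltr_pM2l // ltr_nat.
have [rz|rz] := eqVneq rho 0.
  by left => /=; move: ex ey; rewrite rz !mul0r; case: (p.1) => x y /= -> ->.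
have r1 : 0 < rho by rewrite lt_neqAle eq_sym rz.
right; rewrite -(bigcup_mkord r (fun i => wedge (al + i%:R * om) om lo hi)).
have [k /andP[k0 k1]] := euclid_mod (a - al) om0.
have rz0 : (r : int) != 0 by rewrite -lt0n (ltn_trans _ r2).
have m0 : (0 <= k %% r)%Z by exact: modz_ge0.
have mr : (k %% r < r)%Z by apply: ltz_pmod; rewrite ltz_nat (ltn_trans _ r2).
pose i := `|(k %% r)%Z|%N.
have iE : (i : int) = (k %% r)%Z by rewrite /i gez0_abs.
have ir : (i < r)%N by rewrite -ltz_nat iE.
exists i => //; split => //=.
set tau := a - al - k%:~R * om in k0 k1.
have kE : k%:~R * om = i%:R * om + (k %/ r)%Z%:~R * (2 * pi).
  by rewrite {1}(divz_eq k r) -iE intrD intrM -rom; ring.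
have aE : a = al + i%:R * om + tau + (k %/ r)%Z%:~R * (2 * pi).
  by rewrite /tau kE; ring.
have cE : cos a = cos (al + i%:R * om + tau) by rewrite {1}aE cos_periodz.
have sE : sin a = sin (al + i%:R * om + tau) by rewrite {1}aE sin_periodz.
rewrite ex ey cE sE; move: (al + i%:R * om) => b.
have -> : cos b * (rho * sin (b + tau)) - sin b * (rho * cos (b + tau)) = rho * sin tau.
  have -> : sin tau = sin (b + tau - b) by congr sin; ring.
  by rewrite sinB; ring.
have -> : cos (b + om) * (rho * sin (b + tau)) - sin (b + om) * (rho * cos (b + tau)) = - (rho * sin (om - tau)).
  have -> : om - tau = (b + om) - (b + tau) by ring.
  by rewrite sinB; ring.
rewrite pmulr_rge0 // sin_ge0_pi ?k0 /=; last by apply: ltW; exact: lt_trans ompi.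
split => //; rewrite oppr_lt0 pmulr_rgt0 // sin_gt0_pi // subr_gt0 k1 /=.
by apply: le_lt_trans ompi; rewrite gerBl.
Qed.

(** The [r] wedges have equal volumes by rotation and cover the zone up to the axis, a null set.
    Subadditivity gives the lower bound, which is all that packing needs. *)
Lemma wedge_volume_ge al om lo hi (r : nat) : (2 < r)%N -> r%:R * om = 2 * pi ->
  -1 <= lo -> lo <= hi -> hi <= 1 ->
  ((2 / 3 * @disc_area R * (hi - lo) / r%:R)%:E <= mu3 (wedge al om lo hi))%E.
Proof.
move=> r2 rom h1 h2 h3.
have rR : 0 < r%:R :> R by rewrite ltr0n (ltn_trans _ r2).
rewrite wedge_volume_rotate.
have [v vE] : exists v : R, mu3 (wedge 0 om lo hi) = v%:E.
  exists (fine (mu3 (wedge 0 om lo hi))); rewrite fineK // ge0_fin_numE //.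
  apply: (@le_lt_trans _ _ (mu3 ball3)); last by rewrite volume_ball3 ltry.
  apply: volume_le; [exact: measurable_wedge|exact: measurable_ball3|].
  by move=> p [[]].
have mU n : measurable (\big[setU/set0]_(i < n) wedge (0 + i%:R * om) om lo hi).
  by apply: bigsetU_measurable => i _; exact: measurable_wedge.
have big n : (mu3 (\big[setU/set0]_(i < n) wedge (0 + i%:R * om) om lo hi) <= (n%:R * v)%:E)%E.
  elim: n => [|n IHn]; first by rewrite big_ord0 measure0 mul0r.
  rewrite big_ord_recr /=; apply: le_trans (volumeU_le (mU n) (measurable_wedge _ _ _ _)) _.
  rewrite -natr1 mulrDl mul1r EFinD; apply: leeD => //.
  by rewrite wedge_volume_rotate vE.
rewrite vE lee_fin ler_pdivrMr // [v * _]mulrC -lee_fin -zone_volume //.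
have mA : measurable [set p : R3 | p.1 = (0, 0)].
  have -> : [set p : R3 | p.1 = (0, 0)] = ([set 0] `*` [set 0]) `*` setT.
    apply/seteqP; split => -[[a b] w] /=; first by move=> [-> ->].
    by move=> [[-> ->]].
  by apply: measurableX => //; exact: measurableX.
apply: le_trans (volume_le (measurable_zone _ _) _ (@zone_cover 0 om lo hi r r2 rom)) _.
  exact: measurableU.
apply: le_trans (volumeU_le mA (mU r)) _.
by rewrite axis_null add0e; exact: big.
Qed.

(** Turns volumes into counts: applied to the cells of the points in a cap and to a slightly larger
    cone. *)
Lemma packing (I : eqType) (s : seq I) (F : I -> set R3) (B : set R3) (v b : R) :
  uniq s -> measurable B -> mu3 B = b%:E ->
  (forall i, i \in s -> measurable (F i)) -> (forall i, i \in s -> F i `<=` B) ->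
  (forall i k, i \in s -> k \in s -> i != k -> F i `&` F k = set0) ->
  (forall i, i \in s -> (v%:E <= mu3 (F i))%E) -> (size s)%:R * v <= b.
Proof.
elim: s B b => [|x s IHs] B b /=.
  by move=> _ mB E _ _ _ _; rewrite mul0r -lee_fin -E measure_ge0.
move=> /andP[xs us] mB E mF FB dF vF.
have mx : measurable (F x) by apply: mF; rewrite inE eqxx.
have xB : F x `<=` B by apply: FB; rewrite inE eqxx.
have vx : (v%:E <= mu3 (F x))%E by apply: vF; rewrite inE eqxx.
have mD : measurable (B `\` F x) by exact: measurableD.
have BE : mu3 B = (mu3 (F x) + mu3 (B `\` F x))%E.
  rewrite -volumeU //; last by rewrite -subset0 => p [h [_]].
  congr (mu3 _); apply/seteqP; split => p; last by move=> [/xB|[]].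
  by move=> pB; have [h|h] := pselect (F x p); [left|right].
have fin A : measurable A -> A `<=` B -> exists a : R, mu3 A = a%:E.
  move=> mA AB; exists (fine (mu3 A)); rewrite fineK // ge0_fin_numE //.
  by apply: le_lt_trans (volume_le mA mB AB) _; rewrite E ltry.
have [f fE] := fin _ mx xB.
have [g gE] : exists g : R, mu3 (B `\` F x) = g%:E by apply: fin => // p [].
have fg : b = f + g by apply/EFin_inj; rewrite -E BE fE gE.
have h : (size s)%:R * v <= g.
  apply: (IHs (B `\` F x)) => //.
  - by move=> i si; apply: mF; rewrite inE si orbT.
  - move=> i si p Fp; split; first by apply: (FB i) => //; rewrite inE si orbT.
    move=> Fx; have : (F i `&` F x) p by [].
    rewrite dF //; first by rewrite inE si orbT.
      by rewrite inE eqxx.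
    by apply: contraNneq xs => <-.
  - by move=> i k si sk; apply: dF; rewrite inE ?si ?sk orbT.
  - by move=> i si; apply: vF; rewrite inE si orbT.
by rewrite -natr1 mulrDl mul1r fg addrC lerD // -lee_fin -fE.
Qed.

End Wedges.

(** * Sets of points on parallels *)

Lemma card_fset_filter (K : choiceType) (S : seq K) (P : pred K) : uniq S ->
  #|` [fset x in [fset y in S]%fset | P x]%fset | = count P S.
Proof.
move=> uS; have -> : [fset x in [fset y in S]%fset | P x]%fset = [fset x in [seq y <- S | P y]]%fset.
  by apply/fsetP => x; rewrite !inE /= mem_filter andbC.
by rewrite card_fseq undup_id ?filter_uniq // size_filter.
Qed.

Section Rings.
Context {R : realType}.
Notation R3 := (space3 R).
Variables (r : nat -> nat) (p : nat).

Definition below (j : nat) : nat := (\sum_(1 <= k < j) r k)%N.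

Hypothesis r3 : forall j, (1 <= j <= p)%N -> (3 <= r j)%N.
Hypothesis p0 : (0 < p)%N.

(* [N - 1] for the total number [N = 2 + \sum_j r_j] of points. *)
Definition rn : R := (below p.+1).+1%:R.

(** The upper edge of the zone of ring [j]: the cap above it has normalised area
    [(1 / 2 + below j) / rn], half a share for the pole and one share for each point of the earlier
    rings. [zlev j] is the middle height of the zone. *)
Definition ztop (j : nat) : R := 1 - (1 + 2 * (below j)%:R) / rn.
Definition zlev (j : nat) : R := 1 - (1 + (r j)%:R + 2 * (below j)%:R) / rn.
Definition rho (j : nat) : R := Num.sqrt (1 - zlev j ^+ 2).
Definition ringpt (th : nat -> R) (ji : nat * nat) : R3 :=
  let a := 2 * pi * ji.2%:R / (r ji.1)%:R + th ji.1 in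
  (rho ji.1 * cos a, rho ji.1 * sin a, zlev ji.1).
Definition ringidx : seq (nat * nat) :=
  [seq (j, i) | j <- iota 1 p, i <- iota 1 (r j)].
Definition omega (j : nat) : R := 2 * pi / (r j)%:R.
Definition cell (th : nat -> R) (ji : nat * nat) : set R3 :=
  wedge (ji.2%:R * omega ji.1 + th ji.1) (omega ji.1) (ztop ji.1.+1) (ztop ji.1).

Lemma mem_ringidx ji : ji \in ringidx -> (1 <= ji.1 <= p)%N /\ (1 <= ji.2 <= r ji.1)%N.
Proof.
by move=> /allpairsPdep[j [i [+ + ->]]]; rewrite !mem_iota /= add1n ltnS add1n ltnS.
Qed.

Lemma ringidx_uniq : uniq ringidx.
Proof.
apply: allpairs_uniq_dep; first exact: iota_uniq.
  by move=> j _; exact: iota_uniq.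
by move=> [a b] [c d] _ _ /= [-> ->].
Qed.

Lemma size_ringidx : size ringidx = below p.+1.
Proof.
rewrite /ringidx size_allpairs_dep sumnE big_map /below /index_iota subn1 /=.
by apply: eq_bigr => j _; rewrite size_iota.
Qed.

Lemma below_recr j : (0 < j)%N -> below j.+1 = (below j + r j)%N.
Proof. by move=> j0; rewrite /below big_nat_recr. Qed.

Lemma below_le j k : (j <= k)%N -> (below j <= below k)%N.
Proof.
move=> jk; rewrite /below; have [j1|j1] := leqP j 1.
  by rewrite big_geq.
rewrite (@big_cat_nat _ _ _ j 1 k) //=; [exact: leq_addr|exact: ltnW].
Qed.

Lemma rn_gt0 : 0 < rn. Proof. by rewrite ltr0n. Qed.

Lemma ztop_recr j : (0 < j)%N -> ztop j.+1 = ztop j - 2 * (r j)%:R / rn.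
Proof. by move=> j0; rewrite /ztop below_recr // natrD; field; rewrite gt_eqF ?rn_gt0. Qed.

Lemma zlev_mid j : zlev j = ztop j - (r j)%:R / rn.
Proof. by rewrite /zlev /ztop; field; rewrite gt_eqF ?rn_gt0. Qed.

Lemma ztop_le j k : (j <= k)%N -> ztop k <= ztop j.
Proof.
move=> jk; rewrite /ztop lerD2l lerN2 ler_pM2r ?invr_gt0 ?rn_gt0 // lerD2l ler_pM2l //.
by rewrite ler_nat below_le.
Qed.

Lemma ztop_lt1 j : ztop j < 1.
Proof.
by rewrite /ztop gtrBl divr_gt0 ?rn_gt0 // ltr_pwDl // mulr_ge0.
Qed.

Lemma ztop_gtN1 j : (j <= p.+1)%N -> -1 < ztop j.
Proof.
move=> jp; rewrite /ztop ltrBrDl -ltrBrDr opprK -mulr2n ltr_pdivrMr ?rn_gt0 //.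
have -> : rn = (below p.+1)%:R + 1 by rewrite natr1.
have : (below j)%:R <= (below p.+1)%:R :> R by rewrite ler_nat below_le.
by move: (below j)%:R (below p.+1)%:R => a b; lra.
Qed.

Lemma zlev_bounds j : (1 <= j <= p)%N -> ztop j.+1 < zlev j < ztop j.
Proof.
move=> /[dup] hj /andP[j0 jp].
have q0 : 0 < (r j)%:R / rn :> R by rewrite divr_gt0 ?rn_gt0 // ltr0n (leq_trans _ (r3 hj)).
rewrite zlev_mid ztop_recr // -mulrA; move: q0 (ztop j); set q := (_ / _) => q0 a.
by apply/andP; split; lra.
Qed.

Lemma zlev_lt j k : (1 <= j)%N -> (j < k)%N -> (k <= p)%N -> zlev k < zlev j.
Proof.
move=> j1 jk kp; have /andP[h1 _] := @zlev_bounds j ltac:(rewrite j1 (leq_trans (ltnW jk))//).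
have /andP[_ h2] := @zlev_bounds k ltac:(rewrite kp (leq_trans j1 (ltnW jk))//).
by apply: lt_trans h1; apply: lt_le_trans h2 _; exact: ztop_le.
Qed.

Lemma zlev_abs j : (1 <= j <= p)%N -> -1 < zlev j < 1.
Proof.
move=> hj; have /andP[h1 h2] := zlev_bounds hj; case/andP: hj => j0 jp.
apply/andP; split; first by apply: lt_trans h1; exact: ztop_gtN1.
by apply: lt_trans h2 _; exact: ztop_lt1.
Qed.

Lemma rho_sqr j : (1 <= j <= p)%N -> rho j ^+ 2 = 1 - zlev j ^+ 2.
Proof.
by move=> /zlev_abs /andP[h1 h2]; rewrite /rho sqr_sqrtr //; nra.
Qed.

Lemma rho_gt0 j : (1 <= j <= p)%N -> 0 < rho j.
Proof. by move=> /zlev_abs /andP[h1 h2]; rewrite /rho sqrtr_gt0; nra. Qed.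

Lemma omega_gt0 j : (1 <= j <= p)%N -> 0 < omega j.
Proof.
move=> hj; rewrite divr_gt0 // ?mulr_gt0 ?pi_gt0 // ltr0n; exact: leq_trans (r3 hj).
Qed.

Lemma omegaM j : (1 <= j <= p)%N -> (r j)%:R * omega j = 2 * pi.
Proof.
move=> hj; rewrite /omega mulrC divfK // pnatr_eq0 -lt0n; exact: leq_trans (r3 hj).
Qed.

Lemma omega_lepi j : (1 <= j <= p)%N -> 0 < omega j <= pi.
Proof.
move=> hj; rewrite omega_gt0 //= ler_pdivrMr; last by rewrite ltr0n (leq_trans _ (r3 hj)).
rewrite mulrC ler_pM2l ?pi_gt0 // ler_nat; exact: leq_trans (r3 hj).
Qed.

Lemma ring_angle (th : nat -> R) (ji : nat * nat) :
  2 * pi * ji.2%:R / (r ji.1)%:R + th ji.1 = ji.2%:R * omega ji.1 + th ji.1.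
Proof. by rewrite /omega; ring. Qed.

Lemma ringpt_sphere th ji : ji \in ringidx -> sphere (ringpt th ji).
Proof.
move=> /mem_ringidx[hj _]; apply/sphereE; rewrite /ringpt /dot /= -!expr2 !exprMn -mulrDr cos2Dsin2.
by rewrite mulr1 rho_sqr // subrK.
Qed.

Lemma ringpt_inj th : {in ringidx &, injective (ringpt th)}.
Proof.
move=> [j i] [k l] /mem_ringidx[/= hj hi] /mem_ringidx[/= hk hl].
rewrite /ringpt /= => -[E1 E2 E3].
have jk : j = k.
  case: (ltngtP j k) => // h.
    by move: (@zlev_lt j k); rewrite E3 ltxx => /(_ _ h); case/andP: hj => -> _; case/andP: hk => _ -> /(_ isT isT).
  by move: (@zlev_lt k j); rewrite E3 ltxx => /(_ _ h); case/andP: hk => -> _; case/andP: hj => _ -> /(_ isT isT).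
rewrite -jk in hl E1 E2 *; congr (_, _).
have s0 : rho j != 0 by rewrite gt_eqF ?rho_gt0.
have {}E1 := mulfI s0 E1; have {}E2 := mulfI s0 E2.
have om := omega_gt0 hj; have omM := omegaM hj.
wlog il : i l hi hl E1 E2 / (i < l)%N.
  move=> h; case: (ltngtP i l) => // il; first exact: h.
  by apply/esym; apply: h.
have : cos ((l - i)%N%:R * omega j) = 1.
  have -> : (l - i)%N%:R * omega j = (2 * pi * l%:R / (r j)%:R + th j) - (2 * pi * i%:R / (r j)%:R + th j).
    by rewrite natrB ?(ltnW il) // /omega; ring.
  by rewrite cosB -E1 -E2 -!expr2 cos2Dsin2.
have : cos ((l - i)%N%:R * omega j) < 1; last by move=> /[swap] ->; rewrite ltxx.
apply: cos_lt1; rewrite mulr_gt0 ?ltr0n ?subn_gt0 //= -omM ltr_pM2r // ltr_nat.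
case/andP: hi => i1 _; case/andP: hl => _ lr; apply: leq_trans lr; rewrite ltn_subLR ?(ltnW il) //.
by rewrite -[l in (l < _)%N]add0n ltn_add2r.
Qed.

Lemma cell_disjoint th : forall a b, a \in ringidx -> b \in ringidx -> a != b ->
  cell th a `&` cell th b = set0.
Proof.
move=> [j i] [k l] /mem_ringidx[/= hj hi] /mem_ringidx[/= hk hl] ab.
rewrite -subset0 => q [] /=.
case: (ltngtP j k) => [h|h|jk].
- move=> [[hb [h1 _]] _] [[_ [_ h2]] _].
  have : ztop k * enorm q <= ztop j.+1 * enorm q by rewrite ler_wpM2r ?sqrtr_ge0 // ztop_le.
  by move=> h3; have := lt_le_trans h1 (le_trans h2 h3); rewrite ltxx.
- move=> [[hb [_ h2]] _] [[_ [h1 _]] _].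
  have : ztop j * enorm q <= ztop k.+1 * enorm q by rewrite ler_wpM2r ?sqrtr_ge0 // ztop_le.
  by move=> h3; have := lt_le_trans h1 (le_trans h2 h3); rewrite ltxx.
rewrite /cell /= -jk; rewrite -jk in hl ab.
have om := omega_lepi hj; have omM := omegaM hj.
wlog il : i l hi hl ab / (i < l)%N.
  move=> h; case: (ltngtP i l) => il.
  - exact: h.
  - by move=> a b; apply: (h l i) => //; rewrite eq_sym.
  - by move: ab; rewrite il eqxx.
have -> : l%:R * omega j + th j = i%:R * omega j + th j + (l - i)%N%:R * omega j.
  by rewrite natrB ?(ltnW il) //; ring.
apply: wedge_disjoint => //; first by rewrite subn_gt0.
rewrite -omM ler_pM2r ?omega_gt0 // ler_nat.
case/andP: hi => i1 _; case/andP: hl => _ lr; apply: leq_trans lr; rewrite ltn_subLR ?(ltnW il) //.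
by rewrite -[l in (l < _)%N]add0n ltn_add2r.
Qed.

(** [4 / 3 * disc_area] is the volume of the ball, so the cell occupies at least the fraction
    [1 / rn] of it. *)
Lemma cell_volume th ji : ji \in ringidx ->
  ((4 / 3 * @disc_area R / rn)%:E <= (((@lebesgue_measure R \x @lebesgue_measure R) \x @lebesgue_measure R) (cell th ji)))%E.
Proof.
move=> /mem_ringidx[hj hi]; have /andP[j0 jp] := hj.
have r0 : (r ji.1)%:R != 0 :> R by rewrite pnatr_eq0 -lt0n (leq_trans _ (r3 hj)).
have := @wedge_volume_ge R (ji.2%:R * omega ji.1 + th ji.1) (omega ji.1) (ztop ji.1.+1) (ztop ji.1) (r ji.1) (r3 hj) (omegaM hj).
move=> /(_ (ltW (ztop_gtN1 _)) (ztop_le (leqnSn _)) (ltW (ztop_lt1 _))).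
rewrite ltnS => /(_ jp); congr (_ <= _)%E; congr (_%:E).
by rewrite ztop_recr //; field; rewrite r0 gt_eqF ?rn_gt0.
Qed.

(* A bound for the distance between a unit vector of the cell and its ring point. *)
Definition celldiam (j : nat) : R :=
  4 * (r j)%:R / (rn * rho j) + 4 * pi * rho j / (r j)%:R + (r j)%:R / rn.

(** The normalised point has height [h], horizontal radius [sg] and azimuth [al + tau]. Its height
    is off by at most half the zone, its azimuth by at most [omega], and the coordinates of [z] are
    bounded by 1. *)
Lemma cell_near th ji (z q : R3) : dot z z = 1 -> ji \in ringidx -> cell th ji q ->
  `|dot z q - enorm q * dot z (ringpt th ji)| <= enorm q * celldiam ji.1.
Proof.
case: z => [[z1 z2] z3] zz /mem_ringidx[hj hi]; case: ji hj hi => j i /= hj hi hc.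
have [tau [ro [/andP[t0 t1] ro0 E]]] := wedge_polar (omega_lepi hj) hc.
case: hc => [[/andP[q0 q1] [/= h1 h2]] _].
have n0 := enorm_gt0 q0; have s0 := rho_gt0 hj; have om0 := omega_gt0 hj.
have rR0 : 0 < (r j)%:R :> R by rewrite ltr0n (leq_trans _ (r3 hj)).
have nn := rn_gt0.
set nu := enorm q in h1 h2 n0 *; pose h := q.2 / nu; pose sg := ro / nu.
have h2E : q.2 = nu * h by rewrite /h mulrC divfK ?gt_eqF.
have roE : ro = nu * sg by rewrite /sg mulrC divfK ?gt_eqF.
have sg0 : 0 < sg by rewrite divr_gt0.
have sgh : sg ^+ 2 = 1 - h ^+ 2.
  have : nu ^+ 2 = dot q q by rewrite sqr_sqrtr // ltW.
  rewrite /dot E h2E roE /= => nE; have nu2 : nu ^+ 2 != 0 by rewrite expf_neq0 ?gt_eqF.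
  apply: (mulfI nu2); have cs := cos2Dsin2 (i%:R * omega j + th j + tau).
  move: cs nE; move: (cos _) (sin _) => c s cs nE.
  transitivity ((nu * sg) ^+ 2 * (c ^+ 2 + s ^+ 2)); first by rewrite cs; ring.
  by rewrite [in RHS]mulrBr mulr1 {1}nE; ring.
have hl : ztop j.+1 < h by rewrite -(ltr_pM2r n0) [h * _]mulrC -h2E.
have hu : h <= ztop j by rewrite -(ler_pM2r n0) [h * _]mulrC -h2E.
have hz : `|h - zlev j| <= (r j)%:R / rn.
  have := zlev_mid j; have := ztop_recr (proj1 (andP hj)); rewrite -mulrA.
  move: hl hu; move: (ztop j) (ztop j.+1) (zlev j) (_ / _) => a b c d hl hu E1 E2.
  by rewrite ler_norml; apply/andP; split; lra.
have /andP[zl zu] := zlev_abs hj.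
have habs : -1 <= h <= 1 by apply/andP; split; nra.
(* From [sg ^ 2 - rho ^ 2 = - (h - zlev) (h + zlev)] after division by [sg + rho >= rho]. *)
have ds : `|sg - rho j| <= 2 * ((r j)%:R / rn) / rho j.
  rewrite ler_pdivlMr //.
  apply: (@le_trans _ _ (`|sg - rho j| * (sg + rho j))).
    by rewrite ler_wpM2l // lerDr ltW.
  rewrite -[X in _ * X]gtr0_norm ?addr_gt0 // -normrM.
  have -> : (sg - rho j) * (sg + rho j) = - ((h - zlev j) * (h + zlev j)).
    by rewrite -subr_sqr sgh rho_sqr //; ring.
  rewrite normrN normrM mulrC; apply: ler_pM => //.
  by case/andP: habs => ? ?; rewrite ler_norml; apply/andP; split; lra.
set al := i%:R * omega j + th j in E *.
have -> : ringpt th (j, i) = (rho j * cos al, rho j * sin al, zlev j) by rewrite /ringpt /= (ring_angle th (j, i)).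
have c1 : `|z1| <= 1 by rewrite -(@ler_pXn2r _ 2) ?nnegrE // expr1n real_normK ?num_real //; move: zz; rewrite /dot /=; clear; nra.
have c2 : `|z2| <= 1 by rewrite -(@ler_pXn2r _ 2) ?nnegrE // expr1n real_normK ?num_real //; move: zz; rewrite /dot /=; clear; nra.
have c3 : `|z3| <= 1 by rewrite -(@ler_pXn2r _ 2) ?nnegrE // expr1n real_normK ?num_real //; move: zz; rewrite /dot /=; clear; nra.
have -> : dot (z1, z2, z3) q - nu * dot (z1, z2, z3) (rho j * cos al, rho j * sin al, zlev j)
   = nu * (z1 * ((sg - rho j) * cos (al + tau) + rho j * (cos (al + tau) - cos al))
         + z2 * ((sg - rho j) * sin (al + tau) + rho j * (sin (al + tau) - sin al))
         + z3 * (h - zlev j)).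
  by rewrite /dot E h2E roE /=; ring.
rewrite normrM gtr0_norm // ler_pM2l //.
have dc : `|cos (al + tau) - cos al| <= omega j.
  by apply: le_trans (lipschitz_cos _ _) _; rewrite addrAC subrr add0r ger0_norm // ltW.
have dsi : `|sin (al + tau) - sin al| <= omega j.
  by apply: le_trans (lipschitz_sin _ _) _; rewrite addrAC subrr add0r ger0_norm // ltW.
have part (u c d : R) : `|u| <= 1 -> `|c| <= 1 -> `|d| <= omega j ->
    `|u * ((sg - rho j) * c + rho j * d)| <= 2 * ((r j)%:R / rn) / rho j + rho j * omega j.
  move=> hu' hc' hd'; rewrite normrM -[leRHS]mul1r; apply: ler_pM => //.
  apply: le_trans (ler_normD _ _) _; rewrite !normrM; apply: lerD.
    by rewrite -[leRHS]mulr1; apply: ler_pM.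
  by rewrite gtr0_norm // ler_pM2l.
apply: le_trans (ler_normD _ _) _.
apply: (@le_trans _ _ ((2 * ((r j)%:R / rn) / rho j + rho j * omega j) + (2 * ((r j)%:R / rn) / rho j + rho j * omega j) + (r j)%:R / rn)).
  apply: lerD.
    by apply: le_trans (ler_normD _ _) _; apply: lerD; apply: part => //; [exact: cos_max|exact: sin_max].
  by rewrite normrM -[leRHS]mul1r; apply: ler_pM.
rewrite /celldiam /omega le_eqVlt; apply/orP; left; apply/eqP.
by field; rewrite !gt_eqF.
Qed.

Lemma ring_count_le th (de : R) (z : R3) (t : R) : dot z z = 1 -> -1 <= t <= 1 ->
  (forall j, (1 <= j <= p)%N -> celldiam j <= de) ->
  (size [seq ji <- ringidx | t < dot z (ringpt th ji)])%:R <= rn * (1 - t + de) / 2 /\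
  (size [seq ji <- ringidx | dot z (ringpt th ji) <= t])%:R <= rn * (1 + t + de) / 2.
Proof.
move=> zz /andP[t1 t2] hde; have k1 := @disc_area_ge1 R; have nn := rn_gt0.
have k0 : 0 < @disc_area R by exact: lt_le_trans k1.
have de0 : 0 <= de.
  have hp : (1 <= p <= p)%N by rewrite p0 leqnn.
  apply: le_trans (hde p hp); have s0 := rho_gt0 hp.
  by rewrite /celldiam !addr_ge0 // divr_ge0 // ?mulr_ge0 // ?ltW // ?pi_gt0.
(* Cells of volume at least [4 / 3 * disc_area / rn] inside a region of volume
   [2 / 3 * disc_area * b] number at most [rn * b / 2]. *)
have pack (P : pred (nat * nat)) (B : set R3) (b : R) : measurable B ->
    ((@lebesgue_measure R \x @lebesgue_measure R) \x @lebesgue_measure R)%E B = (2 / 3 * @disc_area R * b)%:E ->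
    (forall ji, ji \in ringidx -> P ji -> cell th ji `<=` B) ->
    (size [seq ji <- ringidx | P ji])%:R <= rn * b / 2.
  move=> mB vB hB.
  have := @packing R _ [seq ji <- ringidx | P ji] (cell th) B (4 / 3 * @disc_area R / rn) _ (filter_uniq _ ringidx_uniq) mB vB.
  move=> h; have {}h : (size [seq ji <- ringidx | P ji])%:R * (4 / 3 * @disc_area R / rn) <= 2 / 3 * @disc_area R * b.
    apply: h.
    - by move=> ji _; exact: measurable_wedge.
    - by move=> ji; rewrite mem_filter => /andP[h1 h2]; exact: hB.
    - by move=> a c; rewrite !mem_filter => /andP[_ h1] /andP[_ h2]; exact: cell_disjoint.
    - by move=> ji; rewrite mem_filter => /andP[_ h1]; exact: cell_volume.
  have k4 : 0 < 4 / 3 * @disc_area R / rn by rewrite divr_gt0 // mulr_gt0.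
  rewrite -(ler_pM2r k4); apply: le_trans h _.
  by rewrite le_eqVlt; apply/orP; left; apply/eqP; field; rewrite gt_eqF.
have near ji q : ji \in ringidx -> cell th ji q ->
    enorm q * (dot z (ringpt th ji) - de) <= dot z q <= enorm q * (dot z (ringpt th ji) + de).
  move=> hji hq; have /ler_normlP[h1 h2] := cell_near zz hji hq.
  have hj := (mem_ringidx hji).1.
  have hd : enorm q * celldiam ji.1 <= enorm q * de by rewrite ler_wpM2l ?sqrtr_ge0 // hde.
  move: h1 h2 hd; move: (dot z (ringpt th ji)) (celldiam ji.1) (enorm q) (dot z q) => w c e a.
  rewrite mulrBr mulrDr; move: (e * w) (e * c) (e * de) => u v x h1 h2 hd.
  by apply/andP; split; lra.
have qb ji q : cell th ji q -> ball3 q by move=> [[]].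
split.
(* If lowering the level by [de] would pass the south pole, the bound exceeds [rn] and packing into
   the whole ball is enough; the complementary cap is treated in the same way below. *)
- have [s1|s1] := leP (-1) (t - de).
    apply: (@pack _ (ocone z (t - de))); first exact: measurable_ocone.
      rewrite volume_ocone // ?s1 /=; first by congr (_%:E); ring.
      by rewrite (le_trans _ t2) // gerBl.
    move=> ji hji hP q hq; have hb := qb _ _ hq; split => //.
    have /andP[h1 _] := near _ _ hji hq; apply: lt_le_trans h1.
    rewrite mulrC ltr_pM2l; first by rewrite ltrD2r.
    by apply: enorm_gt0; case/andP: hb.
  apply: (@le_trans _ _ (rn * 2 / 2)).
    apply: (@pack _ ball3); [exact: measurable_ball3| |].
      by rewrite volume_ball3; congr (_%:E); ring.
    by move=> ji _ _ q; exact: qb.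
  by rewrite ler_pM2r ?invr_gt0 // ler_pM2l //; lra.
- have [s1|s1] := leP (t + de) 1.
    apply: (@pack _ (ball3 `\` ocone z (t + de))).
    + by apply: measurableD; [exact: measurable_ball3|exact: measurable_ocone].
    + have hv : -1 <= t + de <= 1 by rewrite s1 andbT (le_trans t1) // lerDl.
      have := volume_ocone zz hv; have := @volume_ball3 R.
      have {1}-> : @ball3 R = ocone z (t + de) `|` (ball3 `\` ocone z (t + de)).
        apply/seteqP; split => q; last by move=> [[]|[]].
        by move=> qb'; have [h|h] := pselect (ocone z (t + de) q); [left|right].
      rewrite volumeU; [|exact: measurable_ocone| |].
      * move=> /[swap] -> h.
        have -> : ((@lebesgue_measure R \x @lebesgue_measure R) \x @lebesgue_measure R)%E (ball3 `\` ocone z (t + de)) = ((4 / 3 * @disc_area R)%:E - (2 / 3 * @disc_area R * (1 - (t + de)))%:E)%E.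
          by rewrite -h addeAC subee // add0e.
        by rewrite -EFinB; congr (_%:E); field.
      * by apply: measurableD; [exact: measurable_ball3|exact: measurable_ocone].
      * by rewrite -subset0 => q [h []].
    move=> ji hji hP q hq; have hb := qb _ _ hq; split => // -[_].
    have /andP[_ h1] := near _ _ hji hq; apply/negP; rewrite -leNgt; apply: le_trans h1 _.
    by rewrite mulrC ler_wpM2r ?sqrtr_ge0 // lerD2r.
  apply: (@le_trans _ _ (rn * 2 / 2)).
    apply: (@pack _ ball3); [exact: measurable_ball3| |].
      by rewrite volume_ball3; congr (_%:E); ring.
    by move=> ji _ _ q; exact: qb.
  by rewrite ler_pM2r ?invr_gt0 // ler_pM2l //; lra.
Qed.

End Rings.

(** * Cap discrepancy of sets of rings *)

Section Discrepancy.
Context {R : realType}.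
Implicit Types (w : {fset space3 R}) (z : space3 R).

Definition cap_count w z t : nat := #|` [fset x in w | x \in cap z t]%fset |.

Lemma cap_count_le w z t : (cap_count w z t <= #|` w |)%N.
Proof. by apply: fsubset_leq_card; apply/fsubsetP => x; rewrite !inE => /andP[]. Qed.

Lemma cap_discrepancyE w : cap_discrepancy w =
  sup [set D | exists z t, [/\ sphere z, -1 <= t <= 1 &
    D = `|(cap_count w z t)%:R / #|` w |%:R - (1 - t) / 2|]].
Proof.
rewrite /cap_discrepancy; congr sup; apply/seteqP; split => D [z [t [hz ht ->]]].
  by exists z, t; rewrite cap_area_ratio.
by exists z, t; rewrite cap_area_ratio.
Qed.

Definition north : space3 R := (0, 0, 1).

Lemma sphere_north : sphere north.
Proof. by apply/sphereE; rewrite /dot /=; ring. Qed.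

Lemma cap_discrepancy_le w (B : R) :
  (forall z t, sphere z -> -1 <= t <= 1 -> `|(cap_count w z t)%:R / #|` w |%:R - (1 - t) / 2| <= B) ->
  cap_discrepancy w <= B.
Proof.
move=> h; rewrite cap_discrepancyE; apply: ge_sup.
  exists `|(cap_count w north 1)%:R / #|` w |%:R - (1 - 1) / 2|, north, 1; split => //.
    exact: sphere_north.
  by rewrite lexx andbT; lra.
by move=> D [z [t [hz ht ->]]]; exact: h.
Qed.

Lemma cap_dev_le2 w z t : (0 < #|` w |)%N -> -1 <= t <= 1 ->
  `|(cap_count w z t)%:R / #|` w |%:R - (1 - t) / 2| <= (2 : R).
Proof.
move=> w0 /andP[t1 t2].
have h1 : (cap_count w z t)%:R / #|` w |%:R <= 1 :> R.
  by rewrite ler_pdivrMr ?ltr0n // mul1r ler_nat cap_count_le.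
have h0 : 0 <= (cap_count w z t)%:R / #|` w |%:R :> R by rewrite divr_ge0.
by rewrite ler_norml; apply/andP; split; lra.
Qed.

Lemma cap_discrepancy_ge w z t : (0 < #|` w |)%N -> sphere z -> -1 <= t <= 1 ->
  `|(cap_count w z t)%:R / #|` w |%:R - (1 - t) / 2| <= cap_discrepancy w.
Proof.
move=> w0 hz ht; rewrite cap_discrepancyE; apply: ub_le_sup; last by exists z, t.
by exists 2 => D [z' [t' [_ ht' ->]]]; exact: cap_dev_le2.
Qed.

(* The caps of heights [h] and [h - e] around the north pole have nearly the
   same area but differ by all the points at height [h]. *)
Lemma cap_discrepancy_level w (s : seq (space3 R)) (h : R) :
  -1 < h <= 1 -> uniq s -> (forall x, x \in s -> [/\ x \in w, sphere x & x.2 = h]) ->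
  (size s)%:R <= 2 * #|` w |%:R * cap_discrepancy w.
Proof.
move=> /andP[h1 h2] us hs.
have [s0|s0] := posnP (size s).
  have [w0|w0] := posnP #|` w |; first by rewrite s0 w0 mulr0 mul0r.
  rewrite s0; apply: mulr_ge0 => //.
  by apply: (le_trans _ (@cap_discrepancy_ge w north h w0 sphere_north _)); rewrite ?(ltW h1) ?h2.
have w0 : (0 < #|` w |)%N.
  case: s s0 hs {us} => // x s _ /(_ x); rewrite inE eqxx => /(_ isT)[xw _ _].
  by rewrite cardfs_gt0; apply/fset0Pn; exists x.
have W0 : 0 < #|` w |%:R :> R by rewrite ltr0n.
apply/ler_addgt0Pr => e e0.
(* Small enough that the area difference [d / 2], multiplied by the number of points, is at most
   [e], and that the lowered level stays at least -1. *)
pose d := Num.min (2 * e / #|` w |%:R) (h + 1).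
have d0 : 0 < d by rewrite lt_min divr_gt0 ?mulr_gt0 //=; lra.
have d1 : d <= h + 1 by rewrite ge_min lexx orbT.
have d2 : d * #|` w |%:R <= 2 * e by rewrite -ler_pdivlMr // ge_min lexx.
have E1 := @cap_discrepancy_ge w north h w0 sphere_north.
have E2 := @cap_discrepancy_ge w north (h - d) w0 sphere_north.
have {}E1 := E1 ltac:(by rewrite (ltW h1) h2).
have {}E2 := E2 ltac:(by apply/andP; split; lra).
have cnt : (size s + cap_count w north h <= cap_count w north (h - d))%N.
  have sE : size s = #|` [fset x in s]%fset | by rewrite card_fseq undup_id.
  rewrite sE /cap_count -cardfsUI.
  have -> : ([fset x in s] `&` [fset x in w | x \in cap north h])%fset = fset0.
    apply/fsetP => x; rewrite !inE; apply/negP => /andP[/hs[_ _ xh] /andP[_]].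
    by rewrite inE /cap /= => -[_]; rewrite dot_e3 xh ltxx.
  rewrite cardfs0 addn0; apply: fsubset_leq_card; apply/fsubsetP => x.
  rewrite !inE => /orP[/hs[xw xs xh]|/andP[xw]].
    by rewrite xw /= inE /cap /=; split => //; rewrite dot_e3 xh; lra.
  rewrite xw /= !inE /cap /= => -[xs xh]; split => //; lra.
have {cnt} : (size s)%:R + (cap_count w north h)%:R <= (cap_count w north (h - d))%:R :> R.
  by rewrite -natrD ler_nat.
move: E1 E2; rewrite !ler_norml => /andP[E1 _] /andP[_ E2].
move: (size s)%:R (cap_count w north h)%:R (cap_count w north (h - d))%:R E1 E2 => a b c E1 E2 abc.
move: (cap_discrepancy w) E1 E2 => D E1 E2.
move: (#|` w |%:R : R) W0 d2 E1 E2 => W W0 d2 E1 E2.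
have F1 : - D * W <= b - (1 - h) / 2 * W.
  have -> : b - (1 - h) / 2 * W = (b / W - (1 - h) / 2) * W by field; rewrite gt_eqF.
  by rewrite ler_pM2r.
have F2 : c - (1 - (h - d)) / 2 * W <= D * W.
  have -> : c - (1 - (h - d)) / 2 * W = (c / W - (1 - (h - d)) / 2) * W by field; rewrite gt_eqF.
  by rewrite ler_pM2r.
nra.
Qed.

Variables (r : nat -> nat) (p : nat).
Hypothesis r3 : forall j, (1 <= j <= p)%N -> (3 <= r j)%N.
Hypothesis p0 : (0 < p)%N.

Definition ringset (th : nat -> R) : {fset space3 R} :=
  [fset x in [:: (0, 0, 1); (0, 0, -1)] ++
    [seq ringpt r p th (j, i) | j <- iota 1 p, i <- iota 1 (r j)]]%fset.

Lemma ringseqE (th : nat -> R) :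
  [seq ringpt r p th (j, i) | j <- iota 1 p, i <- iota 1 (r j)] =
  [seq ringpt r p th ji | ji <- ringidx r p].
Proof. by rewrite /ringidx map_allpairs. Qed.

Lemma ringseq_uniq (th : nat -> R) :
  uniq ([:: (0, 0, 1); (0, 0, -1)] ++ [seq ringpt r p th ji | ji <- ringidx r p]).
Proof.
rewrite /= inE negb_or.
have N1 : (1 : R) != -1 by rewrite -subr_eq0 opprK gt_eqF.
have zl : forall ji, ji \in ringidx r p -> -1 < (ringpt r p th ji : space3 R).2 < 1.
  by move=> ji /mem_ringidx[hj _]; exact: zlev_abs.
apply/and3P; split.
- apply/andP; split; first by apply/eqP => -[] /eqP; rewrite (negbTE N1).
  by apply/mapP => -[ji /zl /andP[_]] /[swap] <- /=; rewrite ltxx.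
- by apply/mapP => -[ji /zl /andP[h _] E]; move: h; rewrite -E /= ltxx.
- rewrite map_inj_in_uniq ?ringidx_uniq //; exact: ringpt_inj.
Qed.

Lemma card_ringset th : #|` ringset th | = (below r p.+1).+2.
Proof.
rewrite /ringset ringseqE card_fseq undup_id ?ringseq_uniq //.
by rewrite size_cat size_map size_ringidx.
Qed.

Lemma ringset_sphere th : [set` ringset th] `<=` sphere.
Proof.
move=> x /=; rewrite /ringset ringseqE !inE => /orP[/eqP ->|/orP[/eqP ->|]].
- by apply/sphereE; rewrite /dot /=; ring.
- by apply/sphereE; rewrite /dot /=; ring.
- by move=> /mapP[ji hji ->]; exact: ringpt_sphere.
Qed.

Lemma ringset_discrepancy_ge th (j : nat) : (1 <= j <= p)%N ->
  (r j)%:R <= 2 * (below r p.+1).+2%:R * cap_discrepancy (ringset th).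
Proof.
move=> hj; rewrite -(card_ringset th).
have := @cap_discrepancy_level (ringset th) [seq ringpt r p th (j, i) | i <- iota 1 (r j)] (zlev r p j).
rewrite size_map size_iota; apply.
- by have /andP[-> /ltW ->] := @zlev_abs R _ _ r3 _ hj.
- rewrite map_inj_in_uniq ?iota_uniq // => i l hi hl E.
  have mem k : k \in iota 1 (r j) -> (j, k) \in ringidx r p.
    move=> hk; apply/allpairsPdep; exists j, k; split => //.
    by rewrite mem_iota add1n ltnS.
  by have [] := ringpt_inj r3 (mem _ hi) (mem _ hl) E.
- move=> x /mapP[i hi ->]; have hji : (j, i) \in ringidx r p.
    by apply/allpairsPdep; exists j, i; split => //; rewrite mem_iota add1n ltnS.
  split => //; last exact: ringpt_sphere.
  by rewrite /ringset ringseqE !inE map_f ?orbT.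
Qed.

(** The term [2 / N] pays for the poles, which have no cell, and for the shares being [1 / (N - 1)]
    instead of [1 / N]. The lower deviation follows from the count of the complementary cap. *)
Lemma ringset_discrepancy_le th (de : R) :
  (forall j, (1 <= j <= p)%N -> celldiam r p j <= de) ->
  cap_discrepancy (ringset th) <= de / 2 + 2 / (below r p.+1).+2%:R.
Proof.
move=> hde; apply: cap_discrepancy_le => z t hz ht; rewrite card_ringset.
have zz : dot z z = 1 by apply/sphereE.
have [h1 h2] := ring_count_le r3 p0 th zz ht hde.
have cE : cap_count (ringset th) z t =
    (((0, 0, 1)%R \in cap z t) + ((0, 0, -1)%R \in cap z t) +
    size [seq ji <- ringidx r p | (t < dot z (ringpt r p th ji))%R])%N.
  rewrite /cap_count /ringset ringseqE card_fset_filter ?ringseq_uniq // count_cat /= addn0.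
  congr (_ + _)%N; rewrite count_map size_filter; apply: eq_in_count => ji hji /=.
  apply/idP/idP; first by rewrite inE => -[].
  by move=> h; rewrite inE; split => //; exact: ringpt_sphere.
have szE : (size [seq ji <- ringidx r p | (t < dot z (ringpt r p th ji))%R] +
   size [seq ji <- ringidx r p | (dot z (ringpt r p th ji) <= t)%R] = below r p.+1)%N.
  rewrite -size_ringidx !size_filter -(count_predC (fun ji => t < dot z (ringpt r p th ji))).
  by congr (_ + _)%N; apply: eq_count => ji /=; rewrite -leNgt.
have {szE} szR : (size [seq ji <- ringidx r p | (t < dot z (ringpt r p th ji))%R])%:R +
   (size [seq ji <- ringidx r p | (dot z (ringpt r p th ji) <= t)%R])%:R = (below r p.+1)%:R :> R.
  by rewrite -natrD szE.
have {cE} : (size [seq ji <- ringidx r p | (t < dot z (ringpt r p th ji))%R])%:R <= (cap_count (ringset th) z t)%:R :> R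
   /\ (cap_count (ringset th) z t)%:R <= 2 + (size [seq ji <- ringidx r p | (t < dot z (ringpt r p th ji))%R])%:R :> R.
  rewrite cE; split; first by rewrite ler_nat leq_addl.
  by rewrite -natrD ler_nat leq_add2r; case: (_ \in _); case: (_ \in _).
move: szR h1 h2; rewrite /rn -[(below r p.+1).+2]addn1 natrD -natr1.
move: (size _)%:R (size _)%:R (cap_count _ _ _)%:R => A B c.
have b0 : 0 <= (below r p.+1)%:R :> R by [].
move: b0; move: (below r p.+1)%:R => b b0 AB hA hB [c1 c2].
case/andP: ht => t1 t2.
have W0 : 0 < b + 1 + 1 by lra.
have -> : c / (b + 1 + 1) - (1 - t) / 2 = (c - (b + 1 + 1) * (1 - t) / 2) / (b + 1 + 1).
  by field; rewrite gt_eqF.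
rewrite normrM [X in _ * X]gtr0_norm ?invr_gt0 // ler_pdivrMr //.
have -> : (de / 2 + 2 / (b + 1 + 1)) * (b + 1 + 1) = de * (b + 1 + 1) / 2 + 2 by field; rewrite gt_eqF.
have de0 : 0 <= de.
  have hp : (1 <= p <= p)%N by rewrite p0 leqnn.
  apply: le_trans (hde p hp); have s0 := @rho_gt0 R _ _ r3 _ hp.
  by rewrite /celldiam !addr_ge0 // divr_ge0 // ?mulr_ge0 // ?ltW // ?pi_gt0 // rn_gt0.
rewrite ler_norml; apply/andP; split; nra.
Qed.

End Discrepancy.

(** * Expected energy of points on parallels with random phases *)

Lemma horner_deriv_root (F : comNzRingType) (p q : {poly F}) (a : F) :
  p = ('X - a%:P) * q -> p^`().[a] = q.[a].
Proof.
by move=> ->; rewrite derivM derivXsubC mul1r hornerD hornerM hornerXsubC subrr mul0r addr0.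
Qed.

(** * Chords between roots of unity *)

Section Chords.
Import complex.
Context {R : realType}.
Local Notation C := (complex R).
Local Notation cx := (@Complex R).

Definition normsq (x : C) : R := complex.Re x ^+ 2 + complex.Im x ^+ 2.

Lemma normsqM x y : normsq (x * y) = normsq x * normsq y.
Proof. by case: x y => [a b] [c d]; rewrite /normsq /=; ring. Qed.

Definition cis (x : R) : C := cx (cos x) (sin x).

Lemma cisX x k : cis x ^+ k = cis (k%:R * x).
Proof.
elim: k => [|k IHk]; first by rewrite expr0 mul0r /cis cos0 sin0.
rewrite exprS IHk -natr1 mulrDl mul1r addrC /cis cosD sinD.
apply/eqP; rewrite eq_complex /=; apply/andP; split; apply/eqP; ring.
Qed.

Lemma normsq_cis x : normsq (cis x) = 1.
Proof. by rewrite /normsq /= cos2Dsin2. Qed.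

Lemma normsq_natr (n : nat) : normsq n%:R = n%:R ^+ 2.
Proof.
have -> : n%:R = cx n%:R 0 :> C.
  elim: n => [//|n IHn]; rewrite -natr1 IHn -[in RHS]natr1.
  by apply/eqP; rewrite eq_complex /= addr0 !eqxx.
by rewrite /normsq /= expr0n addr0.
Qed.

Lemma normsq_cisB x y : normsq (cis x - cis y) = 2 - 2 * cos (x - y).
Proof.
rewrite /normsq /= cosB.
transitivity ((cos x ^+ 2 + sin x ^+ 2) + (cos y ^+ 2 + sin y ^+ 2) - 2 * (cos x * cos y + sin x * sin y)); first by ring.
by rewrite !cos2Dsin2; ring.
Qed.

Lemma chord_angle (k r : nat) : (0 < k < r)%N ->
  0 < k%:R * (2 * @pi R / r%:R) < 2 * @pi R.
Proof.
move=> /andP[k0 kr]; have rR : (0 : R) < r%:R by rewrite ltr0n (ltn_trans k0).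
have p0 : 0 < 2 * pi :> R by rewrite mulr_gt0 // pi_gt0.
have -> : k%:R * (2 * pi / r%:R) = k%:R / r%:R * (2 * pi) :> R by field; rewrite gt_eqF.
apply/andP; split; first by apply: mulr_gt0 => //; apply: divr_gt0 => //; rewrite ltr0n.
by rewrite gtr_pMl // ltr_pdivrMr // mul1r ltr_nat.
Qed.

Lemma cis_primitive (r : nat) : (0 < r)%N -> r.-primitive_root (cis (2 * pi / r%:R)).
Proof.
move=> r0; have rR : (0 : R) < r%:R by rewrite ltr0n.
apply/andP; split => //; apply/forallP => -[k kr] /=.
rewrite unity_rootE cisX; apply/eqP.
have [->|kN] := eqVneq k.+1 r.
  have -> : cis (r%:R * (2 * pi / r%:R)) = 1; last by rewrite eqxx.
  by rewrite mulrC divfK ?gt_eqF // /cis mulr_natl cos2pi sin2pi.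
apply/negP; rewrite eq_complex /= => /andP[/eqP h _].
have : cos (k.+1%:R * (2 * pi / r%:R)) < 1 :> R.
  by apply: cos_lt1; apply: chord_angle; rewrite (ltn_neqAle k.+1) kN.
by rewrite h ltxx.
Qed.

(* The product of the chords is the derivative of ['X^r - 1] at a root. *)
Lemma prod_chords (r i : nat) : (i < r)%N ->
  \prod_(0 <= l < r | l != i) (2 - 2 * cos ((i%:R - l%:R) * (2 * pi / r%:R))) = r%:R ^+ 2 :> R.
Proof.
move=> ir; have r0 : (0 < r)%N by exact: leq_ltn_trans ir.
set w := 2 * pi / r%:R; set z := cis w.
have zprim : r.-primitive_root z by exact: cis_primitive.
pose Q : {poly C} := \prod_(0 <= l < r | l != i) ('X - (z ^+ l)%:P).
have PE : 'X^r - 1 = ('X - (z ^+ i)%:P) * Q.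
  rewrite -(factor_Xn_sub_1 zprim) (bigD1_seq i) ?iota_uniq //=.
  by rewrite mem_index_iota.
have DE : Q.[z ^+ i] = r%:R * z ^+ i ^+ r.-1.
  by rewrite -(horner_deriv_root PE) derivB derivXn derivC subr0 hornerMn hornerXn mulr_natl.
transitivity (normsq Q.[z ^+ i]); last first.
  rewrite DE normsqM normsq_natr.
  have -> : normsq (z ^+ i ^+ r.-1) = 1 by rewrite -exprM cisX normsq_cis.
  by rewrite mulr1.
rewrite /Q horner_prod (big_morph normsq normsqM (_ : normsq 1 = 1)); last first.
  by rewrite /normsq /= expr1n expr0n addr0.
apply: eq_bigr => l _; rewrite hornerXsubC !cisX normsq_cisB.
by congr (_ - _ * cos _); ring.
Qed.

(** The logarithm of [prod_chords], with indices shifted by one because ring points are numbered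
    from 1. *)
Lemma sum_ln_chords (r i : nat) : (1 <= i <= r)%N ->
  \sum_(l <- iota 1 r | l != i) ln (2 - 2 * cos ((i%:R - l%:R) * (2 * pi / r%:R))) = 2 * ln r%:R :> R.
Proof.
move=> /andP[i1 ir]; have r0 : (0 < r)%N by exact: leq_trans ir.
have rR : (0 : R) < r%:R by rewrite ltr0n.
have -> : 2 * ln r%:R = ln (r%:R ^+ 2) :> R by rewrite lnXn // mulr_natl.
have i0 : (i.-1 < r)%N by rewrite prednK.
rewrite -(prod_chords i0).
have pos l : (0 <= l < r)%N -> l != i.-1 -> 0 < 2 - 2 * cos ((i.-1%:R - l%:R) * (2 * pi / r%:R)) :> R.
  move=> /andP[_ lr] li; suff : cos ((i.-1%:R - l%:R) * (2 * pi / r%:R)) < 1 :> R by move: (cos _) => c; lra.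
  have key a b : (a < b)%N -> (b < r)%N -> cos ((b%:R - a%:R) * (2 * pi / r%:R)) < 1 :> R.
    move=> ab br; rewrite -natrB ?(ltnW ab) //; apply: cos_lt1.
    by apply: chord_angle; rewrite subn_gt0 ab; apply: leq_ltn_trans br; exact: leq_subr.
  case: (ltngtP l i.-1) => h; [exact: key| |by rewrite h eqxx in li].
  by rewrite -cosN -mulNr opprB; exact: key.
have -> : iota 1 r = [seq l.+1 | l <- index_iota 0 r].
  by rewrite /index_iota subn0 -(iotaDl 1 0 r).
rewrite big_map.
have lnprod (s : seq nat) (Q : pred nat) (F : nat -> R) : (forall l, l \in s -> Q l -> 0 < F l) ->
    ln (\prod_(l <- s | Q l) F l) = \sum_(l <- s | Q l) ln (F l) /\ 0 < \prod_(l <- s | Q l) F l.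
  elim: s => [|a s IHs] h; first by rewrite !big_nil ln1.
  have [|h1 h2] := IHs; first by move=> l ls; apply: h; rewrite inE ls orbT.
  rewrite !big_cons; case: ifP => // Qa; have a0 : 0 < F a by apply: h; rewrite ?inE ?eqxx.
  by rewrite lnM ?posrE // h1 mulr_gt0.
rewrite (lnprod _ _ _ _).1; last by move=> l; rewrite mem_index_iota; exact: pos.
apply: eq_big => [l|l _]; first by rewrite -[in LHS](prednK i1) eqSS.
by congr (ln (_ - _ * cos (_ * _))); rewrite -[in LHS](prednK i1) -!natr1; ring.
Qed.

End Chords.

Section Means.
Context d (T : measurableType d) (R : realType) (P : probability T R).

(** Integrability is part of the notion, since additivity of the integral requires it. *)
Definition has_mean (f : T -> R) (m : R) : Prop :=
  P.-integrable setT (EFin \o f) /\ (\int[P]_x (f x)%:E = m%:E)%E.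

Lemma integral_probability_cst (k : R) : (\int[P]_x k%:E = k%:E)%E.
Proof.
transitivity (\int[P]_x (cst k%:E x))%E => //.
by rewrite integral_cst // -[RHS]mule1; congr (_ * _)%E; exact: probability_setT.
Qed.

Lemma mean_cst (k : R) : has_mean (fun=> k) k.
Proof.
split; first exact: finite_measure_integrable_cst.
exact: integral_probability_cst.
Qed.

Lemma mean_add f g a b : has_mean f a -> has_mean g b -> has_mean (fun x => f x + g x) (a + b).
Proof.
move=> [fi fm] [gi gm]; split; first exact: (integrableD _ fi gi).
transitivity (\int[P]_x ((f x)%:E + (g x)%:E))%E => //.
by rewrite integralD // fm gm.
Qed.

Lemma mean_scale k f a : has_mean f a -> has_mean (fun x => k * f x) (k * a).
Proof.
move=> [fi fm]; split; first exact: (integrableZl _ k fi).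
transitivity (\int[P]_x (k%:E * (f x)%:E))%E => //.
by rewrite integralZl // fm.
Qed.

Lemma mean_sum (I : eqType) (s : seq I) (Q : pred I) (f : I -> T -> R) (m : I -> R) :
  (forall i, i \in s -> Q i -> has_mean (f i) (m i)) ->
  has_mean (fun x => \sum_(i <- s | Q i) f i x) (\sum_(i <- s | Q i) m i).
Proof.
elim: s => [|i s IHs] h.
  by under eq_fun do rewrite big_nil; rewrite big_nil; exact: mean_cst.
under eq_fun do rewrite big_cons; rewrite big_cons.
have hs : has_mean (fun x => \sum_(i <- s | Q i) f i x) (\sum_(i <- s | Q i) m i).
  by apply: IHs => k ks; apply: h; rewrite inE ks orbT.
by case: ifP => // Qi; apply: mean_add => //; apply: h; rewrite // inE eqxx.
Qed.

Lemma mean_bounded (f : T -> R) (K : R) : measurable_fun setT f -> (forall x, `|f x| <= K) ->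
  exists m, has_mean f m.
Proof.
move=> mf fK; have fi : P.-integrable setT (EFin \o f).
  apply: measurable_bounded_integrable => //; first by apply: le_lt_trans (probability_le1 P measurableT) _; exact: ltry.
  exists K; split; first exact: num_real.
  by move=> M KM x _ /=; apply: le_trans (fK x) _; exact: ltW.
exists (fine (\int[P]_x (f x)%:E)); split => //; rewrite fineK //.
exact: integrable_fin_num.
Qed.

Lemma mean_norm_le (f : T -> R) (m K : R) : (forall x, `|f x| <= K) -> has_mean f m -> `|m| <= K.
Proof.
move=> fK [fi fm]; rewrite -lee_fin; have -> : (`|m|%:E = `|m%:E|)%E by [].
rewrite -fm; apply: le_trans (le_abse_integral _ _ _) _ => //.
  by case/integrableP: fi.
rewrite -[leRHS]integral_probability_cst.
apply: ge0_le_integral => //.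
- by case/integrableP: fi => mf _; exact: measurableT_comp.
- by move=> x _; rewrite lee_fin; exact: le_trans (fK x).
Qed.

End Means.

(** * The circle mean of the logarithmic kernel *)

Section UniformPhase.
Context {R : realType}.
Notation mu := (@lebesgue_measure R).
Notation RR := (measurableTypeR R).

Definition UP : probability RR R := uniform_prob (@lt0_2pi R).

Let integ (f : R -> R) (a b : R) := (\int[mu]_(x in `]a, b]) (f x)%:E)%E.

Lemma itv_integral_split (f : R -> R) (a b c : R) : measurable_fun setT (f : RR -> RR) -> (forall x, 0 <= f x) ->
  a <= b -> b <= c -> integ f a c = (integ f a b + integ f b c)%E.
Proof.
move=> mf f0 ab bc; rewrite /integ.
have -> : [set` `]a, c]] = [set` `]a, b]] `|` [set` `]b, c]] :> set R.
  by rewrite -itv_bndbnd_setU.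
rewrite ge0_integral_setU //.
- by apply/measurable_EFinP; exact: measurable_funTS.
- by move=> x _; rewrite lee_fin.
- rewrite disj_set2E; apply/eqP; rewrite -subset0 => x [] /=; rewrite !in_itv /= => /andP[_ h1] /andP[h2 _].
  by move: h1; rewrite leNgt h2.
Qed.

Lemma itv_integral_translate (f : R -> R) (a b s : R) : measurable_fun setT (f : RR -> RR) -> (forall x, 0 <= f x) ->
  integ (fun x => f (x + s)) a b = integ f (a + s) (b + s).
Proof.
move=> mf f0; rewrite /integ.
have mphi : measurable_fun setT ((fun x => x + s) : RR -> RR) by mfun.
have -> : [set` `]a, b]] = ((fun x => x + s) : RR -> RR) @^-1` [set` `]a + s, b + s]].
  by apply/seteqP; split => x /=; rewrite !in_itv /= ltrD2r lerD2r.
have := @ge0_integral_pushforward _ _ _ _ _ _ mphi mu [set` `]a + s, b + s]] (EFin \o f).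
rewrite /comp => <- //.
- apply: eq_measure_integral => A mA _; exact: lebesgue_measure_translate.
- by apply/measurable_EFinP; exact: measurable_funTS.
- by move=> x _; rewrite lee_fin.
Qed.

Lemma UP_integralE (f : R -> R) : measurable_fun setT (f : RR -> RR) -> (forall x, 0 <= f x) ->
  (\int[UP]_x (f x)%:E = ((2 * pi)^-1)%:E * integ f 0 (2 * pi))%E.
Proof.
move=> mf f0; rewrite /UP [LHS](@integral_uniform R 0 (2 * pi) lt0_2pi (EFin \o f)).
- rewrite subr0 /integ integral_itv_obnd_cbnd //.
  by apply/measurable_EFinP; exact: measurable_funTS.
- exact/measurable_EFinP.
- by move=> x; rewrite lee_fin.
Qed.

(** Reduce the shift modulo [2 pi] to [u]; then cut [[u, u + 2 pi]] at [2 pi] and move the tail back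
    by one period. *)
Lemma UP_shift_ge0 (f : R -> R) (s : R) : measurable_fun setT (f : RR -> RR) -> (forall x, 0 <= f x) ->
  (forall (k : int) x, f (x + k%:~R * (2 * pi)) = f x) ->
  (\int[UP]_x (f (x + s))%:E = \int[UP]_x (f x)%:E)%E.
Proof.
move=> mf f0 per.
have [k /andP[k0 k1]] := euclid_mod s (@lt0_2pi R).
set u := s - _ in k0 k1.
have -> : (fun x => (f (x + s))%:E) = (fun x => (f (x + u))%:E).
  apply/funext => x; congr (_%:E); rewrite -(per k (x + u)); congr f; rewrite /u; ring.
have mfu : measurable_fun setT ((fun x => f (x + u)) : RR -> RR).
  by apply: (measurableT_comp mf); mfun.
rewrite !UP_integralE //; congr (_ * _)%E.
rewrite itv_integral_translate // add0r.
rewrite (@itv_integral_split f u (2 * pi)) //; [|exact: ltW|by rewrite lerDl].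
rewrite (@itv_integral_split f 0 u) // ?(ltW k1) // addeC; congr (_ + _)%E.
rewrite addrC; have -> : integ f (2 * pi) (u + 2 * pi) = integ (fun x => f (x + 2 * pi)) 0 u.
  by rewrite itv_integral_translate // add0r.
by rewrite /integ; apply: eq_integral => x _; rewrite -[in LHS](mul1r (2 * pi)) (per 1).
Qed.

(** Adding the bound [K] makes the function nonnegative, which reduces the claim to
    [UP_shift_ge0]. *)
Lemma UP_shift (f : R -> R) (s K m : R) : measurable_fun setT (f : RR -> RR) ->
  (forall x, `|f x| <= K) -> (forall (k : int) x, f (x + k%:~R * (2 * pi)) = f x) ->
  has_mean UP f m -> has_mean UP (fun x => f (x + s)) m.
Proof.
move=> mf fK per fm.
have mfs : measurable_fun setT ((fun x => f (x + s)) : RR -> RR).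
  by apply: (measurableT_comp mf); mfun.
have [m' fm'] := mean_bounded UP mfs (fun x => fK (x + s)).
have f0 x : 0 <= f x + K.
  by have := fK x; rewrite ler_norml => /andP[h _]; rewrite -lerBlDr sub0r.
have [_ h1] := mean_add fm (mean_cst UP K).
have [_ h2] := mean_add fm' (mean_cst UP K).
suff -> : m = m' by [].
apply: (addIr K); apply: EFin_inj; rewrite -h1 -h2; apply/esym.
apply: (@UP_shift_ge0 (fun x => f x + K)) => //.
- by apply: measurable_funD.
- by move=> k x; rewrite per.
Qed.

Implicit Types (t x : R).

(* [pker t x] is [ln |1 - t e^(ix)|^2]. *)
Definition pker (t x : R) : R := ln (1 + t ^+ 2 - 2 * t * cos x).

Lemma pker_arg_ge (t x : R) : 0 <= t -> (1 - t) ^+ 2 <= 1 + t ^+ 2 - 2 * t * cos x <= (1 + t) ^+ 2.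
Proof. by move=> t0; have h1 := cos_geN1 x; have h2 := cos_le1 x; apply/andP; split; nra. Qed.

Lemma measurable_pker t : measurable_fun setT (pker t : RR -> RR).
Proof.
apply: (measurableT_comp (@measurable_ln R)).
apply: measurable_funB => //; apply: measurable_funM => //.
exact: continuous_measurable_fun (@continuous_cos R).
Qed.

(** The modulus of [1 - t e^(ix)] lies between [1 - t0] and 2. The bound depends on [t0] alone so
    that it survives the replacement of [t] by [t ^ 2]. *)
Lemma pker_bound (t0 t x : R) : 0 <= t -> t <= t0 -> t0 < 1 ->
  `|pker t x| <= 2 * ln (1 - t0)^-1 + 2 * ln 2.
Proof.
move=> tp tt t1; have /andP[h1 h2] := pker_arg_ge x tp.
have a0 : 0 < (1 - t) ^+ 2 by rewrite exprn_gt0 // subr_gt0 (le_lt_trans tt).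
have b0 : 0 < 1 - t0 by rewrite subr_gt0.
have arg0 := lt_le_trans a0 h1.
have l2 : 0 <= ln 2 :> R by rewrite ln_ge0 // ler1n.
have l1 : 0 <= ln (1 - t0)^-1.
  by rewrite ln_ge0 // invf_ge1 // gerBl (le_trans tp).
have ln2E (y : R) : 0 < y -> ln (y ^+ 2) = 2 * ln y by move=> y0; rewrite lnXn // mulr_natl.
rewrite /pker ler_norml; apply/andP; split.
  apply: (@le_trans _ _ (- (2 * ln (1 - t0)^-1))).
    by rewrite lerN2 lerDl mulr_ge0.
  rewrite lnV ?posrE // mulrN opprK -ln2E //.
  by rewrite ler_ln ?posrE ?exprn_gt0 //; apply: le_trans h1; nra.
apply: (@le_trans _ _ (2 * ln 2)); last by rewrite lerDr mulr_ge0.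
rewrite -ln2E // ler_ln ?posrE ?exprn_gt0 //.
by apply: le_trans h2 _; nra.
Qed.

(** [(1 - t e^(ix)) (1 + t e^(ix)) = 1 - t ^ 2 e^(2ix)], on squared moduli. *)
Lemma pker_double (t x : R) : 0 <= t -> t < 1 ->
  pker t x + pker t (x + pi) = pker (t ^+ 2) (2 * x).
Proof.
move=> t0 t1; have /andP[h1 _] := pker_arg_ge x t0; have /andP[h2 _] := pker_arg_ge (x + pi) t0.
have a0 : 0 < (1 - t) ^+ 2 by rewrite exprn_gt0 // subr_gt0.
rewrite /pker -lnM ?posrE ?(lt_le_trans a0) //; congr ln.
by rewrite cosDpi (_ : 2 * x = x *+ 2) ?mulr_natl // cos_mulr2n; ring.
Qed.

Lemma pker_per t (q : nat) (k : int) x : pker t (q%:R * (x + k%:~R * (2 * pi))) = pker t (q%:R * x).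
Proof.
rewrite /pker; have -> : q%:R * (x + k%:~R * (2 * pi)) = q%:R * x + ((q : int) * k)%:~R * (2 * pi) :> R.
  by rewrite intrM; ring.
by rewrite cos_periodz.
Qed.

(* Doubling: twice the mean of [pker t] is that of [pker (t ^+ 2)], and all the
   [pker t'] with [0 <= t' <= t0] are bounded by the same numerator. *)
Lemma pker_mean_bound (t0 : R) (n : nat) : t0 < 1 -> forall t (q : nat) (m : R), 0 <= t -> t <= t0 -> (0 < q)%N ->
  has_mean UP (fun x => pker t (q%:R * x)) m ->
  `|m| <= (2 * ln (1 - t0)^-1 + 2 * ln 2) / 2 ^+ n.
Proof.
move=> t01; set B := _ + _; have mq t q : measurable_fun setT ((fun x => pker t (q%:R * x)) : RR -> RR).
  by apply: (measurableT_comp (measurable_pker t)); mfun.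
elim: n => [|n IHn] t q m tp tt q0 hm.
  by rewrite expr0 divr1; apply: (mean_norm_le _ hm) => x; exact: pker_bound.
have qR : (0 : R) < q%:R by rewrite ltr0n.
(* The shift by [pi / q] adds [pi] to [q x] and preserves the mean, so [pker_double] applies; the
   frequency [q] doubles at each step. *)
have hm2 : has_mean UP (fun x => pker t (q%:R * (x + pi / q%:R))) m.
  apply: (@UP_shift (fun x => pker t (q%:R * x)) _ B) => //.
    by move=> x; exact: pker_bound.
  by move=> k x; exact: pker_per.
have := mean_add hm hm2.
have -> : (fun x => pker t (q%:R * x) + pker t (q%:R * (x + pi / q%:R))) = (fun x => pker (t ^+ 2) ((2 * q)%:R * x)).
  apply/funext => x; have -> : q%:R * (x + pi / q%:R) = q%:R * x + pi by field; rewrite gt_eqF.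
  by rewrite pker_double ?(le_lt_trans tt) // natrM mulrA.
move=> /IHn h; have {}h : `|m + m| <= B / 2 ^+ n.
  apply: h; rewrite ?muln_gt0 ?exprn_ge0 //.
  by nra.
rewrite exprS invfM mulrCA [leRHS]mulrC ler_pdivlMr //.
by have -> : `|m| * 2 = `|m + m| by rewrite -mulr2n normrMn mulr_natr.
Qed.

(** The mean is bounded by a fixed number divided by [2 ^ n] for every [n], hence vanishes. *)
Lemma pker_mean0 (t s : R) : 0 <= t -> t < 1 -> has_mean UP (fun x => pker t (x + s)) 0.
Proof.
move=> t0 t1; have [m hm] := @mean_bounded _ _ _ UP (fun x => pker t x) _ (measurable_pker t) (fun x => pker_bound x t0 (lexx t) t1).
suff m0 : m = 0.
  rewrite -m0; apply: (@UP_shift (pker t) s (2 * ln (1 - t)^-1 + 2 * ln 2)) => //.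
  - exact: measurable_pker.
  - by move=> x; exact: pker_bound.
  - by move=> k x; rewrite /pker cos_periodz.
have hm1 : has_mean UP (fun x => pker t (1%:R * x)) m by under eq_fun do rewrite mul1r.
have h n := @pker_mean_bound t n t1 t 1 m t0 (lexx t) isT hm1.
set B := _ + _ in h.
apply/eqP; rewrite -normr_eq0 eq_le normr_ge0 andbT leNgt; apply/negP => mp.
have [n hn] : exists n : nat, B / `|m| < n%:R.
  by exists (Num.truncn (B / `|m|)).+1; exact: truncnS_gt.
have := h n; rewrite ler_pdivlMr ?exprn_gt0 // leNgt => /negP; apply.
rewrite ltr_pdivrMr // mulrC in hn; apply: lt_le_trans hn _.
rewrite ler_pM2l // -natrX ler_nat; exact: ltnW (ltn_expl _ _).
Qed.

End UniformPhase.

Section PairMean.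
Context {R : realType} d (T : measurableType d) (P : probability T R).
Notation RR := (measurableTypeR R).

(** By independence the pair has the product of two uniform laws. With [Y] fixed, the mean over [X]
    is that of a shift of [h], always [m]; adding [K] makes Tonelli's theorem applicable. *)
Lemma pair_mean (X Y : {RV P >-> R}) (h : R -> R) (K m c : R) :
  uniform_phase X -> uniform_phase Y ->
  (forall A B : set R, measurable A -> measurable B ->
     P (X @^-1` A `&` Y @^-1` B) = (P (X @^-1` A) * P (Y @^-1` B))%E) ->
  measurable_fun setT (h : RR -> RR) -> (forall x, `|h x| <= K) ->
  (forall s, has_mean UP (fun x => h (x + s)) m) ->
  has_mean P (fun w => h (X w - Y w + c)) m.
Proof.
move=> uX uY ind mh hK hm.
have mX : measurable_fun setT (X : T -> RR) by exact: (@measurable_funP _ _ _ _ setT X).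
have mY : measurable_fun setT (Y : T -> RR) by exact: (@measurable_funP _ _ _ _ setT Y).
have mf : measurable_fun setT (fun w => h (X w - Y w + c)).
  apply: (measurableT_comp mh); apply: measurable_funD => //; exact: measurable_funB.
have [m' hm'] := mean_bounded P mf (fun w => hK _).
suff <- : m' = m by [].
have [_ E'] := mean_add hm' (mean_cst P K).
apply: (addIr K); apply: EFin_inj; rewrite -E'.
have mXY : measurable_fun setT (fun w => (X w, Y w) : RR * RR).
  exact: measurable_fun_pair.
pose g (p : RR * RR) := (h (p.1 - p.2 + c) + K)%:E.
have mg : measurable_fun setT g.
  apply/measurable_EFinP; apply: measurable_funD => //; apply: (measurableT_comp mh).
  by mfun.
have g0 p : (0 <= g p)%E.
  rewrite lee_fin; have := hK (p.1 - p.2 + c); rewrite ler_norml => /andP[h1 _].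
  by rewrite -lerBlDr sub0r.
transitivity (\int[pushforward P (fun w => (X w, Y w) : RR * RR)]_p g p)%E.
  by rewrite ge0_integral_pushforward.
transitivity (\int[UP \x UP]_p g p)%E.
  apply: eq_measure_integral => A mA _; apply/esym.
  have := @product_measure_unique _ _ _ _ R UP UP (pushforward P (fun w => (X w, Y w) : RR * RR)).
  apply => // B C mB mC.
  transitivity (P (X @^-1` B `&` Y @^-1` C)) => //.
  rewrite ind //; congr (_ * _)%E; [exact: uX|exact: uY].
rewrite fubini_tonelli2 // /fubini_G.
transitivity (\int[UP]_y (m + K)%:E)%E; last exact: integral_probability_cst.
apply: eq_integral => y _.
have [_ E] := mean_add (hm (- y + c)) (mean_cst UP K).
by rewrite -E; apply: eq_integral => x _; rewrite /g /= addrA.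
Qed.

End PairMean.

Section PairEnergy.
Context {R : realType}.
Notation R3 := (space3 R).

(** The value 0 for equal points lets double sums run over all ordered pairs. *)
Definition pair_energy (x y : R3) : R := if x == y then 0 else ln (enorm (x - y))^-1.

Lemma log_energyE (w : {fset R3}) : log_energy w = \sum_(x <- w) \sum_(y <- w) pair_energy x y.
Proof.
rewrite /log_energy; apply: eq_bigr => x _; rewrite big_mkcond; apply: eq_bigr => y _.
by rewrite /pair_energy; case: eqP.
Qed.

Lemma big_fset_seq (K : choiceType) (S : seq K) (F : K -> R) : uniq S ->
  \sum_(x <- [fset y in S]%fset) F x = \sum_(x <- S) F x.
Proof.
move=> uS; apply: perm_big; apply: uniq_perm; [exact: fset_uniq|exact: uS|].
by move=> x; rewrite in_fset.
Qed.

Lemma pair_energyE (x y : R3) : x != y -> 0 < dot (x - y) (x - y) ->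
  pair_energy x y = - (1 / 2) * ln (dot (x - y) (x - y)).
Proof.
move=> xy d0; rewrite /pair_energy (negbTE xy).
have n0 : 0 < enorm (x - y) by rewrite /enorm sqrtr_gt0.
rewrite lnV ?posrE // -[in RHS](sqr_sqrtr (ltW d0)) -/(enorm _) lnXn // -mulr_natl.
by field.
Qed.

Lemma pair_energyC (x y : R3) : pair_energy x y = pair_energy y x.
Proof.
rewrite /pair_energy eq_sym; case: eqP => // _; congr (ln (Num.sqrt _)^-1).
by rewrite /dot /=; ring.
Qed.

End PairEnergy.

(** * The expected energy as a sum over the rings *)

Section RingEnergy.
Context {R : realType}.
Notation R3 := (space3 R).
Variables (r : nat -> nat) (p : nat).
Hypothesis r3 : forall j, (1 <= j <= p)%N -> (3 <= r j)%N.
Hypothesis p0 : (0 < p)%N.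

Notation zl := (@zlev R r p).
Notation rh := (@rho R r p).
Notation pt := (@ringpt R r p).
Notation idx := (ringidx r p).

Definition lap (j : nat) : R := ln (1 + zl j).
Definition lam (j : nat) : R := ln (1 - zl j).

Lemma onep_gt0 j : (1 <= j <= p)%N -> 0 < 1 + zl j.
Proof. by move=> hj; have /andP[h1 h2] := @zlev_abs R _ _ r3 _ hj; rewrite -ltrBlDl sub0r. Qed.

Lemma onem_gt0 j : (1 <= j <= p)%N -> 0 < 1 - zl j.
Proof. by move=> hj; have /andP[h1 h2] := @zlev_abs R _ _ r3 _ hj; rewrite subr_gt0. Qed.

(** The squared distances from the poles to a point at height [z] are [2 (1 - z)] and [2 (1 + z)],
    whatever its azimuth. *)
Lemma pole_energy th ji : ji \in idx ->
  pair_energy (0, 0, 1) (pt th ji) = - (1 / 2) * (ln 2 + lam ji.1) /\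
  pair_energy (0, 0, -1) (pt th ji) = - (1 / 2) * (ln 2 + lap ji.1).
Proof.
move=> hji; have [hj _] := mem_ringidx hji.
have p1 := onep_gt0 hj; have m1 := onem_gt0 hj.
have dE (e : R) : e ^+ 2 = 1 -> dot ((0, 0, e) - pt th ji) ((0, 0, e) - pt th ji) = 2 * (1 - e * zl ji.1).
  move=> ee; rewrite /dot /ringpt /=.
  have := rho_sqr r3 (R := R) hj; have := cos2Dsin2 (2 * pi * ji.2%:R / (r ji.1)%:R + th ji.1).
  move: (cos _) (sin _) (rh _) (zl _) => c s q z cs qz.
  transitivity (q ^+ 2 * (c ^+ 2 + s ^+ 2) + e ^+ 2 - 2 * e * z + z ^+ 2); first by ring.
  by rewrite cs qz ee; ring.
have e1 : (1 : R) ^+ 2 = 1 by rewrite expr1n.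
have e2 : (-1 : R) ^+ 2 = 1 by rewrite sqrrN expr1n.
split; rewrite pair_energyE ?dE // ?mul1r ?mulN1r ?opprK ?mulr_gt0 //.
- by rewrite lnM ?posrE.
- by apply/eqP => E; move: m1; rewrite -[zl ji.1]/((pt th ji).2) -E /= subrr ltxx.
- by rewrite lnM ?posrE.
- by apply/eqP => E; move: p1; rewrite -[zl ji.1]/((pt th ji).2) -E /= subrr ltxx.
Qed.

Lemma poles_energy : pair_energy (0, 0, 1) (0, 0, -1) = - ln 2 :> R.
Proof.
have ne : ((0, 0, 1) : R3) != (0, 0, -1).
  by apply/eqP => -[] /eqP; rewrite -subr_eq0 opprK gt_eqF.
have dE : dot ((0, 0, 1) - (0, 0, -1) : R3) ((0, 0, 1) - (0, 0, -1) : R3) = 2 ^+ 2.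
  by rewrite /dot /=; ring.
rewrite (pair_energyE ne); first by rewrite [dot _ _]dE lnXn // -mulr_natl; field.
by rewrite [dot _ _]dE exprn_gt0 //.
Qed.

Lemma ring_dist (th : nat -> R) (a b : nat * nat) :
  (1 <= a.1 <= p)%N -> (1 <= b.1 <= p)%N ->
  dot (pt th a - pt th b) (pt th a - pt th b) =
  2 - 2 * (zl a.1 * zl b.1) - 2 * (rh a.1 * rh b.1) *
    cos (th a.1 - th b.1 + (2 * pi * a.2%:R / (r a.1)%:R - 2 * pi * b.2%:R / (r b.1)%:R)).
Proof.
move=> ha hb; rewrite /dot /ringpt /=.
have := rho_sqr r3 (R := R) ha; have := rho_sqr r3 (R := R) hb.
have -> : th a.1 - th b.1 + (2 * pi * a.2%:R / (r a.1)%:R - 2 * pi * b.2%:R / (r b.1)%:R) =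
  (2 * pi * a.2%:R / (r a.1)%:R + th a.1) - (2 * pi * b.2%:R / (r b.1)%:R + th b.1) by ring.
move: (2 * pi * a.2%:R / (r a.1)%:R + th a.1) (2 * pi * b.2%:R / (r b.1)%:R + th b.1) => x y.
rewrite cosB; have := cos2Dsin2 x; have := cos2Dsin2 y.
move: (cos x) (sin x) (cos y) (sin y) (rh a.1) (rh b.1) (zl a.1) (zl b.1) => c s c' s' q q' z z' E1 E2 E3 E4.
transitivity (q ^+ 2 * (c ^+ 2 + s ^+ 2) + q' ^+ 2 * (c' ^+ 2 + s' ^+ 2) - 2 * (q * q') * (c * c' + s * s') + z ^+ 2 + z' ^+ 2 - 2 * (z * z')); first by ring.
by rewrite E1 E2 E3 E4; ring.
Qed.

(** The common phase cancels, so this energy is not random: the squared distance is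
    [rho ^ 2 = (1 + z) (1 - z)] times a squared chord of the unit circle. *)
Lemma same_ring_energy th j i l : (j, i) \in idx -> (j, l) \in idx -> l != i ->
  pair_energy (pt th (j, i)) (pt th (j, l)) =
  - (1 / 2) * (lap j + lam j + ln (2 - 2 * cos ((i%:R - l%:R) * (2 * pi / (r j)%:R)))).
Proof.
move=> hi hl li; have [/= hj _] := mem_ringidx hi.
have r1 : (0 : R) < (r j)%:R by rewrite ltr0n (leq_trans _ (r3 hj)).
have p1 := onep_gt0 hj; have m1 := onem_gt0 hj.
have ne : pt th (j, i) != pt th (j, l).
  by apply: contraNneq li => /(ringpt_inj r3 hi hl) [->].
have aE : th j - th j + (2 * pi * i%:R / (r j)%:R - 2 * pi * l%:R / (r j)%:R) = (i%:R - l%:R) * (2 * pi / (r j)%:R).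
  by field; rewrite gt_eqF.
have dE : dot (pt th (j, i) - pt th (j, l)) (pt th (j, i) - pt th (j, l)) =
   ((1 + zl j) * (1 - zl j)) * (2 - 2 * cos ((i%:R - l%:R) * (2 * pi / (r j)%:R))).
  rewrite ring_dist //= aE -!expr2 (rho_sqr r3 hj); ring.
have [_ [/andP[/= i1 ir] /andP[/= l1 lr]]] := (hj, (proj2 (mem_ringidx hi), proj2 (mem_ringidx hl))).
have c1 : 0 < 2 - 2 * cos ((i%:R - l%:R) * (2 * pi / (r j)%:R)) :> R.
  have key a b : (0 < a)%N -> (a < b)%N -> (b <= r j)%N -> cos ((b%:R - a%:R) * (2 * pi / (r j)%:R)) < 1 :> R.
    move=> a0 ab br; rewrite -natrB ?(ltnW ab) //; apply: cos_lt1; apply: chord_angle.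
    rewrite subn_gt0 ab /=; apply: leq_trans br.
    by rewrite ltn_subLR ?(ltnW ab) // -[b in (b < _)%N]add0n ltn_add2r.
  suff : cos ((i%:R - l%:R) * (2 * pi / (r j)%:R)) < 1 :> R by move: (cos _) => c; lra.
  case: (ltngtP l i) => h; [exact: key| |by rewrite h eqxx in li].
  by rewrite -cosN -mulNr opprB; exact: key.
rewrite pair_energyE // dE ?mulr_gt0 // lnM ?posrE ?mulr_gt0 // lnM ?posrE //.
Qed.

Definition Lpair (j k : nat) : R := if (j < k)%N then lap j + lam k else lap k + lam j.

Section Mean.
Context d (T : measurableType d) (P : probability T R).
Variable th : nat -> {RV P >-> R}.
Hypothesis hth : random_phases p th.

Lemma phases_pair j k : (1 <= j <= p)%N -> (1 <= k <= p)%N -> j != k ->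
  forall A B : set R, measurable A -> measurable B ->
    P (th j @^-1` A `&` th k @^-1` B) = (P (th j @^-1` A) * P (th k @^-1` B))%E.
Proof.
move=> hj hk jk A B mA mB; have [_ ind] := hth.
pose S (i : nat) := if i == j then A else B.
have := ind [fset j; k]%fset S.
have -> : \bigcap_(i in [set` [fset j; k]%fset]) (th i @^-1` S i) = th j @^-1` A `&` th k @^-1` B.
  apply/seteqP; split => w.
    move=> h; split.
      by have := h j; rewrite /S /= eqxx; apply; rewrite !inE eqxx.
    by have := h k; rewrite /S /= eq_sym (negbTE jk); apply; rewrite !inE eqxx orbT.
  move=> [h1 h2] i /=; rewrite !inE => /orP[/eqP ->|/eqP ->]; rewrite /S /=.
    by rewrite eqxx.
  by rewrite eq_sym (negbTE jk).
have -> : (\prod_(i <- [fset j; k]%fset) P (th i @^-1` S i) = P (th j @^-1` A) * P (th k @^-1` B))%E.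
  rewrite (perm_big [:: j; k]); last first.
    apply: uniq_perm; first exact: fset_uniq.
      by rewrite /= inE jk.
    by move=> i; rewrite !inE.
  by rewrite !big_cons big_nil /= mule1 /S eqxx eq_sym (negbTE jk).
apply.
  by move=> i /=; rewrite !inE => /orP[/eqP ->|/eqP ->].
by move=> i; rewrite /S; case: ifP.
Qed.

Lemma cross_ring_mean_lt a b : a \in idx -> b \in idx -> (a.1 < b.1)%N ->
  has_mean P (fun w => pair_energy (pt (fun j => th j w) a) (pt (fun j => th j w) b))
    (- (1 / 2) * (lap a.1 + lam b.1)).
Proof.
move=> ha hb ab; have [hja _] := mem_ringidx ha; have [hjb _] := mem_ringidx hb.
have zz : zl b.1 < zl a.1 by apply: zlev_lt => //; [case/andP: hja|case/andP: hjb].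
have pa := onep_gt0 hja; have ma := onem_gt0 hja.
have pb := onep_gt0 hjb; have mb := onem_gt0 hjb.
(* [A2 + B2 = 2 - 2 z z'] and [A2 * B2] is the square of the product of the two radii, so the
   squared distance is [A2] times the argument of the logarithm in [pker t]; the higher ring comes
   first, which gives [t < 1]. *)
pose A2 := (1 + zl a.1) * (1 - zl b.1); pose B2 := (1 - zl a.1) * (1 + zl b.1).
have A20 : 0 < A2 by rewrite mulr_gt0.
have B20 : 0 < B2 by rewrite mulr_gt0.
have BA : B2 < A2 by rewrite /A2 /B2; lra.
pose t := Num.sqrt (B2 / A2).
have t0 : 0 <= t by exact: sqrtr_ge0.
have t2 : t ^+ 2 = B2 / A2 by rewrite sqr_sqrtr // divr_ge0 // ltW.
have t1 : t < 1.
  by rewrite -(@ltr_pXn2r _ 2) ?nnegrE // expr1n t2 ltr_pdivrMr // mul1r.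
have At : A2 * t = rh a.1 * rh b.1.
  have s1 := rho_gt0 (R := R) r3 hja; have s2 := rho_gt0 (R := R) r3 hjb.
  have g1 : 0 <= A2 * t by apply: mulr_ge0 => //; exact: ltW.
  have g2 : 0 <= rh a.1 * rh b.1 by apply: mulr_ge0; exact: ltW.
  apply/eqP; rewrite -(@eqrXn2 _ 2) //; apply/eqP.
  rewrite [LHS]exprMn [RHS]exprMn t2 (rho_sqr r3 hja) (rho_sqr r3 hjb).
  have -> : A2 ^+ 2 * (B2 / A2) = A2 * B2 by field; rewrite gt_eqF.
  by rewrite /A2 /B2; ring.
pose c : R := 2 * pi * a.2%:R / (r a.1)%:R - 2 * pi * b.2%:R / (r b.1)%:R.
have ne w : pt (fun j => th j w) a != pt (fun j => th j w) b.
  by apply/eqP => /(ringpt_inj r3 ha hb) E; rewrite E ltnn in ab.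
have karg x : 0 < 1 + t ^+ 2 - 2 * t * cos x.
  by have /andP[h _] := pker_arg_ge x t0; apply: lt_le_trans h; rewrite exprn_gt0 // subr_gt0.
have E w : pair_energy (pt (fun j => th j w) a) (pt (fun j => th j w) b) =
    - (1 / 2) * ln A2 + - (1 / 2) * pker t (th a.1 w - th b.1 w + c).
  have dE : dot (pt (fun j => th j w) a - pt (fun j => th j w) b) (pt (fun j => th j w) a - pt (fun j => th j w) b) =
      A2 * (1 + t ^+ 2 - 2 * t * cos (th a.1 w - th b.1 w + c)).
    rewrite ring_dist // -/c -At t2; move: (cos _) => co.
    have -> : A2 * (1 + B2 / A2 - 2 * t * co) = A2 + B2 - 2 * (A2 * t) * co by field; rewrite gt_eqF.
    by rewrite /A2 /B2; ring.
  by rewrite pair_energyE ?dE ?mulr_gt0 // lnM ?posrE // mulrDr.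
rewrite (_ : (fun w => _) = (fun w => - (1 / 2) * ln A2 + - (1 / 2) * pker t (th a.1 w - th b.1 w + c))); last first.
  exact/funext.
have -> : - (1 / 2) * (lap a.1 + lam b.1) = - (1 / 2) * ln A2 + - (1 / 2) * 0.
  by rewrite /A2 lnM ?posrE // mulr0 addr0.
apply: mean_add; first exact: mean_cst.
apply: mean_scale.
have [uth _] := hth.
apply: (@pair_mean R d T P (th a.1) (th b.1) (pker t) (2 * ln (1 - t)^-1 + 2 * ln 2)).
- exact: uth.
- exact: uth.
- by apply: phases_pair => //; rewrite ltn_eqF.
- exact: measurable_pker.
- by move=> x; exact: pker_bound.
- by move=> s; exact: pker_mean0.
Qed.

Definition mean_pair (a b : nat * nat) : R :=
  if a == b then 0
  else if a.1 == b.1 then - (1 / 2) * (lap a.1 + lam a.1 + ln (2 - 2 * cos ((a.2%:R - b.2%:R) * (2 * pi / (r a.1)%:R))))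
  else - (1 / 2) * Lpair a.1 b.1.

Lemma ring_pair_mean a b : a \in idx -> b \in idx ->
  has_mean P (fun w => pair_energy (pt (fun j => th j w) a) (pt (fun j => th j w) b)) (mean_pair a b).
Proof.
move=> ha hb; rewrite /mean_pair; case: eqP => [->|/eqP ab].
  rewrite (_ : (fun w => _) = fun=> 0); first exact: mean_cst.
  by apply/funext => w; rewrite /pair_energy eqxx.
case: (ltngtP a.1 b.1) => h; rewrite /Lpair.
- by rewrite h; exact: cross_ring_mean_lt.
- rewrite ltnNge (ltnW h) /=; under eq_fun do rewrite pair_energyC.
  exact: cross_ring_mean_lt.
case: a b ha hb h ab => [j i] [k l] /= ha hb h ab; rewrite -h in hb ab *.
rewrite (_ : (fun w => _) = fun=> - (1 / 2) * (lap j + lam j + ln (2 - 2 * cos ((i%:R - l%:R) * (2 * pi / (r j)%:R))))).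
  exact: mean_cst.
apply/funext => w; apply: same_ring_energy => //.
by apply: contraNneq ab => ->.
Qed.

Definition mean_energy : R :=
  - 2 * ln 2 + 2 * \sum_(a <- idx) (- (1 / 2) * (ln 2 + lam a.1) + - (1 / 2) * (ln 2 + lap a.1))
  + \sum_(a <- idx) \sum_(b <- idx) mean_pair a b.

Lemma ringset_mean_energy :
  has_mean P (fun w => log_energy (ringset r p (fun j => th j w))) mean_energy.
Proof.
have E w : log_energy (ringset r p (fun j => th j w)) =
   (- 2 * ln 2 + 2 * \sum_(a <- idx) (- (1 / 2) * (ln 2 + lam a.1) + - (1 / 2) * (ln 2 + lap a.1)))
   + \sum_(a <- idx) \sum_(b <- idx) pair_energy (pt (fun j => th j w) a) (pt (fun j => th j w) b).
  rewrite log_energyE /ringset ringseqE.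
  have uS := ringseq_uniq r3 (fun j => th j w).
  rewrite big_fset_seq //; under eq_bigr do rewrite big_fset_seq //.
  set th' := fun j => th j w.
  have e0 x : pair_energy x x = 0 :> R by rewrite /pair_energy eqxx.
  rewrite !big_cat /= !big_cons !big_nil /= !big_map.
  under [X in _ + X]eq_bigr do rewrite !big_cons big_map.
  rewrite !e0 !big_split /=.
  rewrite (pair_energyC (0, 0, -1) (0, 0, 1)) poles_energy.
  have s1 : \sum_(a <- idx) pair_energy (0, 0, 1) (pt th' a) = \sum_(a <- idx) - (1 / 2) * (ln 2 + lam a.1).
    by apply: eq_big_seq => a ha; have [] := pole_energy th' ha.
  have s2 : \sum_(a <- idx) pair_energy (0, 0, -1) (pt th' a) = \sum_(a <- idx) - (1 / 2) * (ln 2 + lap a.1).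
    by apply: eq_big_seq => a ha; have [] := pole_energy th' ha.
  have s3 : \sum_(a <- idx) pair_energy (pt th' a) (0, 0, 1) = \sum_(a <- idx) - (1 / 2) * (ln 2 + lam a.1).
    by rewrite -s1; apply: eq_bigr => a _; rewrite pair_energyC.
  have s4 : \sum_(a <- idx) pair_energy (pt th' a) (0, 0, -1) = \sum_(a <- idx) - (1 / 2) * (ln 2 + lap a.1).
    by rewrite -s2; apply: eq_bigr => a _; rewrite pair_energyC.
  rewrite s1 s2 s3 s4.
  move: (\sum_(a <- idx) \sum_(b <- idx) _) => W.
  move: (\sum_(a <- idx) - (1 / 2) * (ln 2 + lam a.1)) (\sum_(a <- idx) - (1 / 2) * (ln 2 + lap a.1)) => u v.
  by ring.
rewrite (_ : (fun w => _) = (fun w => (- 2 * ln 2 + 2 * \sum_(a <- idx) (- (1 / 2) * (ln 2 + lam a.1) + - (1 / 2) * (ln 2 + lap a.1)))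
   + \sum_(a <- idx) \sum_(b <- idx) pair_energy (pt (fun j => th j w) a) (pt (fun j => th j w) b))); last exact/funext.
apply: mean_add; first exact: mean_cst.
apply: mean_sum => a ha _; apply: mean_sum => b hb _; exact: ring_pair_mean.
Qed.

End Mean.


Lemma sum_idx (G : nat * nat -> R) :
  \sum_(a <- idx) G a = \sum_(j <- iota 1 p) \sum_(i <- iota 1 (r j)) G (j, i).
Proof. by rewrite /ringidx big_allpairs_dep. Qed.

Lemma sum_cst_seq (I : Type) (s : seq I) (c : R) : \sum_(i <- s) c = (size s)%:R * c.
Proof. by rewrite big_const_seq count_predT iter_addr_0 mulr_natl. Qed.

Lemma sum_idx1 (G : nat -> R) : \sum_(a <- idx) G a.1 = \sum_(j <- iota 1 p) (r j)%:R * G j.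
Proof. by rewrite sum_idx; apply: eq_bigr => j _ /=; rewrite sum_cst_seq size_iota. Qed.

Lemma mean_pair_row j i : (1 <= j <= p)%N -> (1 <= i <= r j)%N ->
  \sum_(b <- idx) mean_pair (j, i) b =
  - (1 / 2) * (((r j)%:R - 1) * (lap j + lam j)) - ln (r j)%:R
  - (1 / 2) * \sum_(k <- iota 1 p) (k != j)%:R * ((r k)%:R * Lpair j k).
Proof.
move=> hj hi; rewrite sum_idx.
have jin : j \in iota 1 p by rewrite mem_iota add1n ltnS.
have iin : i \in iota 1 (r j) by rewrite mem_iota add1n ltnS.
rewrite (bigD1_seq j) ?iota_uniq //=; congr (_ + _).
  transitivity (\sum_(l <- iota 1 (r j) | l != i) (- (1 / 2) * (lap j + lam j + ln (2 - 2 * cos ((i%:R - l%:R) * (2 * pi / (r j)%:R)))))).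
    rewrite [RHS]big_mkcond; apply: eq_bigr => l _; rewrite /mean_pair xpair_eqE eqxx /= eq_sym.
    by case: eqP.
  rewrite -big_distrr big_split /= sum_ln_chords //.
  have : \sum_(l <- iota 1 (r j)) (lap j + lam j) = (r j)%:R * (lap j + lam j) by rewrite sum_cst_seq size_iota.
  rewrite (bigD1_seq i) ?iota_uniq //= => /(canRL (addKr _)) ->.
  by field.
rewrite mulr_sumr -sumrN big_mkcond; apply: eq_bigr => k _; case: eqP => [->|/eqP kj].
  by rewrite mul0r mulr0 oppr0.
transitivity (\sum_(l <- iota 1 (r k)) (- (1 / 2) * Lpair j k)).
  by apply: eq_bigr => l _; rewrite /mean_pair xpair_eqE eq_sym (negbTE kj).
rewrite sum_cst_seq size_iota; move: (Lpair j k) ((r k)%:R) => x y /=; by field.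
Qed.

Lemma sum_below k : (1 <= k <= p.+1)%N ->
  \sum_(j <- iota 1 p) (j < k)%:R * (r j)%:R = (below r k)%:R :> R.
Proof.
move=> /andP[k1 kp]; rewrite /below natr_sum (big_nat_widen _ _ p.+1) //.
rewrite [RHS]big_mkcond /index_iota subn1 /=; apply: eq_bigr => j _.
by case: ifP => _; rewrite ?mul1r ?mul0r.
Qed.

Lemma sum_all : \sum_(j <- iota 1 p) (r j)%:R = (below r p.+1)%:R :> R.
Proof.
rewrite -(@sum_below p.+1) ?leqnn //; apply: eq_big_seq => j; rewrite mem_iota add1n => /andP[_ ->].
by rewrite mul1r.
Qed.

Lemma sum_above k : (1 <= k <= p)%N ->
  \sum_(j <- iota 1 p) (k < j)%:R * (r j)%:R = (below r p.+1)%:R - (below r k)%:R - (r k)%:R :> R.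
Proof.
move=> /andP[k1 kp].
have -> : (below r p.+1)%:R - (below r k)%:R - (r k)%:R = (below r p.+1)%:R - (below r k.+1)%:R :> R.
  by rewrite (below_recr r k1) natrD; ring.
rewrite -sum_all -(@sum_below k.+1) // -sumrB; apply: eq_bigr => j _.
by rewrite ltnS [(j <= k)%N]leqNgt; case: (k < j)%N => /=; ring.
Qed.

(** In each pair of rings [lap] belongs to the upper one and [lam] to the lower one. Collected by
    ring, [lap j] is counted once per point below ring [j] and [lam j] once per point above it; the
    2 comes from the two orders. *)
Lemma sum_Lpair :
  \sum_(j <- iota 1 p) (r j)%:R * (\sum_(k <- iota 1 p) (k != j)%:R * ((r k)%:R * Lpair j k)) =
  2 * \sum_(j <- iota 1 p) (r j)%:R * (((below r p.+1)%:R - (below r j)%:R - (r j)%:R) * lap j + (below r j)%:R * lam j).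
Proof.
pose W j k : R := (j < k)%:R * ((r j)%:R * (r k)%:R * (lap j + lam k)).
have split1 : \sum_(j <- iota 1 p) (r j)%:R * (\sum_(k <- iota 1 p) (k != j)%:R * ((r k)%:R * Lpair j k)) =
   \sum_(j <- iota 1 p) \sum_(k <- iota 1 p) W j k + \sum_(j <- iota 1 p) \sum_(k <- iota 1 p) W k j.
  rewrite -big_split; apply: eq_bigr => j _; rewrite mulr_sumr -big_split; apply: eq_bigr => k _ /=.
  rewrite /W /Lpair; case: (ltngtP j k) => [h|h|->] /=; rewrite ?eqxx /=; by ring.
rewrite split1 [X in _ + X]exchange_big /= -mulr2n -[LHS]mulr_natl; congr (_ * _).
have -> : \sum_(j <- iota 1 p) \sum_(k <- iota 1 p) W j k =
   \sum_(j <- iota 1 p) (r j)%:R * lap j * (\sum_(k <- iota 1 p) (j < k)%:R * (r k)%:R) +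
   \sum_(k <- iota 1 p) (r k)%:R * lam k * (\sum_(j <- iota 1 p) (j < k)%:R * (r j)%:R).
  under [X in _ = X + _]eq_bigr do rewrite mulr_sumr.
  under [X in _ = _ + X]eq_bigr do rewrite mulr_sumr.
  rewrite [X in _ = _ + X]exchange_big /= -big_split; apply: eq_bigr => j _; rewrite -big_split; apply: eq_bigr => k _ /=.
  by rewrite /W; ring.
rewrite -big_split; apply: eq_big_seq => j; rewrite mem_iota add1n ltnS => /andP[j1 jp] /=.
by rewrite sum_above ?j1 // sum_below ?j1 ?leqW //; ring.
Qed.

(* [useq j] is the [u_j = n (1 - z_j)] of the header. *)
Definition useq (j : nat) : R := (1 + r j + 2 * below r j)%N%:R.

Lemma useqE j : useq j = 1 + (r j)%:R + 2 * (below r j)%:R.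
Proof. by rewrite /useq natrD natrD natrM. Qed.

Lemma onem_useq j : 1 - zl j = useq j / rn r p.
Proof. by rewrite /zlev useqE opprB addrC subrK. Qed.

Lemma onep_useq j : 1 + zl j = (2 * rn r p - useq j) / rn r p.
Proof. by rewrite /zlev useqE; field; rewrite gt_eqF ?rn_gt0. Qed.

(** The poles, the other points of ring [j] and the rings above give [lam j] the coefficient [- r (1
    + (r - 1) / 2 + below) = - r u / 2]; likewise [lap j] receives [- r (2 n - u) / 2]. The chords
    leave [- r ln r]. *)
Lemma mean_energyE : let n : R := rn r p in
  mean_energy = - 2 * n * ln 2 - \sum_(j <- iota 1 p) (r j)%:R * ln (r j)%:R
  - 1 / 2 * \sum_(j <- iota 1 p) (r j)%:R * (useq j * ln (useq j) + (2 * n - useq j) * ln (2 * n - useq j))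
  + n * (n - 1) * ln n.
Proof.
move=> n; have n0 : 0 < n by exact: rn_gt0.
have nE : n = (below r p.+1)%:R + 1 by rewrite /n /rn -natr1.
rewrite /mean_energy (sum_idx1 (fun j => - (1 / 2) * (ln 2 + lam j) + - (1 / 2) * (ln 2 + lap j))).
have -> : \sum_(a <- idx) \sum_(b <- idx) mean_pair a b =
    \sum_(a <- idx) (- (1 / 2) * (((r a.1)%:R - 1) * (lap a.1 + lam a.1)) - ln (r a.1)%:R
  - (1 / 2) * \sum_(k <- iota 1 p) (k != a.1)%:R * ((r k)%:R * Lpair a.1 k)).
  by apply: eq_big_seq => -[j i] /mem_ringidx[hj hi]; exact: mean_pair_row.
rewrite (sum_idx1 (fun j => - (1 / 2) * (((r j)%:R - 1) * (lap j + lam j)) - ln (r j)%:R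
  - (1 / 2) * \sum_(k <- iota 1 p) (k != j)%:R * ((r k)%:R * Lpair j k))).
have -> : \sum_(j <- iota 1 p) (r j)%:R * (- (1 / 2) * (((r j)%:R - 1) * (lap j + lam j)) - ln (r j)%:R
  - (1 / 2) * \sum_(k <- iota 1 p) (k != j)%:R * ((r k)%:R * Lpair j k)) =
   \sum_(j <- iota 1 p) (r j)%:R * (- (1 / 2) * (((r j)%:R - 1) * (lap j + lam j)) - ln (r j)%:R)
   - (1 / 2) * (2 * \sum_(j <- iota 1 p) (r j)%:R * (((below r p.+1)%:R - (below r j)%:R - (r j)%:R) * lap j + (below r j)%:R * lam j)).
  rewrite -sum_Lpair [X in _ = _ - X]mulr_sumr -sumrB; apply: eq_bigr => j _; rewrite mulrBr; congr (_ - _).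
  by rewrite mulrCA.
have -> : n * (n - 1) * ln n = \sum_(j <- iota 1 p) (r j)%:R * (n * ln n).
  by rewrite -mulr_suml sum_all nE; ring.
have -> : - 2 * n * ln 2 = - 2 * ln 2 + \sum_(j <- iota 1 p) (r j)%:R * (- 2 * ln 2).
  by rewrite -mulr_suml sum_all nE; ring.
rewrite !mulr_sumr -!sumrN -!addrA; congr (_ + _); rewrite -!big_split /=.
apply: eq_big_seq => j; rewrite mem_iota add1n ltnS => hj.
have p1 := onep_gt0 hj; have m1 := onem_gt0 hj.
have ui : 0 < useq j by have := m1; rewrite onem_useq pmulr_lgt0 // invr_gt0.
have vi : 0 < 2 * n - useq j by have := p1; rewrite onep_useq pmulr_lgt0 // invr_gt0.
have laE : lap j = ln (2 * n - useq j) - ln n by rewrite /lap onep_useq ln_div ?posrE.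
have lbE : lam j = ln (useq j) - ln n by rewrite /lam onem_useq ln_div ?posrE.
rewrite laE lbE; have uE := useqE j.
have -> : (below r j)%:R = (useq j - 1 - (r j)%:R) / 2 by rewrite uE; field.
have -> : (below r p.+1)%:R = n - 1 by rewrite nE; ring.
move: (ln (useq j)) (ln (2 * n - useq j)) (ln n) (ln (r j)%:R) (ln 2) => l1 l2 l3 l4 l5.
by field.
Qed.

End RingEnergy.

(** * The parallels of the construction *)

Section Count.
Context (R : realType) (N : nat).
Hypothesis N241 : (241 <= N)%N.

Local Notation m := (dm R N).
Local Notation M := (dM R N).
Local Notation p := (2 * dM R N - 1)%N.
Local Notation r := (dr R N).
Local Notation ga := (dgamma R N).
Local Notation de := (ddelta R N).
Local Notation eta := (deta R N).

Lemma dm_bounds : (1 <= m)%N /\ (239 * m ^ 2 + 2 <= N < 239 * (m + 1) ^ 2 + 2)%N.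
Proof.
have [c c0 cE] : exists2 c : R, 0 < c & c = 239%N%:R by exists 239%N%:R; rewrite ?ltr0n.
set y : R := (N - 2)%N%:R / c.
have mE : m = Num.truncn (Num.sqrt y) by rewrite /y cE.
have e : (N - 2)%N%:R = y * c by rewrite /y divfK // gt_eqF.
have y1 : 1 <= y.
  by rewrite /y ler_pdivlMr // mul1r cE ler_nat; lia.
have y0 : 0 <= y by apply: le_trans y1.
have s0 : 0 <= Num.sqrt y by rewrite sqrtr_ge0.
have /andP[ml mu] := truncn_itv s0.
rewrite -mE in ml mu.
have sq : Num.sqrt y ^+ 2 = y by rewrite sqr_sqrtr.
have lo : (m%:R ^+ 2 <= y) by rewrite -sq ler_sqr ?nnegrE ?ler0n.
have hi : (y < m.+1%:R ^+ 2) by rewrite -sq ltr_sqr ?nnegrE ?ler0n.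
have m1 : (1 <= m)%N.
  rewrite -ltnS -(ltr_nat R); apply: le_lt_trans mu.
  by rewrite -[1%:R]sqrtr1 ler_sqrt.
have lo' : (239 * m ^ 2 <= N - 2)%N.
  by rewrite -(ler_nat R) natrM -cE natrX e mulrC (ler_pM2r c0).
have hi' : (N - 2 < 239 * m.+1 ^ 2)%N.
  by rewrite -(ltr_nat R) natrM -cE natrX e mulrC (ltr_pM2l c0).
clear -m1 lo' hi' N241; rewrite addn1; split => //; lia.
Qed.

(** The dividend is less than [478 m + 239 <= 717 (2 m - 1)], with equality for [m = 1]. *)
Lemma dgamma_le : (ga <= 716)%N.
Proof.
have [m1 /andP[lo hi]] := dm_bounds.
rewrite /dgamma -ltnS ltn_divLR; last lia.
have : (239 * (m + 1) ^ 2 = 239 * m ^ 2 + 478 * m + 239)%N by ring.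
move: hi lo; move: (239 * m ^ 2)%N (239 * (m + 1) ^ 2)%N => a b; lia.
Qed.

Lemma dcount : (N = 239 * m ^ 2 + 2 + ga * (2 * m - 1) + eta /\ eta < 2 * m - 1)%N.
Proof.
have [m1 /andP[lo hi]] := dm_bounds.
have := divn_eq (N - 239 * m ^ 2 - 2) (2 * m - 1).
rewrite -/ga -/eta -/(dgamma R N) -/(deta R N).
have : (eta < 2 * m - 1)%N by rewrite ltn_mod; lia.
move: lo; move: (ga * _)%N (239 * m ^ 2)%N eta => a b c; lia.
Qed.

Lemma ddelta_bounds : (6 * m <= de <= 7 * m - 1)%N.
Proof.
have [m1 _] := dm_bounds; have [_] := dcount.
by rewrite /ddelta; case: eqP => [->|/eqP e0]; [|case: ifP]; lia.
Qed.

(** The ring sizes when [N = 239 m ^ 2 + 2], without surplus; [extra] is the surplus of the rings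
    strictly north of the equator. *)
Definition slin (j : nat) : nat :=
  (if j <= 2 * m then 6 * j
   else if j <= 3 * m then 2 * m + 5 * j
   else if j <= 4 * m then 5 * m + 4 * j
   else if j <= 5 * m then 9 * m + 3 * j
   else if j <= 6 * m then 14 * m + 2 * j
   else 20 * m + j)%N.

Definition extra (j : nat) : nat := (if j <= 6 * m then 0 else if j <= de then ga else ga + 1)%N.

Lemma dr_slin j : (j < M)%N -> r j = (slin j + extra j)%N.
Proof.
have [m1 _] := dm_bounds; have /andP[d1 d2] := ddelta_bounds.
rewrite /dr /dM => jM; rewrite (ltnW jM) /rfun /slin /extra.
by do ?case: ifP; lia.
Qed.

(** The [eta] leftover points go in pairs to the [7 m - 1 - de] rings nearest to the equator and
    their mirror images; the equator takes the rest, and [depsilon] settles the parity. *)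
Lemma dr_mid : (r M + 2 * (7 * m - 1 - de) = 27 * m + ga + eta)%N.
Proof.
have [m1 _] := dm_bounds; have [_ e2] := dcount.
rewrite /dr /dM leqnn /rfun.
do 5 (rewrite ifF; last lia).
rewrite ifF; last by have := ddelta_bounds; lia.
rewrite ifF; last lia.
by rewrite /depsilon /ddelta; case: eqP => [->|/eqP e0]; [|case: ifP]; lia.
Qed.

Lemma dr_sym j : (1 <= j <= p)%N -> r (2 * M - j) = r j.
Proof.
rewrite /dr => hj; case: (ltngtP j M) => h.
- by rewrite ifF ?ifT //; [congr rfun|]; lia.
- by rewrite ifT; lia.
- by rewrite h (_ : 2 * M - M = M)%N ?leqnn //; lia.
Qed.


(* [u_j - 1] for the rings of [slin j] points: the trapezoidal rule makes it
   exactly quadratic on each piece. *)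
Definition trap (j : nat) : nat := (2 * below slin j + slin j)%N.

Lemma trap_rec j : (0 < j)%N -> trap j.+1 = (trap j + slin j + slin j.+1)%N.
Proof. by move=> j0; rewrite /trap below_recr //; lia. Qed.

(** From [j] to [j + 1] the right-hand side grows by [a (2 j + 1) + 2 b m], which is exactly
    [slin j + slin (j + 1)]. The constant [e m ^ 2] stays on the left to avoid truncated
    subtraction. *)
Lemma trap_piece (a b e x0 x1 : nat) :
  (forall j, (1 <= j)%N -> (x0 * m <= j <= x1 * m)%N -> slin j = (a * j + b * m)%N) ->
  forall j0, (1 <= j0)%N -> (x0 * m <= j0)%N ->
  (trap j0 + e * m ^ 2 = a * j0 ^ 2 + 2 * b * (m * j0))%N ->
  forall j, (j0 <= j <= x1 * m)%N -> (trap j + e * m ^ 2 = a * j ^ 2 + 2 * b * (m * j))%N.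
Proof.
move=> hs j0 j1 xj h0 j /andP[jj jx].
rewrite -(subnKC jj) in jx *; elim: (j - j0)%N jx => [|k ih] jx; first by rewrite addn0.
rewrite addnS in jx *.
rewrite trap_rec; last lia.
rewrite !hs; [|lia..].
have : (j0 + k <= x1 * m)%N by lia.
move=> /ih; move: (trap (j0 + k)) => t; move: (e * m ^ 2)%N (j0 + k)%N => em i h.
transitivity (t + em + (a * i + b * m + (a * i.+1 + b * m)))%N; first by ring.
by rewrite h; ring.
Qed.

(** Neighbouring formulas agree at the breakpoints, so each one holds on a closed range. *)
Lemma slin_pieces j : (1 <= j)%N ->
  [/\ (0 * m <= j <= 2 * m)%N -> slin j = (6 * j + 0 * m)%N,
     (2 * m <= j <= 3 * m)%N -> slin j = (5 * j + 2 * m)%N,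
     (3 * m <= j <= 4 * m)%N -> slin j = (4 * j + 5 * m)%N,
     (4 * m <= j <= 5 * m)%N -> slin j = (3 * j + 9 * m)%N &
     (5 * m <= j <= 6 * m)%N -> slin j = (2 * j + 14 * m)%N] /\
     ((6 * m <= j <= 7 * m)%N -> slin j = (1 * j + 20 * m)%N).
Proof.
have [m1 _] := dm_bounds.
by move=> j1; split; first split; move=> h; rewrite /slin; do ?case: ifP; lia.
Qed.

(** The offsets 4, 13, 29, 54, 90 are forced by agreement at the breakpoints, where [trap] is
    [m ^ 2] times 24, 53, 91, 136, 186; the last formula gives [239 m ^ 2] at the equator. *)
Lemma trap_pieces j : (1 <= j)%N ->
  [/\ (0 * m <= j <= 2 * m)%N -> (trap j + 0 * m ^ 2 = 6 * j ^ 2 + 2 * 0 * (m * j))%N,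
     (2 * m <= j <= 3 * m)%N -> (trap j + 4 * m ^ 2 = 5 * j ^ 2 + 2 * 2 * (m * j))%N,
     (3 * m <= j <= 4 * m)%N -> (trap j + 13 * m ^ 2 = 4 * j ^ 2 + 2 * 5 * (m * j))%N,
     (4 * m <= j <= 5 * m)%N -> (trap j + 29 * m ^ 2 = 3 * j ^ 2 + 2 * 9 * (m * j))%N &
     (5 * m <= j <= 6 * m)%N -> (trap j + 54 * m ^ 2 = 2 * j ^ 2 + 2 * 14 * (m * j))%N] /\
     ((6 * m <= j <= 7 * m)%N -> (trap j + 90 * m ^ 2 = 1 * j ^ 2 + 2 * 20 * (m * j))%N).
Proof.
have [m1 _] := dm_bounds.
have mm : (m ^ 2 = m * m)%N by rewrite expnS expn1.
have sq x : ((x * m) ^ 2 = x ^ 2 * m ^ 2)%N by rewrite expnMn.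
have mx x : (m * (x * m) = x * m ^ 2)%N by rewrite mm; ring.
have T1 : trap 1 = 6%N by rewrite /trap /below big_geq // /slin; case: ifP; lia.
have P1 : forall j, (1 <= j <= 2 * m)%N -> (trap j + 0 * m ^ 2 = 6 * j ^ 2 + 2 * 0 * (m * j))%N.
  apply: (@trap_piece _ _ 0 0 2) => //; first by move=> i i1; case: (slin_pieces i1) => -[].
  by rewrite T1.
have P2 : forall j, (2 * m <= j <= 3 * m)%N -> (trap j + 4 * m ^ 2 = 5 * j ^ 2 + 2 * 2 * (m * j))%N.
  apply: (@trap_piece _ _ 4 2 3) => //; [by move=> i i1; case: (slin_pieces i1) => -[]|lia|].
  by have := P1 (2 * m)%N; rewrite leqnn andbT muln_gt0 m1 => /(_ isT); rewrite !sq !mx; lia.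
have P3 : forall j, (3 * m <= j <= 4 * m)%N -> (trap j + 13 * m ^ 2 = 4 * j ^ 2 + 2 * 5 * (m * j))%N.
  apply: (@trap_piece _ _ 13 3 4) => //; [by move=> i i1; case: (slin_pieces i1) => -[]|lia|].
  by have := P2 (3 * m)%N; rewrite leqnn andbT leq_mul // => /(_ isT); rewrite !sq !mx; lia.
have P4 : forall j, (4 * m <= j <= 5 * m)%N -> (trap j + 29 * m ^ 2 = 3 * j ^ 2 + 2 * 9 * (m * j))%N.
  apply: (@trap_piece _ _ 29 4 5) => //; [by move=> i i1; case: (slin_pieces i1) => -[]|lia|].
  by have := P3 (4 * m)%N; rewrite leqnn andbT leq_mul // => /(_ isT); rewrite !sq !mx; lia.
have P5 : forall j, (5 * m <= j <= 6 * m)%N -> (trap j + 54 * m ^ 2 = 2 * j ^ 2 + 2 * 14 * (m * j))%N.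
  apply: (@trap_piece _ _ 54 5 6) => //; [by move=> i i1; case: (slin_pieces i1) => -[]|lia|].
  by have := P4 (5 * m)%N; rewrite leqnn andbT leq_mul // => /(_ isT); rewrite !sq !mx; lia.
have P6 : forall j, (6 * m <= j <= 7 * m)%N -> (trap j + 90 * m ^ 2 = 1 * j ^ 2 + 2 * 20 * (m * j))%N.
  apply: (@trap_piece _ _ 90 6 7) => //; [by move=> i i1; case: (slin_pieces i1) => -[]|lia|].
  by have := P5 (6 * m)%N; rewrite leqnn andbT leq_mul // => /(_ isT); rewrite !sq !mx; lia.
move=> j1; split; first split; by [move=> h; apply: P1; lia|exact: P2|exact: P3|exact: P4|exact: P5|exact: P6].
Qed.

Lemma below_dr j : (1 <= j <= M)%N ->
  (below r j = below slin j + ga * (j - 1 - 6 * m) + (j - 1 - de))%N.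
Proof.
have [m1 _] := dm_bounds; have /andP[d1 d2] := ddelta_bounds.
elim: j => [//|[|j] ih] /andP[_ jM]; first by rewrite /below !big_geq //; lia.
rewrite (below_recr r) // (below_recr slin) // ih; last lia.
rewrite dr_slin //; rewrite /extra; move: (below slin _) (slin _) => x y.
have [h|h] := leqP j.+1 (6 * m)%N.
  have -> : (j.+2 - 1 - 6 * m = 0)%N by lia.
  have -> : (j.+1 - 1 - 6 * m = 0)%N by lia.
  lia.
have -> : (j.+2 - 1 - 6 * m = (j.+1 - 1 - 6 * m).+1)%N by lia.
rewrite mulnSr; move: (ga * _)%N => z; case: ifP; lia.
Qed.

Lemma below_sym j : (M <= j <= p)%N ->
  (below r j.+1 + below r (2 * M - j) = below r M + r M + below r M)%N.
Proof.
move=> /andP[Mj jp]; rewrite -(subnKC Mj) in jp *; elim: (j - M)%N jp => [|k ih] jp.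
  have [m1 _] := dm_bounds.
  have M0 : (0 < M)%N by rewrite /dM; lia.
  have e : (2 * M - M = M)%N by lia.
  by rewrite addn0 e below_recr.
rewrite below_recr; last by lia.
have hk : (M + k <= p)%N by lia.
rewrite -(ih hk) addnS (_ : 2 * M - (M + k) = (2 * M - (M + k).+1).+1)%N; last by lia.
rewrite (below_recr r (j := 2 * M - (M + k).+1)); last lia.
by rewrite dr_sym; lia.
Qed.

(** [slin] accounts for [239 m ^ 2] points, the surplus [ga] on [m - 1] rings of either hemisphere
    and on the equator for [ga (2 m - 1)], and the leftovers for [eta]. *)
Lemma below_M : (2 * below r M + r M = N - 2)%N.
Proof.
have [m1 _] := dm_bounds; have /andP[d1 d2] := ddelta_bounds; have [Ne _] := dcount.
have rM := dr_mid; rewrite below_dr /dM ?leqnn ?andbT; last lia.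
have := (trap_pieces (j := (7 * m)%N)); rewrite muln_gt0 m1 => /(_ isT)[_].
rewrite leqnn andbT leq_mul // => /(_ isT); rewrite /trap.
have := slin_pieces (j := (7 * m)%N); rewrite muln_gt0 m1 => /(_ isT)[_].
rewrite leqnn andbT leq_mul // => /(_ isT) ->.
rewrite expnMn (_ : m * (7 * m) = 7 * m ^ 2)%N; last by ring.
rewrite (_ : 7 * m - 1 - 6 * m = m - 1)%N; last lia.
have e : (2 * (ga * (m - 1)) + ga = ga * (2 * m - 1))%N.
  by have -> : (2 * m - 1 = 2 * (m - 1) + 1)%N; [lia|ring].
move: rM Ne e; rewrite /dM; move: (r _) (m ^ 2)%N (ga * (2 * m - 1))%N (ga * (m - 1))%N (below slin _) => *.
lia.
Qed.

Lemma below_total : below r p.+1 = (N - 2)%N.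
Proof.
have [m1 _] := dm_bounds.
have := @below_sym p; rewrite leqnn andbT (_ : 2 * M - p = 1)%N; last by rewrite /dM; lia.
rewrite [X in (_ + X)%N]/below big_geq // addn0 => ->; last by rewrite /dM; lia.
rewrite -below_M; ring.
Qed.

Lemma below_refl j : (1 <= j <= p)%N ->
  (below r (2 * M - j) + below r j + r j = N - 2)%N.
Proof.
rewrite -below_M => hj; case: (leqP M j) => h.
  have := @below_sym j; rewrite h; case/andP: hj => j1 -> /(_ isT).
  by rewrite below_recr //; lia.
have := @below_sym (2 * M - j)%N; rewrite (_ : 2 * M - (2 * M - j) = j)%N; last lia.
rewrite below_recr; last lia.
rewrite dr_sym // (_ : (M <= 2 * M - j <= p)%N); last lia.
by move=> /(_ isT); lia.
Qed.

End Count.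

(** * Size estimates and the discrepancy of the construction *)

Section Bounds.
Context (R : realType) (N : nat).
Hypothesis N241 : (241 <= N)%N.

Local Notation m := (dm R N).
Local Notation M := (dM R N).
Local Notation p := (2 * dM R N - 1)%N.
Local Notation r := (dr R N).
Local Notation ga := (dgamma R N).
Local Notation de := (ddelta R N).
Local Notation sl := (slin R N).
Local Notation u j := (1 + dr R N j + 2 * below (dr R N) j)%N.

Lemma dM_gt0 : (0 < M)%N.
Proof. by have [m1 _] := @dm_bounds R N N241; rewrite /dM muln_gt0. Qed.

Lemma slin_bounds j : (1 <= j <= M)%N -> (3 * j <= sl j <= 6 * j)%N.
Proof.
have [m1 _] := @dm_bounds R N N241; rewrite /dM => hj.
by rewrite /slin; do ?case: ifP; lia.
Qed.

(** [718 = 716 + 2]: the surplus is at most [ga + 1] away from the equator and at most [ga + 2] on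
    it. *)
Lemma dr_bounds j : (1 <= j <= M)%N -> (sl j <= r j <= sl j + 718)%N.
Proof.
have [m1 _] := @dm_bounds R N N241; have g := @dgamma_le R N N241.
have /andP[d1 d2] := @ddelta_bounds R N N241.
move=> hj; have [jM|jM] := ltnP j M.
  by rewrite (dr_slin N241 jM) /extra; case: ifP; [|case: ifP]; lia.
have -> : j = M by lia.
have sM : sl M = (27 * m)%N by rewrite /slin /dM; do ?case: ifP; lia.
rewrite sM; have := @dr_mid R N N241; have [_ e2] := @dcount R N N241.
move: g d1 d2 e2; rewrite /ddelta; move: (r M) => rM.
by case: eqP => [->|/eqP e0]; [|case: ifP]; lia.
Qed.

Lemma dr_ge3 j : (1 <= j <= p)%N -> (3 <= r j)%N.
Proof.
move=> hj; wlog jM : j hj / (j <= M)%N => [wl|].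
  have [jM|jM] := leqP j M; first exact: wl.
  rewrite -(dr_sym N241 hj); apply: wl; lia.
by have := @dr_bounds j; have := @slin_bounds j; lia.
Qed.

Lemma trap_bounds j : (1 <= j <= M)%N -> (3 * j ^ 2 <= trap R N j <= 6 * j ^ 2)%N.
Proof.
elim: j => [//|[|j] ih] /andP[_ jM].
  by rewrite /trap /below big_geq //; have := @slin_bounds 1; lia.
have := ih; rewrite ltnS leq0n /= (ltnW jM) => /(_ isT).
rewrite (@trap_rec R N N241 j.+1) //.
have := @slin_bounds j.+1; have := @slin_bounds j.+2; rewrite jM (ltnW jM) => /(_ isT) + /(_ isT).
have -> : (j.+2 ^ 2 = j.+1 ^ 2 + 2 * j.+1 + 1)%N by ring.
move: (trap _ _ _) (j.+1 ^ 2)%N (sl _) (sl _) => *; lia.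
Qed.

(** The excess is at most [1 + 718 + 2 * 716 j + 2 j], from the pole, the ring itself and twice the
    surplus of the rings above. *)
Lemma useq_trap j : (1 <= j <= M)%N -> (trap R N j <= u j <= trap R N j + 2155 * j)%N.
Proof.
move=> hj; have := dr_bounds hj; have g := @dgamma_le R N N241.
rewrite (below_dr N241 hj) /trap.
have : (ga * (j - 1 - 6 * m) <= 716 * j)%N by apply: leq_mul => //; lia.
move: (ga * _)%N (below _ _) (sl _) (r j) => *; lia.
Qed.

Lemma useq_bounds j : (1 <= j <= M)%N -> (3 * j ^ 2 <= u j <= 2161 * j ^ 2)%N.
Proof.
move=> hj; have := useq_trap hj; have := trap_bounds hj.
have : (j <= j ^ 2)%N by rewrite -[X in (X <= _)%N]mul1n expnS expn1 leq_mul //; lia.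
move: (trap _ _ _) (u j) (j ^ 2)%N => *; lia.
Qed.

Lemma useq_sym j : (1 <= j <= p)%N -> (u (2 * M - j) + u j = 2 * (N - 1))%N.
Proof.
move=> hj; have := below_refl N241 hj; rewrite dr_sym //.
by move: (below _ _) (below _ _) (r j) => a b c; lia.
Qed.

Lemma useq_M : u M = (N - 1)%N.
Proof. by have := @below_M R N N241; move: (below _ _) (r M) => *; lia. Qed.

Lemma useq_le j : (1 <= j <= M)%N -> (u j <= N - 1)%N.
Proof.
move=> /andP[j1 jM]; have := jM; rewrite leq_eqVlt => /predU1P[->|jM1]; first by rewrite useq_M.
have := @below_le r _ _ jM1; rewrite below_recr //.
have := @below_M R N N241; move: (below _ _) (below _ _) (r j) (r M) => a b c; lia.
Qed.

Lemma card_dr : ((below r p.+1).+2 = N)%N.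
Proof. by rewrite below_total //; lia. Qed.

Lemma rn_dr : rn r p = (N - 1)%N%:R :> R.
Proof. by rewrite /rn below_total //; congr (_%:R); lia. Qed.

Lemma pred_card_gt0 : 0 < (N - 1)%N%:R :> R.
Proof. by rewrite ltr0n; lia. Qed.

Lemma zlev_dr j : zlev r p j = 1 - (u j)%:R / (N - 1)%N%:R :> R.
Proof. by rewrite /zlev rn_dr natrD natrD natrM. Qed.

(** The construction reflects the northern heights, while [zlev] uses the running count all the way
    south; the two agree because the ring sizes are symmetric. *)
Lemma dz_zlev j : (1 <= j <= p)%N -> dz R N j = zlev r p j.
Proof.
move=> hj; rewrite /dz; case: ltngtP => jM.
- by rewrite zlev_dr.
- rewrite /dz_north -/(below r _) zlev_dr.
  have := useq_sym hj; move/(congr1 (fun k : nat => k%:R : R)); rewrite natrD natrM => /(canRL (addrK _)) ->.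
  by field; rewrite gt_eqF ?pred_card_gt0.
- by rewrite jM zlev_dr useq_M divff ?subrr // gt_eqF ?pred_card_gt0.
Qed.

Lemma diamond_ringset th : diamond_gen N th = ringset r p th :> {fset space3 R}.
Proof.
rewrite /diamond_gen /ringset; apply/fsetP => x; rewrite !inE /=; congr (_ || _); congr (_ || _).
have -> // : [seq dpoint N th j i | j <- iota 1 p, i <- iota 1 (r j)] =
  [seq ringpt r p th (j, i) | j <- iota 1 p, i <- iota 1 (r j)].
congr flatten; apply/eq_in_map => j; rewrite mem_iota add1n ltnS => hj.
by apply: eq_map => i; rewrite /dpoint /ringpt /rho /= dz_zlev.
Qed.

Lemma rho_sym j : (1 <= j <= p)%N -> rho r p (2 * M - j) = rho r p j :> R.
Proof.
move=> hj; rewrite /rho; congr (Num.sqrt (1 - _)); rewrite !zlev_dr.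
have := useq_sym hj; move/(congr1 (fun k : nat => k%:R : R)); rewrite natrD natrM => /(canRL (addrK _)) ->.
by field; rewrite gt_eqF ?pred_card_gt0.
Qed.

(** With [n = N - 1], [rho ^ 2 * n = u (2 n - u) / n] lies between [u] and [2 u] since [u <= n];
    then [3 j ^ 2 <= u <= 2161 j ^ 2] and [2 * 2161 <= 66 ^ 2]. *)
Lemma rho_bounds j : (1 <= j <= M)%N ->
  (j%:R / Num.sqrt (N - 1)%N%:R : R) <= @rho R r p j <= 66 * j%:R / Num.sqrt (N - 1)%N%:R.
Proof.
move=> hj; have n0 := pred_card_gt0; have M0 := dM_gt0; have p0 : (0 < p)%N by lia.
have hp : (1 <= j <= p)%N by lia.
have rs := @rho_sqr R r p dr_ge3 j hp; have r0 := @rho_gt0 R r p dr_ge3 j hp.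
have q0 : 0 < Num.sqrt (N - 1)%N%:R :> R by rewrite sqrtr_gt0.
have qq : Num.sqrt (N - 1)%N%:R ^+ 2 = (N - 1)%N%:R :> R by rewrite sqr_sqrtr // ltW.
have := useq_bounds hj => /andP[]; rewrite -!(ler_nat R) (natrM R 3) (natrM R 2161) natrX => u1 u2.
have := useq_le hj; rewrite -(ler_nat R) => u3.
move: rs; rewrite zlev_dr.
move: (u j)%:R u1 u2 u3 => v u1 u2 u3.
have -> : 1 - (1 - v / (N - 1)%N%:R) ^+ 2 = v * (2 * (N - 1)%N%:R - v) / Num.sqrt (N - 1)%N%:R ^+ 4.
  by rewrite (exprM _ 2 2) qq; field; rewrite gt_eqF.
have j0 : 0 <= j%:R :> R by [].
move: r0 q0 u3 j0 u1 u2; rewrite -[X in _ <= X -> _]qq -[in 2 * _]qq; move: (rho r p j) (Num.sqrt _) (j%:R) => y q t y0 q0 u3 t0 u1 u2 E.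
have E2 : (y * q) ^+ 2 * q ^+ 2 = v * (2 * q ^+ 2 - v).
  by rewrite exprMn E; field; rewrite gt_eqF.
have q2 : 0 < q ^+ 2 by rewrite exprn_gt0.
have v0 : 0 <= v by apply: le_trans u1; rewrite mulr_ge0 // exprn_ge0.
have yq0 : 0 <= y * q by rewrite ltW // mulr_gt0.
have t66 : 0 <= 66 * t by rewrite mulr_ge0.
rewrite ler_pdivrMr // ler_pdivlMr // -[t <= _]ler_sqr ?nnegrE // -[_ <= 66 * t]ler_sqr ?nnegrE //.
rewrite -(ler_pM2r q2) E2 -[X in _ && X](ler_pM2r q2) E2 exprMn.
move: (q ^+ 2) q2 (t ^+ 2) u1 u2 u3 => Q Q0 t2 u1 u2 u3.
by apply/andP; split; nra.
Qed.

(** From [3 j <= r <= 724 j], [rho_bounds] and [pi <= 4], the three summands contribute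
    [4 * 724 = 2896], [4 * 4 * 66 / 3 = 352] and 724. *)
Lemma celldiam_dr j : (1 <= j <= p)%N -> celldiam r p j <= 4000 / Num.sqrt (N - 1)%N%:R :> R.
Proof.
move=> hj; wlog jM : j hj / (j <= M)%N => [wl|].
  have [jM|jM] := leqP j M; first exact: wl.
  have := wl (2 * M - j)%N; rewrite /celldiam rho_sym // dr_sym //; apply; lia.
have hM : (1 <= j <= M)%N by case/andP: hj => ->.
have n0 := pred_card_gt0; have p0 : (0 < p)%N by lia.
have r0 : 0 < rho r p j :> R by exact: (@rho_gt0 R r p dr_ge3 j hj).
have q0 : 0 < Num.sqrt (N - 1)%N%:R :> R by rewrite sqrtr_gt0.
have qq : Num.sqrt (N - 1)%N%:R ^+ 2 = (N - 1)%N%:R :> R by rewrite sqr_sqrtr // ltW.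
have /andP[y1 y2] := rho_bounds hM.
have := useq_bounds hM => /andP[+ _]; have := useq_le hM; rewrite -!(ler_nat R) natrM natrX => u2 u1.
have {u1 u2}jn : 3 * j%:R ^+ 2 <= (N - 1)%N%:R :> R by exact: le_trans u2.
have : (3 * j <= r j <= 724 * j)%N by have := dr_bounds hM; have := slin_bounds hM; lia.
rewrite -!(ler_nat R) !natrM => /andP[r1 r2].
have j1 : 1 <= j%:R :> R by rewrite ler1n; case/andP: hj.
have pi0 : 0 < @pi R := pi_gt0 R.
have pi4 : @pi R <= 4 by have := @pihalf_lt2 R; lra.
have jq : j%:R <= Num.sqrt (N - 1)%N%:R :> R.
  rewrite -ler_sqr ?nnegrE ?sqrtr_ge0 // qq; apply: le_trans jn.
  by rewrite ler_peMl ?exprn_ge0 // ler1n.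
rewrite /celldiam rn_dr; set q := Num.sqrt _ in qq jq q0 y1 y2 *; rewrite -qq; move: {qq jn n0} q r0 q0 jq y1 y2 j1 r1 r2.
move=> q; move: (rho r p j) (j%:R) (r j)%:R => y t x y0 q0 tq y1 y2 t1 x1 x2.
rewrite ler_pdivrMr // in y1; rewrite ler_pdivlMr // in y2.
have x0 : 0 < x by lra.
have e1 : 4 * x / (q ^+ 2 * y) <= 2896 / q.
  rewrite ler_pdivrMr ?mulr_gt0 ?exprn_gt0 //.
  have -> : 2896 / q * (q ^+ 2 * y) = 2896 * (y * q) by field; rewrite gt_eqF.
  by move: (y * q) y1 => z; lra.
have e2 : 4 * pi * y / x <= 352 / q.
  rewrite ler_pdivrMr // [_ / q * x]mulrAC ler_pdivlMr //.
  have -> : 4 * pi * y * q = 4 * (pi * (y * q)) by ring.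
  have : 0 <= y * q by rewrite mulr_ge0 // ltW.
  move: (y * q) y2 => z z1 z0.
  have : pi * z <= 4 * z by rewrite ler_wpM2r.
  by move: (pi * z) z1 x1; clear; move=> *; lra.
have e3 : x / q ^+ 2 <= 724 / q.
  rewrite ler_pdivrMr ?exprn_gt0 //.
  have -> : 724 / q * q ^+ 2 = 724 * q by field; rewrite gt_eqF.
  by move: x2 tq; clear; move=> *; lra.
apply: le_trans (lerD (lerD e1 e2) e3) _.
by rewrite -!mulrDl ler_pM2r ?invr_gt0 // -!natrD ler_nat.
Qed.

(** [N < 239 (m + 1) ^ 2 + 2 <= 956 m ^ 2 + 2 <= 31 ^ 2 m ^ 2]. *)
Lemma sqrtN_bounds : [/\ 0 < Num.sqrt N%:R :> R, Num.sqrt N%:R <= 31 * m%:R :> R &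
  Num.sqrt N%:R <= 2 * Num.sqrt (N - 1)%N%:R :> R].
Proof.
have [m1 /andP[_ mN]] := @dm_bounds R N N241.
split; first by rewrite sqrtr_gt0 ltr0n; lia.
  rewrite -ler_sqr ?nnegrE ?sqrtr_ge0 ?mulr_ge0 // sqr_sqrtr // exprMn -!natrX -natrM ler_nat.
  have : ((m + 1) ^ 2 <= 4 * m ^ 2)%N.
    by have -> : (4 * m ^ 2 = (2 * m) ^ 2)%N; [ring|rewrite leq_sqr; lia].
  have : (1 <= m ^ 2)%N by rewrite expn_gt0 m1.
  move: mN; move: ((m + 1) ^ 2)%N (m ^ 2)%N => a b; lia.
rewrite -ler_sqr ?nnegrE ?sqrtr_ge0 ?mulr_ge0 ?sqrtr_ge0 // exprMn !sqr_sqrtr // -natrX -natrM ler_nat; lia.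
Qed.

(** From below, the equator has at least [21 m >= (21 / 31) sqrt N] points, and [21 / 62 >= 1 / 4].
    From above, half of [4000 / sqrt (N - 1)] is at most [4000 / sqrt N], and
    [2 / N <= 2 / sqrt N]. *)
Lemma diamond_discrepancy th :
  1 / 4 / Num.sqrt N%:R <= cap_discrepancy (diamond_gen N th : {fset space3 R}) <= 4002 / Num.sqrt N%:R.
Proof.
have [s0 s1 s2] := sqrtN_bounds; have M0 := dM_gt0; have p0 : (0 < p)%N by lia.
have qq : Num.sqrt N%:R ^+ 2 = N%:R :> R by rewrite sqr_sqrtr.
rewrite diamond_ringset; apply/andP; split.
  have hM : (1 <= M <= p)%N by lia.
  have := @ringset_discrepancy_ge R r p dr_ge3 th M hM; rewrite card_dr.
  have : (21 * m <= r M)%N.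
    by have := @dr_bounds M; have := @slin_bounds M; rewrite M0 leqnn /dM; lia.
  rewrite -(ler_nat R) natrM => h1 h2; rewrite ler_pdivrMr //.
  move: (le_trans h1 h2) s1 s0; set q := Num.sqrt _ in qq *; rewrite -qq.
  move: (cap_discrepancy _) {qq} q (m%:R) => D q t h3 s1 s0.
  have : 0 < q * ((2 * (D * q)) - 21 / 31) + q * (1 / 31).
    by nra.
  by rewrite -mulrDr pmulr_rgt0 //; move: (D * q) => z; lra.
have := @ringset_discrepancy_le R r p dr_ge3 p0 th _ celldiam_dr; rewrite card_dr.
move=> h; apply: le_trans h _; rewrite -[X in 2 / X]qq.
have q1 : 1 <= Num.sqrt N%:R :> R by rewrite -[X in X <= _]sqrtr1 ler_sqrt // ler1n; lia.
have q0 : 0 < Num.sqrt (N - 1)%N%:R :> R by rewrite sqrtr_gt0 pred_card_gt0.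
move: s0 s2 q1 q0; move: (Num.sqrt (N - 1)%N%:R) (Num.sqrt N%:R) => b a a0 ab a1 b0.
have e1 : 4000 / b / 2 <= 4000 / a.
  rewrite -mulrA -invfM; apply: ler_wpM2l; first exact: ler0n.
  rewrite lef_pV2 ?posrE; lra.
have e2 : 2 / a ^+ 2 <= 2 / a.
  by rewrite ler_pM2l // lef_pV2 ?posrE ?exprn_gt0 // expr2 ler_peMl // ltW.
apply: le_trans (lerD e1 e2) _; by rewrite -mulrDl ler_pM2r ?invr_gt0 // -natrD ler_nat.
Qed.

Lemma diamond_card th : #|` diamond_gen N th : {fset space3 R} | = N.
Proof.
have M0 := dM_gt0; have p0 : (0 < p)%N by lia.
by rewrite diamond_ringset card_ringset ?card_dr //; exact: dr_ge3.
Qed.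

Lemma diamond_sphere th : [set` (diamond_gen N th : {fset space3 R})] `<=` sphere.
Proof.
have M0 := dM_gt0; have p0 : (0 < p)%N by lia.
by rewrite diamond_ringset; apply: ringset_sphere => //; exact: dr_ge3.
Qed.

End Bounds.

(** * Asymptotic expansion of the expected energy *)

Section LogEstimates.
Context {R : realType}.
Implicit Types (K L m r s t u x : R).

Definition xlnx_prim x : R := x ^+ 2 / 2 * ln x - x ^+ 2 / 4.

(** Compares [e] with [c x ^ (k + 1)] through their derivatives; iterated, it yields Taylor bounds
    one order at a time. *)
Lemma pinch (e e' : R -> R) (c : R) (k : nat) t : 0 <= t -> e 0 = 0 ->
  (forall x, 0 <= x <= t -> is_derive x 1 e (e' x)) ->
  (forall x, 0 <= x <= t -> 0 <= e' x <= k.+1%:R * c * x ^+ k) ->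
  0 <= e t <= c * t ^+ k.+1.
Proof.
move=> t0 e0 de be; apply/andP; split.
  by rewrite -e0; apply: (derive_ge0_le t0 de) => x /be/andP[].
rewrite -subr_ge0.
have -> : 0 = c * 0 ^+ k.+1 - e 0 by rewrite e0 expr0n mulr0 subr0.
apply: (@derive_ge0_le R (fun x => c * x ^+ k.+1 - e x) (fun x => k.+1%:R * c * x ^+ k - e' x) 0 t t0).
  move=> x hx; apply: pderiv_sub; last exact: de.
  by apply: pderiv_eq; [apply: pderiv_scale; apply: pderiv_pow; exact: pderiv_id|rewrite mulr1 mulrCA mulrA].
by move=> x /be/andP[_]; rewrite subr_ge0.
Qed.

(* The third derivative of the middle term is [t^2 / (1 - t^2)]. *)
Lemma taylor_unit L t : 0 <= t < 1 -> 1 <= L * (1 - t) ->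
  0 <= ((1 + t) ^+ 2 * ln (1 + t) - (1 - t) ^+ 2 * ln (1 - t)) / 4 - t / 2 - t ^+ 3 / 6
    <= L / 60 * t ^+ 5.
Proof.
move=> /andP[t0 t1] tL.
have L0 : 0 < L by have := lt_le_trans ltr01 tL; rewrite pmulr_lgt0 // subr_gt0.
have h2 x : 0 <= x <= t -> 0 <= (ln (1 + x) - ln (1 - x)) / 2 - x <= L / 3 * x ^+ 3.
  move=> /andP[x0 xt].
  apply: (@pinch (fun x => (ln (1 + x) - ln (1 - x)) / 2 - x) (fun x => x ^+ 2 / (1 - x ^+ 2))) => //.
  - by rewrite addr0 !subr0 ln1; ring.
  - move=> y /andP[y0 yx]; derive_by; [lra|lra|].
    by field; rewrite !gt_eqF //; nra.
  - move=> y /andP[y0 yx]; have y1 : 0 < 1 - y ^+ 2 by nra.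
    apply/andP; split; first by rewrite divr_ge0 ?sqr_ge0 // ltW.
    rewrite ler_pdivrMr // (_ : 3%:R * (L / 3) * y ^+ 2 * _ = y ^+ 2 * (L * (1 - y ^+ 2))); last by field.
    rewrite ler_peMr ?sqr_ge0 //; apply: le_trans tL _; rewrite ler_pM2l //; nra.
have h1 x : 0 <= x <= t -> 0 <= ((1 + x) * ln (1 + x) + (1 - x) * ln (1 - x)) / 2 - x ^+ 2 / 2 <= L / 12 * x ^+ 4.
  move=> /andP[x0 xt].
  apply: (@pinch (fun x => ((1 + x) * ln (1 + x) + (1 - x) * ln (1 - x)) / 2 - x ^+ 2 / 2) (fun x => (ln (1 + x) - ln (1 - x)) / 2 - x)) => //.
  - by rewrite addr0 !subr0 ln1; ring.
  - move=> y /andP[y0 yx]; derive_by; [lra|lra|].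
    by field; rewrite !gt_eqF //; lra.
  - move=> y /andP[y0 yx]; have -> : 4%:R * (L / 12) = L / 3 by field.
    by apply: h2; rewrite y0 (le_trans yx).
apply: (@pinch (fun t => ((1 + t) ^+ 2 * ln (1 + t) - (1 - t) ^+ 2 * ln (1 - t)) / 4 - t / 2 - t ^+ 3 / 6) (fun x => ((1 + x) * ln (1 + x) + (1 - x) * ln (1 - x)) / 2 - x ^+ 2 / 2) (L / 60) 4 t t0).
- by rewrite addr0 !subr0 ln1; ring.
- move=> y /andP[y0 yx]; derive_by; [lra|lra|].
  by field; rewrite !gt_eqF //; lra.
- move=> y hy; have -> : 5%:R * (L / 60) = L / 12 by field.
  exact: h1.
Qed.

(** Scale by [t = r / u]: the expression is [- u ^ 2] times the one in [taylor_unit]. The first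
    assumption on [L] keeps [t] away from 1; the second turns [u ^ 2 t ^ 5 = (r ^ 2) ^ 2 t / u ^ 2]
    into at most [L ^ 2]. *)
Lemma taylor_xlnx L r u : 0 < u -> 0 <= r -> u <= L * (u - r) -> r ^+ 2 <= L * u ->
  `|r * (u * ln u) - (xlnx_prim (u + r) - xlnx_prim (u - r)) / 2 + r ^+ 3 / (6 * u)| <= L ^+ 3.
Proof.
move=> u0 r0 uL rL.
have ru : r < u.
  have [//|h] := ltP r u; have : L * (u - r) <= 0.
    have [L0|L0] := leP 0 L; first by rewrite mulr_ge0_le0 // subr_le0.
    have : 0 <= r ^+ 2 by rewrite sqr_ge0.
    have : L * u < 0 by rewrite nmulr_rlt0.
    lra.
  lra.
have L1 : 1 <= L.
  have ur : 0 < u - r by lra.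
  rewrite -(ler_pM2r ur) mul1r; lra.
set t := r / u.
have t0 : 0 <= t by rewrite divr_ge0 // ltW.
have rE : r = t * u by rewrite /t divfK // gt_eqF.
have t1 : t < 1 by rewrite ltr_pdivrMr // mul1r.
have tL : 1 <= L * (1 - t).
  by rewrite -(ler_pM2r u0) mul1r -mulrA mulrBl mul1r -rE.
have /andP[e0 e1] := @taylor_unit L t (introT andP (conj t0 t1)) tL.
have lp : ln (u + r) = ln u + ln (1 + t).
  rewrite -lnM ?posrE //; last lra.
  by congr ln; rewrite rE; ring.
have lm : ln (u - r) = ln u + ln (1 - t).
  rewrite -lnM ?posrE //; last lra.
  by congr ln; rewrite rE; ring.
have -> : r * (u * ln u) - (xlnx_prim (u + r) - xlnx_prim (u - r)) / 2 + r ^+ 3 / (6 * u) =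
  - (u ^+ 2 * (((1 + t) ^+ 2 * ln (1 + t) - (1 - t) ^+ 2 * ln (1 - t)) / 4 - t / 2 - t ^+ 3 / 6)).
  rewrite /xlnx_prim lp lm rE; move: (ln _) (ln _) (ln _) => a b c.
  by field; rewrite gt_eqF.
rewrite normrN (ger0_norm (mulr_ge0 (sqr_ge0 u) e0)).
apply: le_trans (ler_wpM2l (sqr_ge0 u) e1) _.
have -> : u ^+ 2 * (L / 60 * t ^+ 5) = L / 60 * ((r ^+ 2) ^+ 2 * t / u ^+ 2).
  by rewrite rE; field; rewrite gt_eqF.
have h : (r ^+ 2) ^+ 2 * t / u ^+ 2 <= L ^+ 2.
  rewrite ler_pdivrMr ?exprn_gt0 // -exprMn.
  have : (r ^+ 2) ^+ 2 <= (L * u) ^+ 2 by rewrite ler_sqr ?nnegrE ?sqr_ge0 ?mulr_ge0 //; lra.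
  have : 0 <= (r ^+ 2) ^+ 2 by rewrite sqr_ge0.
  move: ((r ^+ 2) ^+ 2) ((L * u) ^+ 2) => x y; nra.
have -> : L ^+ 3 = L * L ^+ 2 by rewrite exprS.
have : 0 <= L ^+ 2 by rewrite sqr_ge0.
move: h; move: ((r ^+ 2) ^+ 2 * t / u ^+ 2) (L ^+ 2) => x y; nra.
Qed.

(** Change the numerator first, then the denominator: [r] and [s] are [O(t)] and [O(1)] apart, [u]
    and [q] at least of order [t ^ 2] and [O(t)] apart, so both changes are [O(1)]. *)
Lemma cube_quotient_close K t r s u q : 1 <= K -> 0 < t ->
  0 <= r <= K * t -> 0 <= s <= K * t -> `|r - s| <= K ->
  `|u - q| <= K * t -> t ^+ 2 <= 2 * u -> t ^+ 2 <= 2 * q ->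
  `|r ^+ 3 / u - s ^+ 3 / q| <= 10 * K ^+ 4.
Proof.
move=> K1 t0 /andP[r0 rK] /andP[s0 sK] rs uq tu tq.
have t2 : 0 < t ^+ 2 by rewrite exprn_gt0.
have u0 : 0 < u by lra.
have q0 : 0 < q by lra.
have -> : r ^+ 3 / u - s ^+ 3 / q = (r - s) * (r ^+ 2 + r * s + s ^+ 2) / u + s ^+ 3 * (q - u) / (u * q).
  by field; rewrite !gt_eqF.
have K0 : 0 <= K by lra.
have Kt0 : 0 <= K * t by rewrite mulr_ge0 // ltW.
apply: le_trans (ler_normD _ _) _; rewrite !normrM !normfV (normrM u) (gtr0_norm u0) (gtr0_norm q0).
have -> : `|s| * (`|s| * `|s|) = s ^+ 3 by rewrite ger0_norm.
have R3 : 0 <= r ^+ 2 + r * s + s ^+ 2 <= 3 * (K * t) ^+ 2.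
  have rr : r ^+ 2 <= (K * t) ^+ 2 by rewrite ler_sqr ?nnegrE.
  have ss : s ^+ 2 <= (K * t) ^+ 2 by rewrite ler_sqr ?nnegrE.
  have srr : r * s <= (K * t) ^+ 2 by rewrite expr2 ler_pM.
  have : 0 <= r * s by rewrite mulr_ge0.
  have := sqr_ge0 r; have := sqr_ge0 s.
  by move: rr ss srr; move: (r ^+ 2) (s ^+ 2) (r * s) ((K * t) ^+ 2) => *; lra.
have /andP[R0 R1] := R3; rewrite (ger0_norm R0).
have e1 : `|r - s| * (r ^+ 2 + r * s + s ^+ 2) / u <= 6 * K ^+ 3.
  rewrite ler_pdivrMr //; apply: le_trans (_ : K * (3 * (K * t) ^+ 2) <= _); first by rewrite ler_pM.
  have -> : K * (3 * (K * t) ^+ 2) = 3 * K ^+ 3 * t ^+ 2 by ring.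
  have -> : 6 * K ^+ 3 * u = 3 * K ^+ 3 * (2 * u) by ring.
  by rewrite ler_wpM2l // mulr_ge0 // exprn_ge0.
have e2 : s ^+ 3 * `|q - u| / (u * q) <= 4 * K ^+ 4.
  rewrite ler_pdivrMr ?mulr_gt0 // distrC.
  apply: le_trans (_ : (K * t) ^+ 3 * (K * t) <= _).
    by rewrite ler_pM ?exprn_ge0 // lerXn2r ?nnegrE.
  have -> : (K * t) ^+ 3 * (K * t) = K ^+ 4 * (t ^+ 2 * t ^+ 2) by ring.
  have -> : 4 * K ^+ 4 * (u * q) = K ^+ 4 * ((2 * u) * (2 * q)) by ring.
  by rewrite ler_wpM2l ?exprn_ge0 // ler_pM // ltW.
apply: le_trans (lerD e1 e2) _.
have : K ^+ 3 <= K ^+ 4 by exact: ler_weXn2l.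
move: (K ^+ 3) (K ^+ 4) => a b; lra.
Qed.

(** The difference is [(r - s) ln (r / m) + s ln (1 + (r - s) / s)]. The factor [1 + ln m] is due to
    small rings, where [r / m] may be as small as [1 / m]. *)
Lemma xlnx_close K m r s : 1 <= K -> 1 <= m -> 1 <= s -> s <= r <= K * m -> r - s <= K ->
  `|r * ln (r / m) - s * ln (s / m)| <= 3 * K ^+ 2 * (1 + ln m).
Proof.
move=> K1 m1 s1 /andP[sr rK] rs.
have m0 : 0 < m by lra.
have s0 : 0 < s by lra.
have r0 : 0 < r by lra.
have lm : 0 <= ln m by exact: ln_ge0.
have -> : r * ln (r / m) - s * ln (s / m) = (r - s) * ln (r / m) + s * ln (1 + (r - s) / s).
  have -> : 1 + (r - s) / s = r / s by field; rewrite gt_eqF.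
  rewrite !ln_div ?posrE //; ring.
have a1 : `|ln (r / m)| <= K + ln m.
  have lo : - ln m <= ln (r / m) by rewrite ln_div ?posrE // lerBrDr addNr ln_ge0 //; lra.
  have hi : ln (r / m) <= K.
    apply: le_trans (_ : ln K <= _); last by apply/ltW/ln_sublinear; lra.
    by rewrite ler_ln ?posrE ?divr_gt0 // ?ler_pdivrMr //; lra.
  by rewrite ler_norml; lra.
have a2 : 0 <= s * ln (1 + (r - s) / s) <= K.
  have x0 : 0 <= (r - s) / s by rewrite divr_ge0 ?subr_ge0 // ltW.
  rewrite mulr_ge0 ?ln_ge0 ?lerDl ?(ltW s0) //=.
  apply: le_trans rs; have h : ln (1 + (r - s) / s) <= (r - s) / s by apply: le_ln1Dx; lra.
  by rewrite mulrC -ler_pdivlMr.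
apply: le_trans (ler_normD _ _) _; rewrite normrM.
have /andP[b1 b2] := a2; rewrite (ger0_norm b1) ger0_norm ?subr_ge0 //.
have : (r - s) * `|ln (r / m)| <= K * (K + ln m) by rewrite ler_pM ?subr_ge0.
have : 0 <= K * ln m by rewrite mulr_ge0 //; lra.
have : K * ln m <= K ^+ 2 * ln m by rewrite ler_wpM2r // expr2 ler_peMl //; lra.
have : K <= K ^+ 2 by rewrite expr2 ler_peMl //; lra.
rewrite [3 * _ * _]mulrDr mulr1 -mulrA mulrDr -expr2.
by move: (K * ln m) (K ^+ 2 * ln m) (K ^+ 2) ((r - s) * _) => *; lra.
Qed.


(* With [s = a x + b] and [q = s^2 / a - c], a primitive of
   [- s ln s + (s^3 / q + s^3 / (h - q)) / 12]. In the scaled variable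
   [x = j / m], [r_j] and [u_j] are close to [m s] and [m^2 q]; [h] is 478. *)
Definition piece (h a b c x : R) : R :=
  - xlnx_prim (a * x + b) / a
  + a / 24 * (c * ln ((a * x + b) ^+ 2 / a - c)
              - (h + c) * ln (h - ((a * x + b) ^+ 2 / a - c))).

Lemma piece_derive (h a b c x : R) (s := a * x + b) (q := s ^+ 2 / a - c) :
  0 < a -> 0 < s -> 0 < q < h ->
  is_derive x 1 (piece h a b c) (- (s * ln s) + (s ^+ 3 / q + s ^+ 3 / (h - q)) / 12).
Proof.
move=> a0 s0 /andP[q0 q1]; rewrite /piece /xlnx_prim; derive_by.
- exact: s0.
- exact: q0.
- by rewrite subr_gt0; exact: q1.
rewrite -/s -/q /= expr1.
have q2 : h - q != 0 by rewrite gt_eqF ?subr_gt0.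
have q3 : q != 0 by rewrite gt_eqF.
have a3 : a != 0 by rewrite gt_eqF.
have s3 : s != 0 by rewrite gt_eqF.
have -> : c = s ^+ 2 / a - q by rewrite /q; ring.
clearbody q s; move: (ln _) (ln _) (ln _) => l1 l2 l3.
by field; rewrite q2 q3 a3 s3.
Qed.

(** The first quotient is compared at scale [j], since [u] may be small near the pole, the second at
    scale [m], since [2 n - u >= n]. The 5 covers [20 / 12 + 3]. *)
Lemma term_close (h B m j r u n s q : R) (K := 100 * B) :
  2 <= h -> 1 <= B -> 1 <= m -> 2 <= j <= 7 * m -> 1 <= s ->
  s <= r <= s + 7 * B -> r <= 7 * B * j -> j ^+ 2 <= 2 * q -> q <= h / 2 * m ^+ 2 ->
  q <= u <= q + 13 * B * j ->
  h / 2 * m ^+ 2 <= n <= h / 2 * m ^+ 2 + B * m -> u <= n ->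
  `|- (r * ln (r / m)) + (r ^+ 3 / u + r ^+ 3 / (2 * n - u)) / 12
    - (- (s * ln (s / m)) + (s ^+ 3 / q + s ^+ 3 / (h * m ^+ 2 - q)) / 12)| <= 5 * K ^+ 4 * (1 + ln m).
Proof.
move=> h2 B1 m1 /andP[j2 jm] s1 /andP[r1 r2] r3 jq qm /andP[u1 u2] /andP[n1 n2] un.
have B0 : 0 < B by exact: lt_le_trans B1.
have m0 : 0 < m by exact: lt_le_trans m1.
have j0 : 0 < j by apply: lt_le_trans j2.
have K1 : 1 <= K by rewrite /K; move: B B1 {B0 r2 r3 u2 n2 K}; clear; move=> B B1; lra.
have m20 : 0 <= m ^+ 2 by exact: exprn_ge0 (ltW m0).
have hm : m ^+ 2 <= h / 2 * m ^+ 2.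
  by rewrite ler_peMl ?exprn_ge0 ?(ltW m0) // ler_pdivlMr // mul1r.
have Bj : 7 * B * j <= 49 * (B * m).
  have -> : 49 * (B * m) = 7 * B * (7 * m) by ring.
  by rewrite ler_wpM2l // mulr_ge0 // ltW.
have Bm0 : 0 <= B * m by rewrite mulr_ge0 // ltW.
have Bj0 : 0 <= B * j by rewrite mulr_ge0 // ltW.
have KE y : K * y = 100 * (B * y) by rewrite /K mulrA.
have rs : `|r - s| <= K.
  by rewrite ger0_norm ?subr_ge0 // /K; move: r2 B0; clear; move=> *; lra.
have sr0 : 0 <= s /\ 0 <= r by move: s1 r1; clear; move=> *; lra.
have [s0 r0] := sr0.
have c1 : `|r ^+ 3 / u - s ^+ 3 / q| <= 10 * K ^+ 4.
  apply: (@cube_quotient_close K j) => //; rewrite ?KE.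
  - by rewrite r0 /=; move: r3 Bj0; rewrite -mulrA; move: (B * j); clear; move=> *; lra.
  - by rewrite s0 /=; move: r1 r3 Bj0; rewrite -mulrA; move: (B * j); clear; move=> *; lra.
  - rewrite ger0_norm ?subr_ge0 //; move: u2 Bj0; rewrite -mulrA; move: (B * j); clear; move=> *; lra.
  - by apply: le_trans jq _; rewrite ler_wpM2l.
have c2 : `|r ^+ 3 / (2 * n - u) - s ^+ 3 / (h * m ^+ 2 - q)| <= 10 * K ^+ 4.
  have hE : h * m ^+ 2 = 2 * (h / 2 * m ^+ 2) by field.
  move: r3 Bj u2; rewrite -!(mulrA 7) -(mulrA 13).
  rewrite hE; move: (h / 2 * m ^+ 2) qm n1 n2 hm => w qm n1 n2 hm r3 Bj u2.
  apply: (@cube_quotient_close K m) => //; rewrite ?KE.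
  - by rewrite r0 /=; move: r3 Bj Bm0; move: (B * j) (B * m); clear; move=> *; lra.
  - by rewrite s0 /=; move: r1 r3 Bj Bm0; move: (B * j) (B * m); clear; move=> *; lra.
  - move: qm n1 n2 u1 u2 Bj Bj0 Bm0; move: (B * j) (B * m); clear; move=> *.
    by rewrite ler_norml; apply/andP; split; lra.
  - by move: un n1 hm m20; move: (m ^+ 2); clear; move=> *; lra.
  - by move: qm n1 hm m20; move: (m ^+ 2); clear; move=> *; lra.
have c3 : `|r * ln (r / m) - s * ln (s / m)| <= 3 * K ^+ 2 * (1 + ln m).
  apply: xlnx_close; [exact: K1|exact: m1|exact: s1| |].
    rewrite r1 KE; move: r3 Bj Bm0; rewrite -!(mulrA 7); move: (B * j) (B * m); clear; move=> *; lra.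
  by apply: le_trans rs; exact: ler_norm.
have l0 : 0 <= ln m by exact: ln_ge0.
have l1 : 0 <= 1 + ln m by exact: addr_ge0.
have KK : K ^+ 2 <= K ^+ 4 by exact: ler_weXn2l.
have KKl : K ^+ 2 * (1 + ln m) <= K ^+ 4 * (1 + ln m) by exact: ler_wpM2r.
have Kl : K ^+ 4 <= K ^+ 4 * (1 + ln m).
  by rewrite ler_peMr ?lerDl // exprn_ge0 // (le_trans ler01).
move: c1 c2 c3 KKl Kl; rewrite -[5 * _ * _]mulrA -[3 * _ * _]mulrA.
move: (K ^+ 4 * (1 + ln m)) (K ^+ 2 * (1 + ln m)) (K ^+ 4) => w1 w2 w3.
move: (r ^+ 3 / u) (s ^+ 3 / q) (r ^+ 3 / (2 * n - u)) (s ^+ 3 / (h * m ^+ 2 - q)) (r * ln (r / m)) (s * ln (s / m)).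
clear; move=> z1 z2 z3 z4 z5 z6; rewrite !ler_norml.
by move=> /andP[? ?] /andP[? ?] /andP[? ?] *; apply/andP; split; lra.
Qed.

(** By the mean value theorem the increment of [piece] is its derivative at some [t / m] with
    [j - 1 < t < j]; the affine and quadratic data at [t] are then close enough to ring [j] for
    [term_close]. [j >= 2] keeps [T] away from its zero at the pole. *)
Lemma cell_close (h B m j a b c r u n : R) (K := 100 * B)
    (T := fun t : R => (a * t + b * m) ^+ 2 / a - c * m ^+ 2) :
  2 <= h -> 1 <= B -> 1 <= m -> 2 <= j <= 7 * m -> 1 <= a <= 6 ->
  3 * (j - 1) <= a * (j - 1) + b * m -> a * j + b * m <= 6 * j ->
  a * j + b * m <= r <= a * j + b * m + B ->
  3 * (j - 1) ^+ 2 <= T (j - 1) -> T j <= h / 2 * m ^+ 2 -> T j <= u <= T j + B * j ->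
  h / 2 * m ^+ 2 <= n <= h / 2 * m ^+ 2 + B * m -> u <= n ->
  `|- (r * ln (r / m)) + (r ^+ 3 / u + r ^+ 3 / (2 * n - u)) / 12
    - m ^+ 2 * (piece h a b c (j / m) - piece h a b c ((j - 1) / m))| <= 5 * K ^+ 4 * (1 + ln m).
Proof.
move=> h2 B1 m1 /andP[j2 jm] /andP[a1 a6] s1 s2 /andP[r1 r2] T1 T2 /andP[u1 u2] /andP[n1 n2] un.
have m0 : 0 < m by exact: lt_le_trans m1.
have a0 : 0 < a by exact: lt_le_trans a1.
have hh : h / 2 < h by move: h2; clear; move=> *; lra.
have s0 : 3 <= a * (j - 1) + b * m by apply: le_trans s1; move: j2; clear; move=> *; lra.
have mm : m != 0 by rewrite gt_eqF.
have aa : a != 0 by rewrite gt_eqF.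
have m2 : 0 < m ^+ 2 by rewrite exprn_gt0.
have TE x : T x = m ^+ 2 * ((a * (x / m) + b) ^+ 2 / a - c).
  by rewrite /T; field; rewrite mm aa.
have SE x : a * x + b * m = m * (a * (x / m) + b) by field.
have Tmono x y : 0 <= a * x + b * m -> x <= y -> T x <= T y.
  move=> x0 xy; rewrite /T lerD2r ler_pM2r ?invr_gt0 //.
  have : a * x <= a * y by rewrite ler_pM2l.
  by move=> xy'; rewrite ler_sqr ?nnegrE ?lerD2r // (le_trans x0) ?lerD2r.
have key t : j - 1 <= t <= j -> [/\ 3 <= a * t + b * m, 3 * (j - 1) ^+ 2 <= T t & T t <= T j].
  move=> /andP[t1 t2].
  have st : 3 <= a * t + b * m by apply: le_trans s0 _; rewrite lerD2r ler_pM2l.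
  split => //; first by apply: le_trans T1 (Tmono _ _ _ t1); exact: le_trans s0.
  by apply: Tmono t2; exact: le_trans st.
have jj : 3 <= 3 * (j - 1) ^+ 2 by nra.
have [x /andP[x1 x2] E] : exists2 x, (j - 1) / m < x < j / m &
  piece h a b c (j / m) - piece h a b c ((j - 1) / m) =
  (- ((a * x + b) * ln (a * x + b)) + ((a * x + b) ^+ 3 / ((a * x + b) ^+ 2 / a - c) +
     (a * x + b) ^+ 3 / (h - ((a * x + b) ^+ 2 / a - c))) / 12) * (j / m - (j - 1) / m).
  apply: (mean_value (f' := fun x => (- ((a * x + b) * ln (a * x + b)) + ((a * x + b) ^+ 3 / ((a * x + b) ^+ 2 / a - c) +
     (a * x + b) ^+ 3 / (h - ((a * x + b) ^+ 2 / a - c))) / 12))).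
    by rewrite ltr_pM2r ?invr_gt0 // gtrBl.
  move=> x hx.
  have hx' : j - 1 <= x * m <= j 
    by move: hx => /andP[x1 x2]; rewrite -(ler_pdivrMr _ _ m0) x1 -(ler_pdivlMr _ _ m0).
  have [k1 k2 k3] := key _ hx'.
  have e : x * m / m = x by rewrite mulfK.
  move: k1 k2 k3; rewrite SE TE e => k1 k2 k3.
  apply: piece_derive => //.
    by rewrite -(pmulr_rgt0 _ m0) (lt_le_trans _ k1).
  move: (le_trans jj k2) (le_trans k3 T2) m2; move: (_ / a - c) (m ^+ 2) => q M2 q0 q1 m2.
  rewrite -(pmulr_rgt0 _ m2) -[q < h](ltr_pM2l m2).
  by apply/andP; split; [exact: lt_le_trans q0|apply: le_lt_trans q1 _; rewrite mulrC ltr_pM2l].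
set t := x * m.
have xt : x = t / m by rewrite /t mulfK.
move: x1 x2; rewrite ltr_pdivrMr // ltr_pdivlMr // -/t => t1 t2.
have [|k1 k2 k3] := key t; first by rewrite !ltW.
set S := a * t + b * m; set Q := T t.
have -> : m ^+ 2 * (piece h a b c (j / m) - piece h a b c ((j - 1) / m)) =
   - (S * ln (S / m)) + (S ^+ 3 / Q + S ^+ 3 / (h * m ^+ 2 - Q)) / 12.
  have Q0 : Q != 0.
    by rewrite gt_eqF // (lt_le_trans _ k2) // (lt_le_trans _ jj).
  have V0 : h * m ^+ 2 - Q != 0.
    rewrite gt_eqF // subr_gt0 (le_lt_trans (le_trans k3 T2)) // (ltr_pM2r m2); exact: hh.
  have S1 : S / m = a * x + b by rewrite /S SE -xt [m * _]mulrC mulfK.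
  have Q1 : (a * x + b) ^+ 2 / a - c = Q / m ^+ 2 by rewrite /Q TE -xt [m ^+ 2 * _]mulrC mulfK // (gt_eqF m2).
  rewrite E Q1 -S1; move: (ln _) => l; clearbody S Q.
  have V1 : h - Q / m ^+ 2 = (h * m ^+ 2 - Q) / m ^+ 2 by field.
  rewrite V1; field.
  by rewrite mm Q0 V0.
have SJ : S <= a * j + b * m by rewrite /S lerD2r ler_pM2l // ltW.
have Sa : a * j + b * m - S <= a.
  have : a * (j - t) <= a * 1 by rewrite ler_pM2l // lerBlDr addrC -lerBlDr ltW.
  by rewrite mulrBr /S; move: (a * j) (a * t) (b * m); clear; move=> *; lra.
have TQ : T j - Q <= 12 * j.
  have -> : T j - Q = (a * j + b * m - S) * (a * j + b * m + S) / a.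
    by rewrite /Q /T /S; field.
  have k1' : 3 <= S by [].
  rewrite ler_pdivrMr // [12 * j * a]mulrC; clearbody S.
  move: SJ Sa s2 k1' a0; move: (a * j + b * m); clear; move=> s ? ? ? ? ?.
  by apply: ler_pM; lra.
have Bj : j <= B * j by rewrite ler_peMl // (le_trans _ j2).
have s1' : 1 <= S by rewrite (le_trans _ k1) // ler1n.
have Q3 : 3 * (j - 1) ^+ 2 <= Q by [].
have QT : Q <= T j by [].
clearbody S Q; apply: (@term_close h B m j); rewrite ?j2 //.
- move: r1 r2 SJ Sa B1 a6; move: (a * j + b * m); clear; move=> s *.
  by apply/andP; split; lra.
- rewrite -mulrA; move: r2 s2 Bj; move: (a * j + b * m).
  have : B <= B * j by rewrite ler_peMr ?(le_trans ler01 B1) // (le_trans _ j2) // ler1n.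
  by move: (B * j); clear; move=> *; lra.
(* Valid because [j >= 2]; with [3 (j - 1) ^ 2 <= Q] it gives [j ^ 2 <= 2 Q]. *)
- have : j ^+ 2 <= 6 * (j - 1) ^+ 2.
    have -> : j ^+ 2 = 6 * (j - 1) ^+ 2 - (5 * (j - 2) ^+ 2 + 8 * (j - 2) + 2) by ring.
    have := sqr_ge0 (j - 2); move: ((j - 2) ^+ 2) ((j - 1) ^+ 2) j2; clear; move=> *; lra.
  by move: Q3; move: (j ^+ 2) ((j - 1) ^+ 2); clear; move=> *; lra.
- exact: le_trans QT T2.
- rewrite (le_trans QT u1) /=; move: u2 TQ Bj; rewrite -mulrA; move: (B * j) (T j); clear; move=> *; lra.
- by rewrite n1.
Qed.

End LogEstimates.

(** * Riemann sums over the six affine pieces *)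

Section PieceSum.
Context (R : realType) (N : nat) (B h : R).
Hypothesis N241 : (241 <= N)%N.
Hypothesis hB : 2155%N%:R <= B.
Hypothesis hE : h = 478.

Local Notation m := (dm R N).
Local Notation M := (dM R N).
Local Notation p := (2 * dM R N - 1)%N.
Local Notation r := (dr R N).
Local Notation u j := (1 + dr R N j + 2 * below (dr R N) j)%N.
Local Notation n := ((N - 1)%N%:R : R).
Local Notation mr := (m%:R : R).

(* [B] and [h] stand for 2155 and 478: numerals of [R] are unary, and a literal
   would be unfolded by conversion. *)
Definition ring_term (j : nat) : R :=
  - ((r j)%:R * ln ((r j)%:R / mr))
  + ((r j)%:R ^+ 3 / (u j)%:R + (r j)%:R ^+ 3 / (2 * n - (u j)%:R)) / 12.

Local Notation C := (5 * (100 * B) ^+ 4 * (1 + ln mr)).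

Lemma dm_ge1 : 1 <= mr.
Proof. by rewrite ler1n; have [] := @dm_bounds R N N241. Qed.

Lemma error_ge1 : 1 <= B.
Proof. by apply: le_trans hB; rewrite ler1n. Qed.

Lemma n_bounds : 239 * mr ^+ 2 <= n <= 239 * mr ^+ 2 + B * mr.
Proof.
have [m1 /andP[lo hi]] := @dm_bounds R N N241.
have h1 : (239 * m ^ 2 <= N - 1)%N by lia.
have h2 : (N - 1 <= 239 * m ^ 2 + 2155 * m)%N.
  have : (239 * (m + 1) ^ 2 = 239 * m ^ 2 + 478 * m + 239)%N by ring.
  by move: hi; move: (239 * m ^ 2)%N (239 * (m + 1) ^ 2)%N => x y; lia.
have e1 : (239 * m ^ 2)%N%:R = 239 * mr ^+ 2 by rewrite natrM natrX.
have e2 : (2155 * m)%N%:R = 2155%N%:R * mr by rewrite natrM.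
have {}h1 : 239 * mr ^+ 2 <= n by rewrite -e1 ler_nat.
have {}h2 : n <= 239 * mr ^+ 2 + 2155%N%:R * mr by rewrite -e1 -e2 -natrD ler_nat.
by rewrite h1 /=; apply: le_trans h2 _; rewrite lerD2l; apply: ler_wpM2r.
Qed.

Lemma trap_le j : (1 <= j <= M)%N -> (trap R N j <= 239 * m ^ 2)%N.
Proof.
move=> /andP[j1 jM]; have M0 := @dM_gt0 R N N241.
have -> : (239 * m ^ 2 = trap R N M)%N.
  have [_] := @trap_pieces R N N241 M M0; rewrite {1 2}/dM leqnn andbT leq_mul // => /(_ isT).
  rewrite {2 3}/dM expnMn (_ : m * (7 * m) = 7 * m ^ 2)%N; last by ring.
  move: (trap _ _ _) (m ^ 2)%N => x y; lia.
rewrite -(subnKC jM); elim: (M - j)%N => [|k ih]; first by rewrite addn0.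
by apply: leq_trans ih _; rewrite addnS (@trap_rec R N N241) ?(leq_trans j1) ?leq_addr // -addnA leq_addr.
Qed.

(** [c] completes the square: [a k ^ 2 + 2 b m k - e m ^ 2 = (a k + b m) ^ 2 / a - c m ^ 2], so that
    [trap] is the quadratic of [cell_close]. *)
Lemma cell_dr (a b e j : nat) (c : R := b%:R ^+ 2 / a%:R + e%:R) :
  (1 <= a <= 6)%N -> (2 <= j <= M)%N ->
  (forall k, (j.-1 <= k <= j)%N -> slin R N k = (a * k + b * m)%N /\
      (trap R N k + e * m ^ 2 = a * k ^ 2 + 2 * b * (m * k))%N) ->
  `|ring_term j - mr ^+ 2 * (piece h a%:R b%:R c (j%:R / mr) - piece h a%:R b%:R c ((j%:R - 1) / mr))| <= C.
Proof.
move=> /andP[a1 a6] /andP[j2 jM] hk.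
have B1 := error_ge1; have m1 := dm_ge1.
have j1 : (j.-1)%:R = j%:R - 1 :> R by rewrite -[in RHS](@prednK j) ?(ltnW j2) // -natr1 addrK.
have a0 : (a%:R : R) != 0 by rewrite pnatr_eq0; move: a1; clear; lia.
have T k : (j.-1 <= k <= j)%N -> (a%:R * k%:R + b%:R * mr) ^+ 2 / a%:R - c * mr ^+ 2 = (trap R N k)%:R.
  move=> /hk[_] /(congr1 (fun i : nat => i%:R : R)); rewrite natrD (natrM R e) natrX => /(canRL (addrK _)) ->.
  rewrite natrD (natrM R a) natrX (natrM R (2 * b)) (natrM R 2) (natrM R m).
  by rewrite /c; field.
have S k : (j.-1 <= k <= j)%N -> a%:R * k%:R + b%:R * mr = (slin R N k)%:R.
  by move=> /hk[-> _]; rewrite natrD !natrM.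
have hj : (1 <= j <= M)%N by move: j2 jM; clear; lia.
have hj1 : (1 <= j.-1 <= M)%N by move: j2 jM; clear; lia.
have k0 : (j.-1 <= j.-1 <= j)%N by clear; lia.
have k1 : (j.-1 <= j <= j)%N by clear; lia.
have half : h / 2 = 239.
  by apply: (mulIf (x := 2)); rewrite ?pnatr_eq0 // divfK ?pnatr_eq0 // hE -natrM.
rewrite /ring_term.
apply: cell_close; rewrite -?j1 ?half ?T ?S //.
- by rewrite hE ler_nat.
- by rewrite ler_nat j2 -natrM ler_nat.
- by rewrite ler1n a1 ler_nat.
- by rewrite -natrM ler_nat; case/andP: (@slin_bounds R N N241 _ hj1).
- by rewrite -natrM ler_nat; case/andP: (@slin_bounds R N N241 _ hj).
- have /andP[d1 d2] := @dr_bounds R N N241 _ hj; rewrite ler_nat d1 /=.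
  apply: le_trans (_ : (slin R N j + 718)%N%:R <= _); first by rewrite ler_nat.
  by rewrite natrD lerD2l; apply: le_trans hB; rewrite ler_nat.
- by rewrite -natrX -natrM ler_nat; case/andP: (@trap_bounds R N N241 _ hj1).
- by rewrite -natrX -natrM ler_nat; exact: trap_le.
- have /andP[d1 d2] := @useq_trap R N N241 _ hj; rewrite ler_nat d1 /=.
  apply: le_trans (_ : (trap R N j + 2155 * j)%N%:R <= _); first by rewrite ler_nat.
  by rewrite natrD natrM lerD2l ler_wpM2r.
- exact: n_bounds.
- by rewrite ler_nat; exact: useq_le.
Qed.

Lemma piece_sum (a b e lo hi : nat) (aR bR cR x y : R) :
  (1 <= a <= 6)%N -> (1 <= lo <= hi)%N -> (hi <= M)%N ->
  (forall k, (lo <= k <= hi)%N -> slin R N k = (a * k + b * m)%N /\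
      (trap R N k + e * m ^ 2 = a * k ^ 2 + 2 * b * (m * k))%N) ->
  aR = a%:R -> bR = b%:R -> cR = bR ^+ 2 / aR + e%:R -> x = lo%:R / mr -> y = hi%:R / mr ->
  `|\sum_(lo <= k < hi) ring_term k.+1
     - mr ^+ 2 * (piece h aR bR cR y - piece h aR bR cR x)| <= (hi - lo)%N%:R * C.
Proof.
move=> ha /andP[l1 lh] hM hk -> -> -> -> ->.
rewrite -(telescope_sumr (fun k => piece h a%:R b%:R (b%:R ^+ 2 / a%:R + e%:R) (k%:R / mr)) lh) mulr_sumr -sumrB.
apply: le_trans (ler_norm_sum _ _ _) _.
apply: le_trans (_ : \sum_(lo <= k < hi) C <= _); last by rewrite sumr_const_nat -[C *+ _]mulr_natl.
rewrite !big_nat; apply: ler_sum => k /andP[k1 k2].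
have -> : k%:R = k.+1%:R - 1 :> R by rewrite -natr1 addrK.
by apply: cell_dr => //; [lia|move=> i hi'; apply: hk; lia].
Qed.

(** The third parameters are [b ^ 2 / a + e] with the offsets [e] of [trap_pieces]; the endpoints
    are the breakpoints divided by [m]. *)
Definition piece_total : R :=
  (piece h 6 0 0 2 - piece h 6 0 0 0) +
  (piece h 5 2 (24 / 5) 3 - piece h 5 2 (24 / 5) 2) +
  (piece h 4 5 (77 / 4) 4 - piece h 4 5 (77 / 4) 3) +
  (piece h 3 9 56 5 - piece h 3 9 56 4) +
  (piece h 2 14 152 6 - piece h 2 14 152 5) +
  (piece h 1 20 490 7 - piece h 1 20 490 6).

(** The sum starts at ring 2, so the increment over [[0, 1 / m]] is taken out of the total. The
    remaining cells number at most [7 m]. *)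
Lemma pieces_sum :
  `|\sum_(1 <= k < M) ring_term k.+1
     - mr ^+ 2 * (piece_total - (piece h 6 0 0 (1 / mr) - piece h 6 0 0 0))| <= 7 * mr * C.
Proof.
have [m1 _] := @dm_bounds R N N241.
have L1 : (1 <= 1 <= 2 * m)%N by clear -m1; lia.
have U1 : (2 * m <= M)%N by rewrite /dM; clear -m1; lia.
have K1 k : (1 <= k <= 2 * m)%N -> slin R N k = (6 * k + 0 * m)%N /\
      (trap R N k + 0 * m ^ 2 = 6 * k ^ 2 + 2 * 0 * (m * k))%N.
  move=> hk; have k1 : (1 <= k)%N by clear -m1 hk; lia.
  case: (@slin_pieces R N N241 k k1) => -[hs _ _ _ _] _; case: (@trap_pieces R N N241 k k1) => -[ht _ _ _ _] _; split; [apply: hs|apply: ht]; clear -m1 hk; lia.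
have E1 : 0 = 0 ^+ 2 / 6 + 0%:R :> R by rewrite expr0n mul0r add0r.
have L2 : (1 <= 2 * m <= 3 * m)%N by clear -m1; lia.
have U2 : (3 * m <= M)%N by rewrite /dM; clear -m1; lia.
have K2 k : (2 * m <= k <= 3 * m)%N -> slin R N k = (5 * k + 2 * m)%N /\
      (trap R N k + 4 * m ^ 2 = 5 * k ^ 2 + 2 * 2 * (m * k))%N.
  move=> hk; have k1 : (1 <= k)%N by clear -m1 hk; lia.
  case: (@slin_pieces R N N241 k k1) => -[_ hs _ _ _] _; case: (@trap_pieces R N N241 k k1) => -[_ ht _ _ _] _; split; [apply: hs|apply: ht]; clear -m1 hk; lia.
have E2 : (24 / 5) = 2 ^+ 2 / 5 + 4%:R :> R by field.
have L3 : (1 <= 3 * m <= 4 * m)%N by clear -m1; lia.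
have U3 : (4 * m <= M)%N by rewrite /dM; clear -m1; lia.
have K3 k : (3 * m <= k <= 4 * m)%N -> slin R N k = (4 * k + 5 * m)%N /\
      (trap R N k + 13 * m ^ 2 = 4 * k ^ 2 + 2 * 5 * (m * k))%N.
  move=> hk; have k1 : (1 <= k)%N by clear -m1 hk; lia.
  case: (@slin_pieces R N N241 k k1) => -[_ _ hs _ _] _; case: (@trap_pieces R N N241 k k1) => -[_ _ ht _ _] _; split; [apply: hs|apply: ht]; clear -m1 hk; lia.
have E3 : (77 / 4) = 5 ^+ 2 / 4 + 13%:R :> R by field.
have L4 : (1 <= 4 * m <= 5 * m)%N by clear -m1; lia.
have U4 : (5 * m <= M)%N by rewrite /dM; clear -m1; lia.
have K4 k : (4 * m <= k <= 5 * m)%N -> slin R N k = (3 * k + 9 * m)%N /\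
      (trap R N k + 29 * m ^ 2 = 3 * k ^ 2 + 2 * 9 * (m * k))%N.
  move=> hk; have k1 : (1 <= k)%N by clear -m1 hk; lia.
  case: (@slin_pieces R N N241 k k1) => -[_ _ _ hs _] _; case: (@trap_pieces R N N241 k k1) => -[_ _ _ ht _] _; split; [apply: hs|apply: ht]; clear -m1 hk; lia.
have E4 : 56 = 9 ^+ 2 / 3 + 29%:R :> R by field.
have L5 : (1 <= 5 * m <= 6 * m)%N by clear -m1; lia.
have U5 : (6 * m <= M)%N by rewrite /dM; clear -m1; lia.
have K5 k : (5 * m <= k <= 6 * m)%N -> slin R N k = (2 * k + 14 * m)%N /\
      (trap R N k + 54 * m ^ 2 = 2 * k ^ 2 + 2 * 14 * (m * k))%N.
  move=> hk; have k1 : (1 <= k)%N by clear -m1 hk; lia.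
  case: (@slin_pieces R N N241 k k1) => -[_ _ _ _ hs] _; case: (@trap_pieces R N N241 k k1) => -[_ _ _ _ ht] _; split; [apply: hs|apply: ht]; clear -m1 hk; lia.
have E5 : 152 = 14 ^+ 2 / 2 + 54%:R :> R by field.
have L6 : (1 <= 6 * m <= 7 * m)%N by clear -m1; lia.
have U6 : (7 * m <= M)%N by rewrite /dM; clear -m1; lia.
have K6 k : (6 * m <= k <= 7 * m)%N -> slin R N k = (1 * k + 20 * m)%N /\
      (trap R N k + 90 * m ^ 2 = 1 * k ^ 2 + 2 * 20 * (m * k))%N.
  move=> hk; have k1 : (1 <= k)%N by clear -m1 hk; lia.
  case: (@slin_pieces R N N241 k k1) => _ hs; case: (@trap_pieces R N N241 k k1) => _ ht; split; [apply: hs|apply: ht]; clear -m1 hk; lia.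
have E6 : 490 = 20 ^+ 2 / 1 + 90%:R :> R by field.
have m1' := dm_ge1.
have m0 : mr != 0 by rewrite gt_eqF // (lt_le_trans ltr01).
have C0 : 0 <= C.
  have B1 := error_ge1.
  by rewrite mulr_ge0 ?addr_ge0 ?ln_ge0 // mulr_ge0 ?exprn_ge0 // mulr_ge0 // (le_trans ler01).
have xm (x : nat) : x%:R = (x * m)%N%:R / mr by rewrite natrM mulfK.
have P1 := @piece_sum 6 0 0 (1) (2 * m) 6 0 0 (1 / mr) 2 isT L1 U1 K1 (erefl _) (erefl _) E1 (erefl _) (xm 2).
have P2 := @piece_sum 5 2 4 (2 * m) (3 * m) 5 2 (24 / 5) 2 3 isT L2 U2 K2 (erefl _) (erefl _) E2 (xm 2) (xm 3).
have P3 := @piece_sum 4 5 13 (3 * m) (4 * m) 4 5 (77 / 4) 3 4 isT L3 U3 K3 (erefl _) (erefl _) E3 (xm 3) (xm 4).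
have P4 := @piece_sum 3 9 29 (4 * m) (5 * m) 3 9 56 4 5 isT L4 U4 K4 (erefl _) (erefl _) E4 (xm 4) (xm 5).
have P5 := @piece_sum 2 14 54 (5 * m) (6 * m) 2 14 152 5 6 isT L5 U5 K5 (erefl _) (erefl _) E5 (xm 5) (xm 6).
have P6 := @piece_sum 1 20 90 (6 * m) (7 * m) 1 20 490 6 7 isT L6 U6 K6 (erefl _) (erefl _) E6 (xm 6) (xm 7).
rewrite {1}/dM.
rewrite (@big_cat_nat _ _ _ (2 * m)) ?leq_mul //=.
rewrite (@big_cat_nat _ _ _ (3 * m) (2 * m)) ?leq_mul //=.
rewrite (@big_cat_nat _ _ _ (4 * m) (3 * m)) ?leq_mul //=.
rewrite (@big_cat_nat _ _ _ (5 * m) (4 * m)) ?leq_mul //=.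
rewrite (@big_cat_nat _ _ _ (6 * m) (5 * m)) ?leq_mul //=.
have one (x : nat) : (x.+1 * m - x * m)%N%:R = mr by rewrite -mulnBl subSnn mul1n.
rewrite !one in P2 P3 P4 P5 P6.
have P1' := le_trans P1 (_ : _ <= 2 * mr * C).
have {}P1' : `|\sum_(1 <= k < 2 * m) ring_term k.+1 - mr ^+ 2 * (piece h 6 0 0 2 - piece h 6 0 0 (1 / mr))| <= 2 * mr * C.
  by apply: P1'; rewrite ler_wpM2r // -natrM ler_nat leq_subr.
move: P1' P2 P3 P4 P5 P6; rewrite /piece_total -[2 * mr * _]mulrA -[7 * mr * _]mulrA.
move: (mr * C) => D; move: (mr ^+ 2) => q.
move: (\sum_(1 <= k < _) _) (\sum_(2 * m <= k < _) _) (\sum_(3 * m <= k < _) _) (\sum_(4 * m <= k < _) _) (\sum_(5 * m <= k < _) _) (\sum_(6 * m <= k < _) _) => S1 S2 S3 S4 S5 S6.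
move: (piece h 6 0 0 0) (piece h 6 0 0 (1 / mr)) (piece h 6 0 0 2) => x1 x2 x3.
move: (piece h 5 2 (24 / 5) 3 - piece h 5 2 (24 / 5) 2) (piece h 4 5 (77 / 4) 4 - piece h 4 5 (77 / 4) 3) (piece h 3 9 56 5 - piece h 3 9 56 4) (piece h 2 14 152 6 - piece h 2 14 152 5) (piece h 1 20 490 7 - piece h 1 20 490 6) => x4 x5 x6 x7 x8.
move=> Q1 Q2 Q3 Q4 Q5 Q6.
have -> : S1 + (S2 + (S3 + (S4 + (S5 + S6)))) - q * (x3 - x1 + x4 + x5 + x6 + x7 + x8 - (x2 - x1)) =
  (S1 - q * (x3 - x2)) + (S2 - q * x4) + (S3 - q * x5) + (S4 - q * x6) + (S5 - q * x7) + (S6 - q * x8) by ring.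
have -> : 7 * D = 2 * D + D + D + D + D + D by ring.
by do 5 (apply: le_trans (ler_normD _ _) _; apply: lerD => //).
Qed.


(** A crude bound within the error budget of the whole sum, so that single rings can be set apart:
    the first one, and the equator, which the reflection counts twice. *)
Lemma ring_term_bound j : (1 <= j <= M)%N -> `|ring_term j| <= 11 * B ^+ 3 * mr * (1 + ln mr).
Proof.
move=> hj; have B1 := error_ge1; have m1 := dm_ge1.
have /andP[u1 _] := @useq_bounds R N N241 _ hj.
have un := @useq_le R N N241 _ hj.
have rb : (1 <= r j <= 724 * j)%N.
  have := @dr_bounds R N N241 _ hj; have := @slin_bounds R N N241 _ hj; clear -hj; lia.
have jm : (j <= 7 * m)%N by case/andP: hj.
have l0 : 0 <= ln mr by exact: ln_ge0.
have B0 : 0 < B by exact: lt_le_trans B1.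
have m0 : 0 < mr by exact: lt_le_trans m1.
have B724 : (724%N%:R : R) <= B by apply: le_trans hB; rewrite ler_nat.
have B7 : 7 * 724%N%:R <= 3 * B.
  apply: le_trans (_ : 3 * 2155%N%:R <= _); first by rewrite -!natrM ler_nat.
  by rewrite ler_wpM2l.
have j1 : 1 <= j%:R :> R by rewrite ler1n; case/andP: hj.
have r1 : 1 <= (r j)%:R :> R by rewrite ler1n; case/andP: rb.
have rj : (r j)%:R <= B * j%:R.
  apply: le_trans (_ : (724 * j)%N%:R <= _); first by rewrite ler_nat; case/andP: rb.
  by rewrite natrM ler_wpM2r.
have jm' : j%:R <= 7 * mr by rewrite -natrM ler_nat.
have rm : (r j)%:R <= 3 * B * mr.
  apply: le_trans (_ : (724 * j)%N%:R <= _); first by rewrite ler_nat; case/andP: rb.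
  rewrite natrM; apply: le_trans (_ : 724%N%:R * (7 * mr) <= _).
    by apply: ler_wpM2l; [exact: ler0n|exact: jm'].
  by rewrite mulrA [_ * 7]mulrC ler_wpM2r // ltW.
have uj : j%:R ^+ 2 <= (u j)%:R :> R.
  by rewrite -natrX ler_nat; apply: leq_trans u1; rewrite leq_pmull.
have vj : j%:R ^+ 2 <= 2 * n - (u j)%:R.
  apply: le_trans uj _; rewrite lerBrDr -mulr2n -[X in X <= _]mulr_natl ler_wpM2l // ler_nat //.
have j2 : 0 < j%:R ^+ 2 :> R by rewrite exprn_gt0 // (lt_le_trans _ j1).
have r0 : 0 <= (r j)%:R :> R by exact: ler0n.
rewrite /ring_term; move: (r j)%:R (u j)%:R (2 * n - (u j)%:R) r0 r1 rj rm uj vj => x U V x0 x1 xj xm uj vj.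
have cube W : j%:R ^+ 2 <= W -> 0 <= x ^+ 3 / W <= 7 * B ^+ 3 * mr.
  move=> hW; have W0 : 0 < W by exact: lt_le_trans hW.
  rewrite divr_ge0 ?exprn_ge0 ?(ltW W0) //= ler_pdivrMr //.
  apply: le_trans (_ : (B * j%:R) ^+ 3 <= _); first by apply: lerXn2r => //; rewrite nnegrE // mulr_ge0 // ltW.
  have -> : (B * j%:R) ^+ 3 = B ^+ 3 * (j%:R * j%:R ^+ 2) by ring.
  have -> : 7 * B ^+ 3 * mr * W = B ^+ 3 * (7 * mr * W) by ring.
  by rewrite ler_wpM2l ?exprn_ge0 ?(ltW B0) // ler_pM // ltW.
have /andP[c1 c2] := cube _ uj; have /andP[c3 c4] := cube _ vj.
have lx : `|ln (x / mr)| <= 3 * B + ln mr.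
  have xp : 0 < x by exact: lt_le_trans x1.
  have lo : - ln mr <= ln (x / mr) by rewrite ln_div ?posrE // lerBrDr addNr ln_ge0.
  have hi : ln (x / mr) <= 3 * B.
    apply: le_trans (_ : ln (3 * B) <= _); last by apply/ltW/ln_sublinear; rewrite mulr_gt0.
    by rewrite ler_ln ?posrE ?divr_gt0 // ?mulr_gt0 // ler_pdivrMr.
  rewrite ler_norml; apply/andP; split.
    by apply: le_trans lo; rewrite lerN2 lerDr mulr_ge0 // ltW.
  by apply: le_trans hi _; rewrite lerDl.
have t1 : `|x * ln (x / mr)| <= 9 * B ^+ 3 * mr * (1 + ln mr).
  rewrite normrM (ger0_norm x0); apply: le_trans (ler_pM x0 (normr_ge0 _) xm lx) _.
  apply: le_trans (_ : 3 * B * mr * (3 * B ^+ 2 * (1 + ln mr)) <= _).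
    apply: ler_wpM2l; first by rewrite !mulr_ge0 // ltW.
    have B2 : B <= B ^+ 2 by rewrite expr2 ler_peMl // ltW.
    have B3 : 1 <= B ^+ 2 by exact: le_trans B2.
    rewrite mulrDr mulr1; apply: lerD; first by rewrite ler_wpM2l.
    rewrite ler_peMl //; apply: (le_trans B3); rewrite ler_peMl ?ler1n //; exact: (le_trans ler01 B3).
  have -> : 3 * B * mr * (3 * B ^+ 2 * (1 + ln mr)) = 9 * B ^+ 3 * mr * (1 + ln mr) by ring.
  exact: lexx.
have t2 : B ^+ 3 * mr <= B ^+ 3 * mr * (1 + ln mr).
  by rewrite ler_peMr ?lerDl // mulr_ge0 ?exprn_ge0 // ltW.
move: t1 t2 c1 c2 c3 c4.
move: (x ^+ 3 / U) (x ^+ 3 / V) (x * ln (x / mr)) => y4 y5 y1.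
rewrite -2!mulrA -(mulrA 7) -(mulrA 11) -(mulrA 11); move: (B ^+ 3) => b.
rewrite -!mulrA; move: (b * (mr * (1 + ln mr))) (b * mr) => y2 y3.
clear; rewrite !ler_norml => /andP[? ?] *; apply/andP; split; lra.
Qed.

(** Here [b = c = 0], so the logarithm that is singular at the pole has coefficient 0. With
    [h - 6 / m ^ 2 = h (1 - y)] the other one contributes only [O(1)], because
    [h m ^ 2 y / 4 = 3 / 2]. *)
Lemma first_piece : `|mr ^+ 2 * (piece h 6 0 0 (1 / mr) - piece h 6 0 0 0)| <= 30 * (1 + ln mr).
Proof.
have m1 := dm_ge1; have m0 : 0 < mr by exact: lt_le_trans m1.
have l0 : 0 <= ln mr by exact: ln_ge0.
have h12 : 12 <= h by rewrite hE ler_nat.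
have h0 : 0 < h by exact: lt_le_trans h12.
set y := 6 / (h * mr ^+ 2).
have mm : 1 <= mr ^+ 2 by rewrite exprn_ege1.
have hy : 0 < y <= 1 / 2.
  rewrite divr_gt0 ?mulr_gt0 ?exprn_gt0 //= ler_pdivrMr ?mulr_gt0 ?exprn_gt0 //.
  have : h <= h * mr ^+ 2 by rewrite ler_peMr // ltW.
  by move: (h * mr ^+ 2) => z; lra.
have /andP[y0 y1] := hy.
have E1 : h - ((6 * (1 / mr) + 0) ^+ 2 / 6 - 0) = h * (1 - y).
  by rewrite /y; field; rewrite !gt_eqF.
have E2 : h - ((6 * 0 + 0) ^+ 2 / 6 - 0) = h by rewrite mulr0 addr0 expr0n mul0r subr0 subr0.
have y2 : 0 < 1 - y by lra.
have -> : mr ^+ 2 * (piece h 6 0 0 (1 / mr) - piece h 6 0 0 0) =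
  - 3 * ln (6 / mr) + 3 / 2 - (h * mr ^+ 2) / 4 * ln (1 - y).
  rewrite /piece E1 E2 lnM ?posrE // /xlnx_prim.
  have -> : 6 * (1 / mr) + 0 = 6 / mr by rewrite addr0 mul1r.
  rewrite !mul0r !sub0r !addr0 !mulr0 expr0n /=.
  move: (ln (6 / mr)) (ln h) (ln (1 - y)) (ln 0) => a b c d.
  by field; rewrite gt_eqF.
have ly : - (2 * y) <= ln (1 - y) <= 0.
  apply/andP; split; last by apply: ln_le0; lra.
  rewrite -[ln _]opprK lerN2 -lnV ?posrE //.
  have -> : (1 - y)^-1 = 1 + y / (1 - y) by field; rewrite gt_eqF.
  have q0 : 0 <= y / (1 - y) by rewrite divr_ge0 // ltW.
  apply: le_trans (le_ln1Dx _) _; first by lra.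
  rewrite ler_pdivrMr //; nra.
have E3 : h * mr ^+ 2 / 4 * y = 3 / 2 by rewrite /y; field; rewrite !gt_eqF.
have K0 : 0 <= h * mr ^+ 2 / 4 by rewrite !mulr_ge0 ?exprn_ge0 // ltW.
have T : - 3 <= h * mr ^+ 2 / 4 * ln (1 - y) <= 0.
  have /andP[ly1 ly2] := ly; apply/andP; split; last by rewrite mulr_ge0_le0.
  apply: le_trans (ler_wpM2l K0 ly1).
  have -> : h * mr ^+ 2 / 4 * - (2 * y) = - 2 * (h * mr ^+ 2 / 4 * y) by ring.
  by rewrite E3; lra.
have l6 : `|ln (6 / mr)| <= 6 + ln mr.
  rewrite ln_div ?posrE //; apply: le_trans (ler_normB _ _) _.
  rewrite (ger0_norm l0) lerD2r ger0_norm ?ln_ge0 ?ler1n //.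
  by apply/ltW/ln_sublinear.
move: T l6 l0; move: (h * mr ^+ 2 / 4 * ln (1 - y)) (ln (6 / mr)) (ln mr).
clear; move=> a b c /andP[? ?]; rewrite !ler_norml => /andP[? ?] ?; apply/andP; split; lra.
Qed.

Lemma ring_term_sym j : (1 <= j <= p)%N -> ring_term (2 * M - j) = ring_term j.
Proof.
move=> hj; rewrite /ring_term (dr_sym N241 hj).
have /(congr1 (fun i : nat => i%:R : R)) := @useq_sym R N N241 _ hj.
rewrite natrD natrM (dr_sym N241 hj) => e.
have -> : (1 + r j + 2 * below r (2 * M - j))%N%:R = 2 * n - (u j)%:R :> R by rewrite -e addrK.
by rewrite opprB addrCA subrr addr0 [X in _ + X / 12]addrC.
Qed.

Lemma sym_sum (F : nat -> R) (k : nat) : (1 <= k)%N ->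
  (forall j, (1 <= j <= 2 * k - 1)%N -> F (2 * k - j)%N = F j) ->
  \sum_(1 <= j < (2 * k - 1).+1) F j = 2 * \sum_(1 <= j < k.+1) F j - F k.
Proof.
move=> k1 sF; rewrite (@big_cat_nat _ _ _ k.+1) //=; last by lia.
have -> : \sum_(k.+1 <= j < (2 * k - 1).+1) F j = \sum_(1 <= j < k) F j.
  rewrite -add1n big_addn (_ : (2 * k - 1).+1 - k = k)%N; last lia.
  rewrite big_nat_rev /= [LHS]big_nat [RHS]big_nat; apply: eq_bigr => j hj.
  by rewrite -sF; [congr F; lia|lia].
rewrite [\sum_(1 <= j < k.+1) _]big_nat_recr //=; ring.
Qed.

(** By symmetry, twice the northern sum less one equator term: [60 = 2 * 30] from [first_piece],
    [33 = 3 * 11] from the first ring twice and the equator once, [70 = 2 * 35] from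
    [pieces_sum]. *)
Lemma ring_terms_sum :
  `|\sum_(1 <= j < p.+1) ring_term j - 2 * mr ^+ 2 * piece_total| <=
    (60 + 33 * B ^+ 3 + 70 * (100 * B) ^+ 4) * mr * (1 + ln mr).
Proof.
have M0 := @dM_gt0 R N N241; have m1 := dm_ge1.
have l0 : 0 <= ln mr by exact: ln_ge0.
rewrite (@sym_sum ring_term M) //; last exact: ring_term_sym.
rewrite big_nat_recl // -/(iota _ _).
have -> : \sum_(1 <= i < M) ring_term i.+1 = \sum_(1 <= k < M) ring_term k.+1 by [].
have R1 : `|ring_term 1| <= 11 * B ^+ 3 * mr * (1 + ln mr) by apply: ring_term_bound; rewrite ?leqnn ?M0.
have RM : `|ring_term M| <= 11 * B ^+ 3 * mr * (1 + ln mr) by apply: ring_term_bound; rewrite ?leqnn ?M0.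
have P := pieces_sum; have F := first_piece.
have G : 30 * (1 + ln mr) <= 30 * (mr * (1 + ln mr)).
  by rewrite ler_wpM2l // ler_peMl // addr_ge0.
move: P F R1 RM G.
have -> : 7 * mr * C = 35 * ((100 * B) ^+ 4 * (mr * (1 + ln mr))) by ring.
rewrite mulrBr; move: ((100 * B) ^+ 4) (B ^+ 3) (mr ^+ 2 * (_ - _)) => x1 x2 x5.
have -> : 11 * x2 * mr * (1 + ln mr) = 11 * (x2 * (mr * (1 + ln mr))) by ring.
have -> : (60 + 33 * x2 + 70 * x1) * mr * (1 + ln mr) = 60 * (mr * (1 + ln mr)) + 33 * (x2 * (mr * (1 + ln mr))) + 70 * (x1 * (mr * (1 + ln mr))) by ring.
have -> : 2 * mr ^+ 2 * piece_total = 2 * (mr ^+ 2 * piece_total) by rewrite mulrA.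
move: (mr * (1 + ln mr)) (mr ^+ 2 * piece_total) => x3 x4.
move: (x1 * x3) (x2 * x3) => y1 y2.
move: (\sum_(1 <= k < M) _) (ring_term 1) (ring_term M) (ln mr) => S a b l.
clear; rewrite !ler_norml => /andP[? ?] /andP[? ?] /andP[? ?] /andP[? ?] ?; apply/andP; split; lra.
Qed.

End PieceSum.

(** * Expansion of the expected energy in terms of [m] *)

Section Energy.
Context (R : realType) (N : nat) (B : R).
Hypothesis N241 : (241 <= N)%N.
Hypothesis hB : 2155%N%:R <= B.

Local Notation m := (dm R N).
Local Notation M := (dM R N).
Local Notation p := (2 * dM R N - 1)%N.
Local Notation r := (dr R N).
Local Notation u j := (1 + dr R N j + 2 * below (dr R N) j)%N.
Local Notation n := ((N - 1)%N%:R : R).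
Local Notation mr := (m%:R : R).
Local Notation G := (@xlnx_prim R).

Lemma useq_natE j : (u j)%:R = 1 + (r j)%:R + 2 * (below r j)%:R :> R.
Proof. by rewrite (natrD _ (1 + r j)) (natrD _ 1) natrM. Qed.

Lemma useq_symR j : (1 <= j <= p)%N -> (u (2 * M - j))%:R = 2 * n - (u j)%:R :> R.
Proof.
move=> hj; have /(congr1 (fun i : nat => i%:R : R)) := @useq_sym R N N241 _ hj.
by rewrite natrD natrM => /(canRL (addrK _)).
Qed.

Lemma ring_taylor_half j : (1 <= j <= M)%N ->
  forall v : R, (v = (u j)%:R \/ v = 2 * n - (u j)%:R) ->
  `|(r j)%:R * (v * ln v) - (G (v + (r j)%:R) - G (v - (r j)%:R)) / 2 + (r j)%:R ^+ 3 / (6 * v)| <= (B ^+ 2) ^+ 3.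
Proof.
move=> hj v hv.
have B1 := @error_ge1 R B hB.
have /andP[u1 _] := @useq_bounds R N N241 _ hj.
have un := @useq_le R N N241 _ hj.
have r1 : (r j <= 724 * j)%N.
  have := @dr_bounds R N N241 _ hj; have := @slin_bounds R N N241 _ hj; clear -hj; lia.
have hp : (1 <= j <= p)%N by move: hj; clear; lia.
have j1 : (j <= 1 + 2 * below r j)%N.
  clear v hv; case: j hj u1 un r1 hp => [//|[|j]] hj _ _ _ _; first by rewrite /below big_geq.
  have : (3 <= r j.+1)%N by apply: (@dr_ge3 R N N241); move: hj; clear; lia.
  have : (j.+1 <= M)%N by move: hj; clear; lia.
  rewrite below_recr // => jM.
  have := @slin_bounds R N N241 j.+1; have := @dr_bounds R N N241 j.+1; rewrite jM => /(_ isT) + /(_ isT).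
  by move: (below _ _) (r _) (slin _ _ _); clear; lia.
have e1 : (u j = (1 + 2 * below r j) + r j)%N by move: (below _ _); clear; lia.
have B724 : 724%N%:R <= B by apply: le_trans hB; rewrite ler_nat.
set q : R := (1 + 2 * below r j)%N%:R.
have jq : j%:R <= q by rewrite ler_nat.
(* [q = u - r] is at least 1 and at least [j], so [r / u] stays away from 1 even on the first ring;
   for [v = 2 n - u] the mirror ring gives the same bound. *)
have rB : (r j)%:R <= B * q.
  apply: le_trans (_ : 724%N%:R * j%:R <= _); first by rewrite -natrM ler_nat.
  by apply: ler_pM B724 jq; exact: ler0n.
have rj : (r j)%:R <= B * j%:R.
  apply: le_trans (_ : 724%N%:R * j%:R <= _); first by rewrite -natrM ler_nat.
  by apply: ler_wpM2r B724; exact: ler0n.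
have uR : (u j)%:R = q + (r j)%:R by rewrite e1 natrD.
have q0 : 1 <= q by rewrite /q natrD lerDl.
have vq : q <= v - (r j)%:R.
  case: hv => ->; first by rewrite uR addrK.
  rewrite -(useq_symR hp) useq_natE (dr_sym N241 hp) addrAC addrK.
  have -> : q = 1 + 2 * (below r j)%:R by rewrite /q natrD natrM.
  rewrite lerD2l ler_wpM2l // ler_nat.
  by apply: below_le; move: hj; clear; lia.
have v0 : 0 < v.
  have : 0 <= (r j)%:R :> R by [].
  by move: vq q0; move: (r j)%:R; clear; move=> *; lra.
have B0 : 0 <= B by exact: le_trans B1.
have B2 : B <= B ^+ 2 by rewrite expr2 ler_peMl.
have jv : j%:R ^+ 2 <= v.
  have h : j%:R ^+ 2 <= (u j)%:R :> R.
    by rewrite -natrX ler_nat; apply: leq_trans u1; rewrite leq_pmull.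
  case: hv => -> //.
  apply: le_trans h _; rewrite lerBrDr -mulr2n -[X in X <= _]mulr_natl ler_wpM2l // ler_nat //.
apply: taylor_xlnx => //.
  have : B * q <= B ^+ 2 * (v - (r j)%:R) - (v - (r j)%:R).
    rewrite -{2}[v - _]mul1r -mulrBl; apply: le_trans (_ : B * (v - (r j)%:R) <= _).
      by rewrite ler_wpM2l.
    rewrite ler_wpM2r ?(le_trans _ vq) ?(le_trans ler01) //.
    have : 2 <= B by apply: le_trans hB; rewrite ler_nat.
    by move=> h; clear -h B1; nra.
  lra.
apply: le_trans (_ : (B * j%:R) ^+ 2 <= _).
  by rewrite ler_sqr ?nnegrE ?mulr_ge0.
by rewrite exprMn ler_wpM2l // exprn_ge0.
Qed.

Definition ring_xlnx (j : nat) : R :=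
  (r j)%:R * ((u j)%:R * ln (u j)%:R + (2 * n - (u j)%:R) * ln (2 * n - (u j)%:R)).

Definition ring_jump (j : nat) : R :=
  (G ((u j)%:R + (r j)%:R) - G ((u j)%:R - (r j)%:R))
  + (G (2 * n - (u j)%:R + (r j)%:R) - G (2 * n - (u j)%:R - (r j)%:R)).

Definition ring_cubes (j : nat) : R :=
  (r j)%:R ^+ 3 / (u j)%:R + (r j)%:R ^+ 3 / (2 * n - (u j)%:R).

Lemma ring_taylor j : (1 <= j <= p)%N ->
  `|ring_xlnx j - ring_jump j / 2 + ring_cubes j / 6| <= 2 * (B ^+ 2) ^+ 3.
Proof.
move=> hj; wlog jM : j hj / (j <= M)%N => [wl|].
  have [jM|jM] := leqP j M; first exact: wl.
  have hj' : (1 <= 2 * M - j <= p)%N by move: hj jM; clear; lia.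
  have := wl (2 * M - j)%N hj'; rewrite /ring_xlnx /ring_jump /ring_cubes.
  rewrite (dr_sym N241 hj) -(dr_sym N241 hj) (useq_symR hj) (dr_sym N241 hj) subKr.
  rewrite [_ ^+ 3 / (u j)%:R + _]addrC [(u j)%:R * _ + _]addrC [G ((u j)%:R + _) - _ + _]addrC.
  by apply; move: jM hj; clear; lia.
have hM : (1 <= j <= M)%N by case/andP: hj => ->.
have T := ring_taylor_half hM.
have := lerD (T _ (or_introl erefl)) (T _ (or_intror erefl)).
have -> : (B ^+ 2) ^+ 3 + (B ^+ 2) ^+ 3 = 2 * (B ^+ 2) ^+ 3 by ring.
apply: le_trans; apply: le_trans (ler_normD _ _); rewrite le_eqVlt; apply/orP; left; apply/eqP; congr `|_|.
rewrite /ring_xlnx /ring_jump /ring_cubes !invfM.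
move: (G _) (G _) (G _) (G _) => a b c d.
move: (ln _) (ln _) => e f.
move: ((u j)%:R) (2 * n - (u j)%:R) => x y.
move: (x^-1) (y^-1) => x' y'.
by field.
Qed.

Lemma ring_jumps_sum : \sum_(1 <= j < p.+1) ring_jump j = 2 * (G (2 * n - 1) + 1 / 4).
Proof.
have M0 := @dM_gt0 R N N241.
pose Q k : R := 1 + 2 * (below r k.+1)%:R.
have -> : \sum_(1 <= j < p.+1) ring_jump j = \sum_(0 <= i < p) ((G (Q i.+1) - G (2 * n - Q i.+1)) - (G (Q i) - G (2 * n - Q i))).
  rewrite big_add1; apply: eq_bigr => i _; rewrite /ring_jump /Q.
  have -> : (u i.+1)%:R + (r i.+1)%:R = 1 + 2 * (below r i.+2)%:R :> R.
    by rewrite (below_recr r (ltn0Sn i)) (natrD _ (below r i.+1)) useq_natE; ring.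
  have -> : (u i.+1)%:R - (r i.+1)%:R = 1 + 2 * (below r i.+1)%:R :> R.
    by rewrite useq_natE; ring.
  have -> : 2 * n - (u i.+1)%:R + (r i.+1)%:R = 2 * n - (1 + 2 * (below r i.+1)%:R).
    by rewrite useq_natE; ring.
  have -> : 2 * n - (u i.+1)%:R - (r i.+1)%:R = 2 * n - (1 + 2 * (below r i.+2)%:R).
    by rewrite (below_recr r (ltn0Sn i)) (natrD _ (below r i.+1)) useq_natE; ring.
  move: (G _) (G _) (G _) (G _) => *; ring.
rewrite (telescope_sumr (fun i => G (Q i) - G (2 * n - Q i))) //.
have -> : Q p = 2 * n - 1.
  rewrite /Q below_total // (_ : N - 1 = (N - 2).+1)%N; last by move: N241; clear; lia.
  by rewrite -natr1; ring.
have -> : Q 0 = 1 by rewrite /Q /below big_geq // mulr0 addr0.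
have -> : 2 * n - (2 * n - 1) = 1 by ring.
(* Only the outer edges 1 and [2 n - 1] survive the telescoping, each occurring twice by
   symmetry. *)
have -> : G 1 = - (1 / 4) by rewrite /xlnx_prim ln1 mulr0 expr1n sub0r.
by ring.
Qed.

(** The coefficient [1 / 12] in [ring_term] is the Taylor term [1 / 6] times the factor [1 / 2] of
    [mean_energyE]. The Taylor errors of at most [14 m] rings make up the last summand of the
    constant. *)
Lemma mean_energy_expansion (L := ln mr) :
  `|@mean_energy R r p - (- 2 * n * ln 2 + n * (n - 1) * ln n - G (2 * n - 1) / 2 - 1 / 8
      - (N - 2)%N%:R * L + 2 * mr ^+ 2 * piece_total 478)|
  <= (60 + 33 * B ^+ 3 + 70 * (100 * B) ^+ 4 + 14 * (B ^+ 2) ^+ 3) * mr * (1 + L).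
Proof.
have M0 := @dM_gt0 R N N241; have m1 := @dm_ge1 R N N241.
have p0 : (0 < p)%N by move: M0; clear; lia.
have L0 : 0 <= L by exact: ln_ge0.
rewrite mean_energyE //; last exact: (@dr_ge3 R N N241).
rewrite (rn_dr R N241).
have io (F : nat -> R) : \sum_(j <- iota 1 p) F j = \sum_(1 <= j < p.+1) F j.
  by rewrite /index_iota subSS subn0.
rewrite !io.
pose E : R := \sum_(1 <= j < p.+1) (ring_xlnx j - ring_jump j / 2 + ring_cubes j / 6).
have hE : `|E| <= 14 * mr * (2 * (B ^+ 2) ^+ 3).
  apply: le_trans (ler_norm_sum _ _ _) _.
  apply: le_trans (_ : \sum_(1 <= j < p.+1) (2 * (B ^+ 2) ^+ 3) <= _).
    by rewrite !big_nat; apply: ler_sum => j hj; apply: ring_taylor.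
  rewrite sumr_const_nat -[_ *+ _]mulr_natl; apply: ler_wpM2r.
    by rewrite mulr_ge0 // !exprn_ge0 //; have := @error_ge1 R B hB; lra.
  by rewrite -natrM ler_nat /dM; clear; lia.
have X := @ring_terms_sum R N B 478 N241 hB erefl.
have lnr j : (1 <= j <= p)%N -> (r j)%:R * ln (r j)%:R = (r j)%:R * ln ((r j)%:R / mr) + (r j)%:R * L.
  move=> hj; rewrite ln_div ?posrE ?ltr0n; [by rewrite /L; ring| |].
    by apply: leq_trans (@dr_ge3 R N N241 _ hj).
  by rewrite -(ltr0n R); lra.
have sr : \sum_(1 <= j < p.+1) (r j)%:R * L = (N - 2)%N%:R * L.
  by rewrite -mulr_suml -natr_sum -/(below r p.+1) below_total.
have -> : \sum_(1 <= j < p.+1) (r j)%:R * ln (r j)%:R =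
  \sum_(1 <= j < p.+1) (r j)%:R * ln ((r j)%:R / mr) + (N - 2)%N%:R * L.
  by rewrite -sr -big_split; apply: eq_big_nat => j hj; exact: lnr.
have -> : \sum_(1 <= j < p.+1) (r j)%:R * (@useq R r j * ln (@useq R r j) + (2 * n - @useq R r j) * ln (2 * n - @useq R r j))
   = E + (G (2 * n - 1) + 1 / 4) - \sum_(1 <= j < p.+1) ring_cubes j / 6.
  have -> : G (2 * n - 1) + 1 / 4 = \sum_(1 <= j < p.+1) ring_jump j / 2.
    by rewrite -mulr_suml ring_jumps_sum; field.
  rewrite /E -big_split -sumrB; apply: eq_bigr => j _ /=; rewrite /ring_xlnx /useq.
  move: (_ * (_ + _)) (ring_jump j) (ring_cubes j) => *; ring.
have XE : \sum_(1 <= j < p.+1) ring_term R N j = - \sum_(1 <= j < p.+1) (r j)%:R * ln ((r j)%:R / mr)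
   + (\sum_(1 <= j < p.+1) ring_cubes j / 6) / 2.
  rewrite -sumrN mulr_suml -big_split; apply: eq_bigr => j _ /=; rewrite /ring_term -/(ring_cubes j).
  by move: (_ * ln _) (ring_cubes j) => x y; field.
rewrite XE in X.
move: hE X; have -> : 14 * mr * (2 * (B ^+ 2) ^+ 3) = 28 * ((B ^+ 2) ^+ 3 * mr) by ring.
have : (B ^+ 2) ^+ 3 * mr <= (B ^+ 2) ^+ 3 * (mr * (1 + L)).
  rewrite ler_wpM2l ?exprn_ge0 //; first by have := @error_ge1 R B hB; lra.
  by rewrite ler_peMr ?lerDl //; lra.
rewrite -/L; move: ((B ^+ 2) ^+ 3) (B ^+ 3) ((100 * B) ^+ 4) => b6 b3 b4.
have -> : (60 + 33 * b3 + 70 * b4) * mr * (1 + L) = 60 * (mr * (1 + L)) + 33 * (b3 * (mr * (1 + L))) + 70 * (b4 * (mr * (1 + L))) by ring.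
have -> : (60 + 33 * b3 + 70 * b4 + 14 * b6) * mr * (1 + L) = 60 * (mr * (1 + L)) + 33 * (b3 * (mr * (1 + L))) + 70 * (b4 * (mr * (1 + L))) + 14 * (b6 * (mr * (1 + L))) by ring.
clearbody E; move: (b6 * (mr * (1 + L))) (b3 * (mr * (1 + L))) (b4 * (mr * (1 + L))) => x2 x3 x4.
move: (b6 * mr) (mr * (1 + L)) => x1 x5.
move: (2 * mr ^+ 2 * piece_total 478) ((N - 2)%N%:R * L) => y1 y2.
move: (\sum_(1 <= j < p.+1) ring_cubes j / 6) (\sum_(1 <= j < p.+1) (r j)%:R * ln _) => y3 y4.
move: (G (2 * n - 1)) (n * (n - 1) * ln n) (- 2 * n * ln 2) => g z1 z2.
clear; rewrite !ler_norml => ? /andP[? ?] /andP[? ?]; apply/andP; split; lra.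
Qed.

End Energy.

(** * Closed form of the constant *)

Section Constant.
Context {R : realType}.

Lemma pieceE (h a b c x s q v : R) : a * x + b = s -> s ^+ 2 / a - c = q -> h - q = v ->
  piece h a b c x = - (s ^+ 2 / 2 * ln s - s ^+ 2 / 4) / a + a / 24 * (c * ln q - (h + c) * ln v).
Proof. by rewrite /piece /xlnx_prim => -> -> ->. Qed.

Lemma lnMn (a b : nat) : (0 < a)%N -> (0 < b)%N -> ln ((a * b)%N%:R : R) = ln a%:R + ln b%:R.
Proof. by move=> a0 b0; rewrite natrM lnM ?posrE ?ltr0n. Qed.

Lemma c_diamond_piece : c_diamond = ln 2 - 1 + ln 239 / 2 + 2 / 239 * piece_total 478 :> R.
Proof.
rewrite /piece_total.
rewrite (@pieceE 478 6 0 0 2 12 24 454); [|by field..].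
rewrite (@pieceE 478 6 0 0 0 0 0 478); [|by field..].
rewrite (@pieceE 478 5 2 (24 / 5) 3 17 53 425); [|by field..].
rewrite (@pieceE 478 5 2 (24 / 5) 2 12 24 454); [|by field..].
rewrite (@pieceE 478 4 5 (77 / 4) 4 21 91 387); [|by field..].
rewrite (@pieceE 478 4 5 (77 / 4) 3 17 53 425); [|by field..].
rewrite (@pieceE 478 3 9 56 5 24 136 342); [|by field..].
rewrite (@pieceE 478 3 9 56 4 21 91 387); [|by field..].
rewrite (@pieceE 478 2 14 152 6 26 186 292); [|by field..].
rewrite (@pieceE 478 2 14 152 5 24 136 342); [|by field..].
rewrite (@pieceE 478 1 20 490 7 27 239 239); [|by field..].
rewrite (@pieceE 478 1 20 490 6 26 186 292); [|by field..].
have l4 : ln (4%:R : R) = ln 2%:R + ln 2%:R by rewrite -(@lnMn 2 2).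
have l9 : ln (9%:R : R) = ln 3%:R + ln 3%:R by rewrite -(@lnMn 3 3).
have l12 : ln (12%:R : R) = ln 4%:R + ln 3%:R by rewrite -(@lnMn 4 3).
have l8 : ln (8%:R : R) = ln 4%:R + ln 2%:R by rewrite -(@lnMn 4 2).
have l24 : ln (24%:R : R) = ln 8%:R + ln 3%:R by rewrite -(@lnMn 8 3).
have l21 : ln (21%:R : R) = ln 3%:R + ln 7%:R by rewrite -(@lnMn 3 7).
have l26 : ln (26%:R : R) = ln 2%:R + ln 13%:R by rewrite -(@lnMn 2 13).
have l27 : ln (27%:R : R) = ln 9%:R + ln 3%:R by rewrite -(@lnMn 9 3).
have l91 : ln (91%:R : R) = ln 7%:R + ln 13%:R by rewrite -(@lnMn 7 13).
have l136 : ln (136%:R : R) = ln 8%:R + ln 17%:R by rewrite -(@lnMn 8 17).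
have l6 : ln (6%:R : R) = ln 2%:R + ln 3%:R by rewrite -(@lnMn 2 3).
have l186 : ln (186%:R : R) = ln 6%:R + ln 31%:R by rewrite -(@lnMn 6 31).
have l478 : ln (478%:R : R) = ln 2%:R + ln 239%:R by rewrite -(@lnMn 2 239).
have l454 : ln (454%:R : R) = ln 2%:R + ln 227%:R by rewrite -(@lnMn 2 227).
have l25 : ln (25%:R : R) = ln 5%:R + ln 5%:R by rewrite -(@lnMn 5 5).
have l425 : ln (425%:R : R) = ln 25%:R + ln 17%:R by rewrite -(@lnMn 25 17).
have l387 : ln (387%:R : R) = ln 9%:R + ln 43%:R by rewrite -(@lnMn 9 43).
have l18 : ln (18%:R : R) = ln 9%:R + ln 2%:R by rewrite -(@lnMn 9 2).
have l342 : ln (342%:R : R) = ln 18%:R + ln 19%:R by rewrite -(@lnMn 18 19).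
have l292 : ln (292%:R : R) = ln 4%:R + ln 73%:R by rewrite -(@lnMn 4 73).
rewrite l478 l454 l425 l387 l342 l292 l186 l136 l91 l27 l26 l21 l24 l12 l25 l18 l8 l6 l4 l9 /c_diamond.
(* [ln 0] arises at the pole, only with coefficient 0. *)
rewrite [ln 0]ln0 //.
move: (ln 2) (ln 3) (ln 5) (ln 7) (ln 13) (ln 17) (ln 19) (ln 31) (ln 43) (ln 53) (ln 73) (ln 227) (ln 239).
move=> *; by field.
Qed.

End Constant.

(** * Asymptotics in terms of [N] *)

Section Asymptotics.
Context {R : realType}.
Local Notation G := (@xlnx_prim R).

(** With [n = N - 1] and [y = 1 / (2 n)], split [ln (2 n - 1) = ln 2 + ln n + ln (1 - y)]. The
    second-order remainder [w <= 2 y ^ 2] is multiplied by [(n - 1 / 2) ^ 2], so it contributes at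
    most [1 / 2]. *)
Lemma leading_part (n : R) : 1 <= n ->
  `|- 2 * n * ln 2 + n * (n - 1) * ln n - G (2 * n - 1) / 2 - 1 / 8
    - (Wlog * (n + 1) ^+ 2 + (n + 1) * (ln 2 - 1))| <= 1 + ln n.
Proof.
move=> n1; have n0 : 0 < n by lra.
set y := (2 * n)^-1.
have y0 : 0 < y by rewrite invr_gt0; lra.
have yn : y * (2 * n) = 1 by rewrite mulVf // gt_eqF //; lra.
have y1 : y <= 1 / 2 by nra.
have ln2n : ln (2 * n - 1) = ln 2 + ln n + ln (1 - y).
  rewrite -!lnM ?posrE ?mulr_gt0 //; [|lra..].
  by congr ln; rewrite /y; field; rewrite gt_eqF.
set w := - y - ln (1 - y).
have w0 : 0 <= w.
  have : ln (1 - y) <= - y by apply: le_ln1Dx; lra.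
  by rewrite /w; lra.
have w1 : w <= 2 * y ^+ 2.
  have : ln (1 - y)^-1 <= y / (1 - y).
    have e : (1 - y)^-1 = 1 + y / (1 - y) by field; rewrite gt_eqF //; lra.
    rewrite [X in ln X]e; apply: le_ln1Dx; apply: lt_le_trans (_ : 0 <= _); first lra.
    by rewrite divr_ge0 //; lra.
  rewrite lnV ?posrE; last lra.
  have : y / (1 - y) <= y + 2 * y ^+ 2.
    by rewrite ler_pdivrMr; [nra|lra].
  by rewrite /w; lra.
have lw : ln (1 - y) = - y - w by rewrite /w; ring.
have l2 : 0 <= @ln R 2 <= 2.
  by rewrite ln_ge0 ?ler1n //=; apply/ltW/ln_sublinear.
have l0 : 0 <= ln n by exact: ln_ge0.
have -> : - 2 * n * ln 2 + n * (n - 1) * ln n - G (2 * n - 1) / 2 - 1 / 8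
    - (Wlog * (n + 1) ^+ 2 + (n + 1) * (ln 2 - 1)) =
    - (ln 2 + ln n) / 4 + y / 4 + (n ^+ 2 - n + 1 / 4) * w.
  rewrite /xlnx_prim ln2n lw /Wlog; move: (ln n) (ln 2) => a b.
  have -> : n = (2 * y)^-1 by rewrite /y invfM; field; rewrite gt_eqF.
  by field; rewrite gt_eqF.
have nw : 0 <= (n ^+ 2 - n + 1 / 4) * w <= 1 / 2.
  have -> : n ^+ 2 - n + 1 / 4 = (n - 1 / 2) ^+ 2 by field.
  rewrite mulr_ge0 ?sqr_ge0 //=.
  apply: le_trans (_ : n ^+ 2 * (2 * y ^+ 2) <= _).
    apply: ler_pM => //; first exact: sqr_ge0.
    by rewrite ler_sqr ?nnegrE; lra.
  have -> : n ^+ 2 * (2 * y ^+ 2) = (y * (2 * n)) ^+ 2 / 2 by field.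
  by rewrite yn expr1n.
move: nw l2 l0; move: ((n ^+ 2 - n + 1 / 4) * w) (ln 2) (ln n) => a b c /andP[? ?] /andP[? ?] ?.
by rewrite ler_norml; apply/andP; split; lra.
Qed.

(** [t] is the relative excess of [N] over [H m ^ 2], of order [1 / m], and
    [ln N = ln H + 2 ln m + ln (1 + t)]. Replacing [ln m] by half of [ln N - ln H] and [m ^ 2] by
    [N / H] therefore costs [O(m)]. *)
Lemma log_part (B H P m n : R) : 1 <= H -> H <= B -> 1 <= m -> H * m ^+ 2 <= n <= H * m ^+ 2 + B * m ->
  `|- (n - 1) * ln m + 2 * m ^+ 2 * P
     - (- 1 / 2 * (n + 1) * ln (n + 1) + (n + 1) * (ln H / 2 + 2 / H * P))| <=
  2 * ln m + (4 * B ^+ 2 + 4 * B * `|P|) * m.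
Proof.
move=> H1 HB m1 /andP[n1 n2].
have H0 : 0 < H by exact: lt_le_trans H1.
have m0 : 0 < m by exact: lt_le_trans m1.
have B1 : 1 <= B by exact: le_trans HB.
have mm : 0 < m ^+ 2 by rewrite exprn_gt0.
have Hm : 0 < H * m ^+ 2 by rewrite mulr_gt0.
have Bm : 1 <= B * m by exact: mulr_ege1.
set t := (n + 1) / (H * m ^+ 2) - 1.
have tE : t * (H * m ^+ 2) = n + 1 - H * m ^+ 2 by rewrite mulrBl divfK ?mul1r // gt_eqF.
have t0 : 0 <= t by rewrite -(pmulr_lge0 _ Hm) tE; lra.
have t1 : t * (H * m ^+ 2) <= 2 * (B * m) by rewrite tE; lra.
have lE : ln (n + 1) = ln H + 2 * ln m + ln (1 + t).
  have -> : 2 * ln m = ln (m ^+ 2) by rewrite lnXn // mulr_natl.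
  rewrite -!lnM ?posrE //; last lra.
  by congr ln; rewrite mulrDr mulr1 [_ * t]mulrC tE; ring.
set l := ln (1 + t).
have l0 : 0 <= l by rewrite ln_ge0 // lerDl.
have l1 : l <= t by apply: le_ln1Dx; lra.
have lm : 0 <= ln m by exact: ln_ge0.
have -> : - (n - 1) * ln m + 2 * m ^+ 2 * P
     - (- 1 / 2 * (n + 1) * ln (n + 1) + (n + 1) * (ln H / 2 + 2 / H * P)) =
  2 * ln m + (n + 1) / 2 * l - 2 / H * P * (n + 1 - H * m ^+ 2).
  by rewrite lE -/l; field; rewrite gt_eqF.
have e1 : 0 <= (n + 1) / 2 * l <= 4 * B ^+ 2 * m.
  rewrite mulr_ge0 //=; last by lra.
  apply: le_trans (_ : (n + 1) / 2 * t <= _); first by rewrite ler_wpM2l //; lra.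
  have nn : n + 1 <= (H * m ^+ 2) * (3 * B).
    have : B * m <= H * m ^+ 2 * B.
      have -> : H * m ^+ 2 * B = B * (m * (H * m)) by ring.
      rewrite ler_wpM2l //; first lra.
      by rewrite ler_peMr; [|lra|nra].
    have : H * m ^+ 2 <= H * m ^+ 2 * B by rewrite ler_peMr // ltW.
    move: (H * m ^+ 2 * B) (H * m ^+ 2) (B * m) n2 Bm => *; lra.
  apply: le_trans (_ : (H * m ^+ 2) * (3 * B) / 2 * t <= _).
    by rewrite ler_wpM2r // ler_pM2r.
  have -> : (H * m ^+ 2) * (3 * B) / 2 * t = 3 / 2 * B * (t * (H * m ^+ 2)) by field.
  apply: le_trans (_ : 3 / 2 * B * (2 * (B * m)) <= _); first by rewrite ler_wpM2l //; lra.
  have -> : 3 / 2 * B * (2 * (B * m)) = 3 * (B ^+ 2 * m) by field.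
  have : 0 <= B ^+ 2 * m by rewrite mulr_ge0 ?sqr_ge0 // ltW.
  rewrite -mulrA; move: (B ^+ 2 * m) => z; lra.
have e2 : `|2 / H * P * (n + 1 - H * m ^+ 2)| <= 4 * B * `|P| * m.
  have n0 : 0 <= n + 1 - H * m ^+ 2 by rewrite -tE mulr_ge0 // ltW.
  have h0 : 0 <= 2 / H by rewrite divr_ge0 // ltW.
  rewrite normrM (ger0_norm n0) (normrM (2 / H)) (ger0_norm h0).
  apply: le_trans (_ : 2 * `|P| * (2 * (B * m)) <= _); last first.
    have -> : 2 * `|P| * (2 * (B * m)) = 4 * B * `|P| * m by ring.
    exact: lexx.
  apply: ler_pM; [exact: mulr_ge0 h0 (normr_ge0 P)|exact: n0| |by rewrite -tE].
  by rewrite ler_wpM2r // ler_pdivrMr // ler_peMr.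
apply: le_trans (ler_normB _ _) _; rewrite [_ * m]mulrDl addrA; apply: lerD => //.
have /andP[a b] := e1; rewrite ger0_norm; last by rewrite addr_ge0 // mulr_ge0.
by rewrite lerD2l.
Qed.


Lemma energy_asymptotics (B : R) : 2155%N%:R <= B -> exists C : R, forall N : nat, (241 <= N)%N ->
  `|mean_energy (dr R N) (2 * dM R N - 1)
     - (Wlog * N%:R ^+ 2 - 1 / 2 * N%:R * ln N%:R + c_diamond * N%:R)| <= C * (Num.sqrt N%:R * ln N%:R).
Proof.
move=> hB; pose P : R := piece_total 478.
exists (2 * (60 + 33 * B ^+ 3 + 70 * (100 * B) ^+ 4 + 14 * (B ^+ 2) ^+ 3 + 4 * B ^+ 2 + 4 * B * `|P| + 2) + 2).
move=> N N241; have B1 := @error_ge1 R B hB; have m1 := @dm_ge1 R N N241.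
have E1 := @mean_energy_expansion R N B N241 hB; rewrite -/P in E1.
set m : R := (dm R N)%:R in E1 m1; set n : R := (N - 1)%N%:R in E1 *.
have nN : N%:R = n + 1 by rewrite natr1 subn1 prednK // (leq_trans _ N241).
have n2 : (N - 2)%N%:R = n - 1.
  rewrite /n (_ : N - 1 = (N - 2).+1)%N; last by move: N241; clear; lia.
  by rewrite -[in RHS]natr1 addrK.
have n1 : 1 <= n by rewrite /n ler1n; move: N241; clear; lia.
have E2 := leading_part n1.
have H1 : 1 <= 239%N%:R :> R by rewrite ler1n.
have HB : 239%N%:R <= B by apply: le_trans hB; rewrite ler_nat.
have E3 := @log_part B 239%N%:R P m n H1 HB m1 (@n_bounds R N B N241 hB).
have cE := @c_diamond_piece R; rewrite -/P in cE.
have [s0 _ _] := @sqrtN_bounds R N N241.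
have lm0 : 0 <= ln m by exact: ln_ge0.
have msq : m <= Num.sqrt N%:R.
  rewrite -[m]ger0_norm ?(le_trans ler01 m1) // -sqrtr_sqr ler_sqrt // -natrX ler_nat.
  have [_ /andP[h _]] := @dm_bounds R N N241; apply: leq_trans h; clear; lia.
have sN : Num.sqrt N%:R <= N%:R :> R.
  rewrite -[X in _ <= X]ger0_norm // -[X in _ <= X]sqrtr_sqr ler_sqrt // -natrX ler_nat.
  by rewrite expnS expn1 leq_pmull //; move: N241; clear; lia.
(* [ln N >= ln 4 >= 1], which lets bare multiples of [m] be absorbed into [sqrt N ln N]. *)
have lN : 1 <= ln N%:R :> R.
  have l2 : 1 / 2 <= ln 2 :> R.
    have := @le_ln1Dx R (- (1 / 2)); have -> : 1 + - (1 / 2) = 2^-1 :> R by field.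
    by rewrite lnV ?posrE // => h; rewrite -lerN2; apply: h; clear; lra.
  apply: le_trans (_ : ln (2 * 2) <= _); first by rewrite lnM ?posrE // [leLHS]splitr; exact: lerD.
  by rewrite ler_ln ?posrE // ?ltr0n ?mulr_gt0 // -?natrM ?ler_nat; move: N241; clear; lia.
have lmN : ln m <= ln N%:R.
  by rewrite ler_ln ?posrE ?(lt_le_trans ltr01 m1) ?(le_trans msq) // ltr0n; move: N241; clear; lia.
have lnN : ln n <= ln N%:R.
  by rewrite ler_ln ?posrE ?(lt_le_trans ltr01 n1) // ?ltr0n ?ler_nat; move: N241; clear; lia.
have s1 : 1 <= Num.sqrt N%:R :> R by apply: le_trans msq.
pose S : R := Num.sqrt N%:R * ln N%:R.
have q1 : m * (1 + ln m) <= 2 * S.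
  have -> : 2 * S = Num.sqrt N%:R * (ln N%:R + ln N%:R) by rewrite /S; ring.
  exact: (ler_pM (le_trans ler01 m1) (addr_ge0 ler01 lm0) msq (lerD lN lmN)).
have q2 : ln N%:R <= S by rewrite ler_peMl // (le_trans ler01 lN).
have q3 : m <= S by apply: le_trans msq _; rewrite ler_peMr // ltW.
rewrite -/S; move: E1 E2 E3; rewrite n2 nN cE /=.
pose D1 : R := 60 + 33 * B ^+ 3 + 70 * (100 * B) ^+ 4 + 14 * (B ^+ 2) ^+ 3.
pose D2 : R := 4 * B ^+ 2 + 4 * B * `|P|.
have B0 : 0 <= B by exact: le_trans B1.
have D10 : 0 <= D1.
  have b3 : 0 <= B ^+ 3 by exact: exprn_ge0.
  have b4 : 0 <= (100 * B) ^+ 4 by apply: exprn_ge0; exact: mulr_ge0.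
  have b6 : 0 <= (B ^+ 2) ^+ 3 by apply: exprn_ge0; exact: exprn_ge0.
  rewrite /D1; move: b3 b4 b6; move: (B ^+ 3) ((100 * B) ^+ 4) ((B ^+ 2) ^+ 3) => b3 b4 b6.
  by clear; lra.
have D20 : 0 <= D2.
  have b2 : 0 <= B ^+ 2 by exact: exprn_ge0.
  have bP : 0 <= B * `|P| by exact: mulr_ge0.
  rewrite /D2 -[4 * B * _]mulrA; move: b2 bP; move: (B ^+ 2) (B * `|P|) => b2 bP.
  by clear; lra.
have -> : (2 * (60 + 33 * B ^+ 3 + 70 * (100 * B) ^+ 4 + 14 * (B ^+ 2) ^+ 3 + 4 * B ^+ 2 + 4 * B * `|P| + 2) + 2) * S = 2 * (D1 * S) + 2 * (D2 * S) + 6 * S.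
  by rewrite /D1 /D2; ring.
rewrite -/D1 -/D2 -[D1 * m * _]mulrA.
have p1 : D1 * (m * (1 + ln m)) <= 2 * (D1 * S).
  by rewrite [2 * (D1 * S)]mulrCA; exact: ler_wpM2l.
have p2 : D2 * m <= D2 * S by exact: ler_wpM2l.
have p3 : 0 <= D2 * S by exact: mulr_ge0 D20 (le_trans ler01 (le_trans lN q2)).
have -> : (n - 1) * ln m = ln m * (n - 1) by rewrite mulrC.
move: p1 p2 p3 q2 lN lmN lnN lm0; rewrite nN.
have -> : ln 2 - 1 + ln 239 / 2 + 2 / 239 * P = (ln 2 - 1) + (ln 239 / 2 + 2 / 239 * P) by rewrite addrA.
have -> : - (n - 1) * ln m = - (ln m * (n - 1)) by rewrite mulrC mulrN.
clearbody D1 D2 S.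
rewrite [_ * (n + 1)]mulrDl.
have -> : (n + 1) * (ln 239 / 2 + 2 / 239 * P) = (ln 239 / 2 + 2 / 239 * P) * (n + 1) by rewrite mulrC.
have -> : (n + 1) * (ln 2 - 1) = (ln 2 - 1) * (n + 1) by rewrite mulrC.
have -> : - 1 / 2 * (n + 1) * ln (n + 1) = - (1 / 2 * (n + 1) * ln (n + 1)) by ring.
move: ((ln 239 / 2 + 2 / 239 * P) * (n + 1)) ((ln 2 - 1) * (n + 1)) (1 / 2 * (n + 1) * ln (n + 1)) (Wlog * (n + 1) ^+ 2) => y1 y2 y3 y4.
move: (ln m * (n - 1)) (2 * m ^+ 2 * P) (D1 * (m * (1 + ln m))) (D1 * S) (D2 * m) (D2 * S) => z1 z2 z3 z4 z5 z6.
move: (- 2 * n * ln 2) (n * (n - 1) * ln n) (G (2 * n - 1)) => g1 g2 g3.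
move: (mean_energy _ _) (ln n) (ln m) (ln (n + 1)) => me l1 l2 l3.
clear; rewrite !ler_norml => ? ? ? ? ? ? ? ? /andP[? ?] /andP[? ?] /andP[? ?]; apply/andP; split; lra.
Qed.

End Asymptotics.

(** * The numerical value of the constant *)

Section Numerics.
Context {R : realType}.

(** The error has derivative [2 y ^ 2 / (1 - y ^ 2)], at most [3 y ^ 2] for [y <= 1 / 2]. *)
Lemma ln_ratio_bounds (x : R) : 0 <= x <= 1 / 2 -> 2 * x <= ln (1 + x) - ln (1 - x) <= 2 * x + x ^+ 3.
Proof.
move=> /andP[x0 x1].
have : 0 <= ln (1 + x) - ln (1 - x) - 2 * x <= 1 * x ^+ 3.
  apply: (@pinch R (fun x => ln (1 + x) - ln (1 - x) - 2 * x) (fun x => 2 * x ^+ 2 / (1 - x ^+ 2)) 1 2) => //.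
  - by rewrite addr0 subr0 mulr0 ln1 !subr0.
  - move=> y /andP[y0 y1]; derive_by; [lra|lra|].
    by field; rewrite !gt_eqF //; nra.
  - move=> y /andP[y0 y1].
    have y2 : y ^+ 2 <= 1 / 4 by nra.
    have y3 : 0 < 1 - y ^+ 2 by lra.
    have y4 : 0 <= y ^+ 2 by rewrite sqr_ge0.
    rewrite divr_ge0 ?(ltW y3) ?mulr_ge0 //= ler_pdivrMr // mulr1.
    by move: (y ^+ 2) y2 y4 => z z1 z0; nra.
by rewrite mul1r; lra.
Qed.

Definition prime_prod (s : seq (nat * nat)) : nat := foldr (fun x k => x.1 ^ x.2 * k)%N 1%N s.
Definition prime_ln (s : seq (nat * nat)) : R := foldr (fun x t => x.2%:R * ln x.1%:R + t) 0 s.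

Lemma prime_lnE s : all (fun x => 0 < x.1)%N s -> ln (prime_prod s)%:R = prime_ln s.
Proof.
elim: s => [_|[q e] s ih] /=; first by rewrite ln1.
move=> /andP[q0 s0]; have h : (0 < prime_prod s)%N.
  by elim: s s0 {ih} => //= -[q' e'] s ih /andP[q'0 /ih]; rewrite /= muln_gt0 expn_gt0 q'0.
rewrite natrM lnM ?posrE ?ltr0n ?expn_gt0 ?q0 // ih // natrX lnXn ?ltr0n //.
by rewrite mulr_natl.
Qed.

(** With [x = 1 / (2 n + 1)] one has [(1 + x) / (1 - x) = (n + 1) / n]. The last two hypotheses are
    the bounds of [ln_ratio_bounds], times [k], cleared of denominators. *)
Lemma ln_step (a b : nat) (s t : seq (nat * nat)) (k lo hi : R)
    (n := (a * 100 + b)%N) (w := 2 * (a%:R * 100 + b%:R) + 1 : R) :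
  all (fun x => 0 < x.1)%N s -> all (fun x => 0 < x.1)%N t -> (0 < n)%N ->
  prime_prod s = n -> prime_prod t = n.+1 ->
  0 <= k -> lo * w <= k * 2 -> k * (2 * w ^+ 2 + 1) <= hi * w ^+ 3 ->
  lo <= k * (prime_ln t - prime_ln s) <= hi.
Proof.
move=> s0 t0 n0 sn tn k0; rewrite -!prime_lnE // sn tn.
have n1 : 1 <= n%:R :> R by rewrite ler1n.
have wE : w = 2 * n%:R + 1 by rewrite /w /n natrD natrM.
have w1 : 3 <= w by rewrite wE; lra.
have w0 : 0 < w by lra.
have x1 : w^-1 <= 1 / 2 by rewrite div1r lef_pV2 ?posrE //; lra.
have e1 : n.+1%:R = (1 + w^-1) * (w / 2) :> R.
  by rewrite -natr1; field: wE; rewrite gt_eqF.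
have e2 : n%:R = (1 - w^-1) * (w / 2) :> R.
  by field: wE; rewrite gt_eqF.
have v0 : 0 < w^-1 by rewrite invr_gt0.
have -> : ln n.+1%:R - ln n%:R = ln (1 + w^-1) - ln (1 - w^-1).
  rewrite e1 [X in _ - ln X]e2 !lnM ?posrE ?divr_gt0 //; [|lra..].
  by rewrite opprD addrACA subrr addr0.
have /andP[h3 h4] : 2 * w^-1 <= ln (1 + w^-1) - ln (1 - w^-1) <= 2 * w^-1 + w^-1 ^+ 3.
  by apply: ln_ratio_bounds; rewrite ltW.
rewrite -ler_pdivlMr // -[_ <= hi * _]ler_pdivrMr ?exprn_gt0 // => h1 h2.
rewrite (le_trans h1) /=; last by rewrite -mulrA ler_wpM2l.
apply: le_trans (ler_wpM2l k0 h4) (le_trans _ h2).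
rewrite le_eqVlt; apply/orP; left; apply/eqP.
by field; rewrite gt_eqF.
Qed.

(* The logarithms of the thirteen primes are recovered from thirteen pairs of
   consecutive integers without any other prime factor, and [ln_step] bounds
   each [ln ((n + 1) / n)] with relative precision [n^-2]. *)
Lemma c_diamond_bounds :
  - ((49 * 1000 + 223) / 1000 ^+ 2) < @c_diamond R < - ((49 * 1000 + 222) / 1000 ^+ 2).
Proof.
have /andP[a1 b1] := @ln_step 24 99 [:: (3, 1); (7, 2); (17, 1)] [:: (2, 2); (5, 4)]
  ((((6 * 100 + 45) * 100 + 28) * 100 + 13) / 2) ((((12 * 100 + 90) * 100 + 82) * 100 + 7) / 100 ^+ 2)
  ((((12 * 100 + 90) * 100 + 82) * 100 + 8) / 100 ^+ 2)
  isT isT isT erefl erefl ltac:(clear; lra) ltac:(clear; lra) ltac:(clear; lra).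
have /andP[a2 b2] := @ln_step 24 50 [:: (2, 1); (5, 2); (7, 2)] [:: (3, 1); (19, 1); (43, 1)]
  ((((4 * 100 + 48) * 100 + 89) * 100 + 9) / 2) ((((9 * 100 + 15) * 100 + 91) * 100 + 69) / 100 ^+ 2)
  ((((9 * 100 + 15) * 100 + 91) * 100 + 70) / 100 ^+ 2)
  isT isT isT erefl erefl ltac:(clear; lra) ltac:(clear; lra) ltac:(clear; lra).
have /andP[a3 b3] := @ln_step 24 0 [:: (2, 5); (3, 1); (5, 2)] [:: (7, 4)]
  ((((3 * 100 + 68) * 100 + 30) * 100 + 76)) ((((15 * 100 + 34) * 100 + 29) * 100 + 53) / 100 ^+ 2)
  ((((15 * 100 + 34) * 100 + 29) * 100 + 54) / 100 ^+ 2)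
  isT isT isT erefl erefl ltac:(clear; lra) ltac:(clear; lra) ltac:(clear; lra).
have /andP[a4 b4] := @ln_step 22 79 [:: (43, 1); (53, 1)] [:: (2, 3); (3, 1); (5, 1); (19, 1)]
  (((81 * 100 + 86) * 100 + 49) / 2) ((((1 * 100 + 79) * 100 + 56) * 100 + 76) / 100 ^+ 2)
  ((((1 * 100 + 79) * 100 + 56) * 100 + 77) / 100 ^+ 2)
  isT isT isT erefl erefl ltac:(clear; lra) ltac:(clear; lra) ltac:(clear; lra).
have /andP[a5 b5] := @ln_step 21 50 [:: (2, 1); (5, 2); (43, 1)] [:: (3, 2); (239, 1)]
  (((1 * 100 + 91) * 100 + 20)) (((8 * 100 + 89) * 100 + 9) / 100 ^+ 2)
  (((8 * 100 + 89) * 100 + 10) / 100 ^+ 2)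
  isT isT isT erefl erefl ltac:(clear; lra) ltac:(clear; lra) ltac:(clear; lra).
have /andP[a6 b6] := @ln_step 21 7 [:: (7, 2); (43, 1)] [:: (2, 2); (17, 1); (31, 1)]
  ((((2 * 100 + 26) * 100 + 61) * 100 + 94)) ((((10 * 100 + 75) * 100 + 29) * 100 + 96) / 100 ^+ 2)
  ((((10 * 100 + 75) * 100 + 29) * 100 + 97) / 100 ^+ 2)
  isT isT isT erefl erefl ltac:(clear; lra) ltac:(clear; lra) ltac:(clear; lra).
have /andP[a7 b7] := @ln_step 21 6 [:: (2, 1); (3, 4); (13, 1)] [:: (7, 2); (43, 1)]
  (((37 * 100 + 4) * 100 + 0)) ((((1 * 100 + 75) * 100 + 83) * 100 + 66) / 100 ^+ 2)
  ((((1 * 100 + 75) * 100 + 83) * 100 + 68) / 100 ^+ 2)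
  isT isT isT erefl erefl ltac:(clear; lra) ltac:(clear; lra) ltac:(clear; lra).
have /andP[a8 b8] := @ln_step 20 43 [:: (3, 2); (227, 1)] [:: (2, 2); (7, 1); (73, 1)]
  (((23 * 100 + 40) * 100 + 83)) ((((1 * 100 + 14) * 100 + 55) * 100 + 0) / 100 ^+ 2)
  ((((1 * 100 + 14) * 100 + 55) * 100 + 1) / 100 ^+ 2)
  isT isT isT erefl erefl ltac:(clear; lra) ltac:(clear; lra) ltac:(clear; lra).
have /andP[a9 b9] := @ln_step 20 15 [:: (5, 1); (13, 1); (31, 1)] [:: (2, 5); (3, 2); (7, 1)]
  ((((1 * 100 + 95) * 100 + 47) * 100 + 92)) ((((9 * 100 + 69) * 100 + 87) * 100 + 94) / 100 ^+ 2)
  ((((9 * 100 + 69) * 100 + 87) * 100 + 95) / 100 ^+ 2)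
  isT isT isT erefl erefl ltac:(clear; lra) ltac:(clear; lra) ltac:(clear; lra).
have /andP[a10 b10] := @ln_step 20 14 [:: (2, 1); (19, 1); (53, 1)] [:: (5, 1); (13, 1); (31, 1)]
  ((((1 * 100 + 29) * 100 + 18) * 100 + 85) / 2) ((((3 * 100 + 20) * 100 + 64) * 100 + 65) / 100 ^+ 2)
  ((((3 * 100 + 20) * 100 + 64) * 100 + 66) / 100 ^+ 2)
  isT isT isT erefl erefl ltac:(clear; lra) ltac:(clear; lra) ltac:(clear; lra).
have /andP[a11 b11] := @ln_step 18 24 [:: (2, 5); (3, 1); (19, 1)] [:: (5, 2); (73, 1)]
  (((23 * 100 + 26) * 100 + 23)) ((((1 * 100 + 27) * 100 + 49) * 100 + 95) / 100 ^+ 2)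
  ((((1 * 100 + 27) * 100 + 49) * 100 + 96) / 100 ^+ 2)
  isT isT isT erefl erefl ltac:(clear; lra) ltac:(clear; lra) ltac:(clear; lra).
have /andP[a12 b12] := @ln_step 17 67 [:: (3, 1); (19, 1); (31, 1)] [:: (2, 3); (13, 1); (17, 1)]
  ((((1 * 100 + 91) * 100 + 65) * 100 + 49) / 2) ((((5 * 100 + 42) * 100 + 16) * 100 + 37) / 100 ^+ 2)
  ((((5 * 100 + 42) * 100 + 16) * 100 + 39) / 100 ^+ 2)
  isT isT isT erefl erefl ltac:(clear; lra) ltac:(clear; lra) ltac:(clear; lra).
have /andP[a13 b13] := @ln_step 15 89 [:: (7, 1); (227, 1)] [:: (2, 1); (3, 1); (5, 1); (53, 1)]
  (((23 * 100 + 63) * 100 + 53)) ((((1 * 100 + 48) * 100 + 69) * 100 + 64) / 100 ^+ 2)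
  ((((1 * 100 + 48) * 100 + 69) * 100 + 65) / 100 ^+ 2)
  isT isT isT erefl erefl ltac:(clear; lra) ltac:(clear; lra) ltac:(clear; lra).
(* The multipliers solve the linear system matching the coefficients of the thirteen logarithms; the
   three negative ones are collected in the subtracted group, where the upper and lower bounds
   change roles. *)
have -> : c_diamond =
   (((((6 * 100 + 45) * 100 + 28) * 100 + 13) / 2 * (prime_ln [:: (2, 2); (5, 4)] - prime_ln [:: (3, 1); (7, 2); (17, 1)])
      + (((4 * 100 + 48) * 100 + 89) * 100 + 9) / 2 * (prime_ln [:: (3, 1); (19, 1); (43, 1)] - prime_ln [:: (2, 1); (5, 2); (7, 2)])
      + (((3 * 100 + 68) * 100 + 30) * 100 + 76) * (prime_ln [:: (7, 4)] - prime_ln [:: (2, 5); (3, 1); (5, 2)])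
      + ((1 * 100 + 91) * 100 + 20) * (prime_ln [:: (3, 2); (239, 1)] - prime_ln [:: (2, 1); (5, 2); (43, 1)]))
    + ((((2 * 100 + 26) * 100 + 61) * 100 + 94) * (prime_ln [:: (2, 2); (17, 1); (31, 1)] - prime_ln [:: (7, 2); (43, 1)])
      + (((1 * 100 + 95) * 100 + 47) * 100 + 92) * (prime_ln [:: (2, 5); (3, 2); (7, 1)] - prime_ln [:: (5, 1); (13, 1); (31, 1)])
      + (((1 * 100 + 29) * 100 + 18) * 100 + 85) / 2 * (prime_ln [:: (5, 1); (13, 1); (31, 1)] - prime_ln [:: (2, 1); (19, 1); (53, 1)]))
    + (((23 * 100 + 26) * 100 + 23) * (prime_ln [:: (5, 2); (73, 1)] - prime_ln [:: (2, 5); (3, 1); (19, 1)])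
      + (((1 * 100 + 91) * 100 + 65) * 100 + 49) / 2 * (prime_ln [:: (2, 3); (13, 1); (17, 1)] - prime_ln [:: (3, 1); (19, 1); (31, 1)])
      + ((23 * 100 + 63) * 100 + 53) * (prime_ln [:: (2, 1); (3, 1); (5, 1); (53, 1)] - prime_ln [:: (7, 1); (227, 1)]))
    - (((81 * 100 + 86) * 100 + 49) / 2 * (prime_ln [:: (2, 3); (3, 1); (5, 1); (19, 1)] - prime_ln [:: (43, 1); (53, 1)])
      + ((37 * 100 + 4) * 100 + 0) * (prime_ln [:: (7, 2); (43, 1)] - prime_ln [:: (2, 1); (3, 4); (13, 1)])
      + ((23 * 100 + 40) * 100 + 83) * (prime_ln [:: (2, 2); (7, 1); (73, 1)] - prime_ln [:: (3, 2); (227, 1)]))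
    - (7 * 1000 + 170)) / (14 * 1000 + 340) :> R.
  rewrite /c_diamond /prime_ln /=; clear.
  move: (ln 2) => l2.
  move: (ln 3) => l3.
  move: (ln 5) => l5.
  move: (ln 7) => l7.
  move: (ln 13) => l13.
  move: (ln 17) => l17.
  move: (ln 19) => l19.
  move: (ln 31) => l31.
  move: (ln 43) => l43.
  move: (ln 53) => l53.
  move: (ln 73) => l73.
  move: (ln 227) => l227.
  move: (ln 239) => l239.
  by field.
have lo := lerB (lerD (lerD (lerD (lerD (lerD a1 a2) a3) a5) (lerD (lerD a6 a9) a10)) (lerD (lerD a11 a12) a13)) (lerD (lerD b4 b7) b8).
have hi := lerB (lerD (lerD (lerD (lerD (lerD b1 b2) b3) b5) (lerD (lerD b6 b9) b10)) (lerD (lerD b11 b12) b13)) (lerD (lerD a4 a7) a8).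
clear a1 b1 a2 b2 a3 b3 a4 b4 a5 b5 a6 b6 a7 b7 a8 b8 a9 b9 a10 b10 a11 b11 a12 b12 a13 b13.
have D0 : 0 < 14 * 1000 + 340 :> R by clear; lra.
rewrite ltr_pdivlMr // ltr_pdivrMr // ltrBrDr ltrBlDr.
by apply/andP; split; [apply: lt_le_trans lo|apply: le_lt_trans hi _]; clear; lra.
Qed.

End Numerics.

(** * Conclusion *)

Section Equator.
Context {R : realType}.

(** The rational parametrisation of the circle. For small [N] any [N] distinct points will do, and
    this one is injective on the naturals because the second coordinate determines [i ^ 2]. *)
Definition equator_point (i : nat) : space3 R :=
  (2 * i%:R / (1 + i%:R ^+ 2), (1 - i%:R ^+ 2) / (1 + i%:R ^+ 2), 0).

Definition equator_set (N : nat) : {fset space3 R} :=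
  [fset x in [seq equator_point i | i <- iota 0 N]]%fset.

Lemma equator_point_inj : injective equator_point.
Proof.
move=> i j /(congr1 (fun p : space3 R => p.1.2)) /=.
have d0 k : (1 + k%:R ^+ 2 : R) != 0 by rewrite gt_eqF // ltr_pwDl // exprn_ge0.
move=> /(congr1 (fun x => x * (1 + i%:R ^+ 2) * (1 + j%:R ^+ 2))).
rewrite divfK // mulrAC divfK // => e.
have : (i%:R : R) ^+ 2 = j%:R ^+ 2 by move: (i%:R ^+ 2) (j%:R ^+ 2) e => x y e; lra.
by move=> /eqP; rewrite eqrXn2 // => /eqP/eqP; rewrite eqr_nat => /eqP.
Qed.

Lemma equator_point_sphere i : sphere (equator_point i).
Proof.
apply/sphereE; rewrite /dot /equator_point /=; field.
by rewrite gt_eqF // ltr_pwDl // exprn_ge0.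
Qed.

Lemma equator_uniq N : uniq [seq equator_point i | i <- iota 0 N].
Proof. by rewrite map_inj_uniq ?iota_uniq //; exact: equator_point_inj. Qed.

Lemma card_equator_set N : #|` equator_set N | = N.
Proof. by rewrite /equator_set card_fseq undup_id ?equator_uniq // size_map size_iota. Qed.

Lemma equator_set_sphere N : [set` equator_set N] `<=` sphere.
Proof.
by move=> x /=; rewrite !inE => /mapP[i _ ->]; exact: equator_point_sphere.
Qed.

Lemma equator_discrepancy N : (0 < N)%N -> 1 / 2 <= cap_discrepancy (equator_set N) <= 2.
Proof.
move=> N0; apply/andP; split.
  have := @cap_discrepancy_level R (equator_set N) [seq equator_point i | i <- iota 0 N] 0.
  rewrite size_map size_iota card_equator_set => /(_ _ (equator_uniq N) _).
  move=> h.
  have {h} : N%:R <= 2 * N%:R * cap_discrepancy (equator_set N).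
    apply: h; first by rewrite ltrN10 ler01.
    by move=> x hx; split; [rewrite !inE|move/mapP: hx => [i _ ->]; exact: equator_point_sphere|move/mapP: hx => [i _ ->]].
  by rewrite mulrAC -[X in X <= _]mul1r ler_pM2r ?ltr0n //; lra.
by apply: cap_discrepancy_le => z t _ ht; apply: cap_dev_le2 => //; rewrite card_equator_set.
Qed.

End Equator.

Section Final.
Context {R : realType}.

Definition diamond_set (N : nat) (theta : nat -> R) : {fset space3 R} :=
  if (241 <= N)%N then diamond_gen N theta else equator_set N.

(** For [N <= 240] the discrepancy lies in [[1 / 2, 2]], and [1 <= sqrt N <= 240] makes the
    constants of the large case sufficient. *)
Lemma diamond_set_discrepancy (N : nat) (theta : nat -> R) : (0 < N)%N ->
  1 / 4 / Num.sqrt N%:R <= cap_discrepancy (diamond_set N theta) <= 4002 / Num.sqrt N%:R.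
Proof.
move=> N0; rewrite /diamond_set; case: ifPn => hN; first exact: diamond_discrepancy.
have {}hN : (N <= 240)%N by rewrite -ltnNge in hN.
have N1 : 1 <= N%:R :> R by rewrite ler1n.
have s1 : 1 <= Num.sqrt N%:R :> R by rewrite -[X in X <= _]sqrtr1 ler_sqrt // (le_trans ler01).
have sN : Num.sqrt N%:R <= 240%N%:R :> R.
  apply: le_trans (_ : N%:R <= _); last by rewrite ler_nat.
  rewrite -[X in _ <= X](@ger0_norm R N%:R) // -sqrtr_sqr ler_sqrt ?exprn_ge0 //.
  by rewrite expr2 ler_peMl // (le_trans ler01).
have /andP[d1 d2] := @equator_discrepancy R N N0.
move: s1 sN; move: (Num.sqrt _) => s s1 sN.
have s0 : 0 < s by exact: lt_le_trans s1.
apply/andP; split.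
  apply: le_trans d1; rewrite ler_pdivrMr //.
  by move: s s1 {sN s0}; clear; move=> s ?; lra.
apply: le_trans d2 _; rewrite ler_pdivlMr //.
by move: s sN {s1 s0}; clear; move=> s ?; lra.
Qed.

Lemma diamond_gen_expectation (N : nat) : (241 <= N)%N ->
  forall (d : measure_display) (T : measurableType d) (P : probability T R)
    (theta : nat -> {RV P >-> R}), random_phases (2 * dM R N - 1)%N theta ->
  ('E_P[fun w => log_energy (diamond_gen N (fun j => theta j w))]
    = (mean_energy (dr R N) (2 * dM R N - 1))%:E)%E.
Proof.
move=> hN d T P theta hth.
have M0 := @dM_gt0 R N hN.
have [_ h] := @ringset_mean_energy R (dr R N) (2 * dM R N - 1) (@dr_ge3 R N hN) d T P theta hth.
rewrite unlock -h; apply: eq_integral => w _.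
by rewrite diamond_ringset.
Qed.

End Final.

Theorem theorem1p1 (R : realType) :
  - ((49 * 1000 + 223) / 1000 ^+ 2) < @c_diamond R
    < - ((49 * 1000 + 222) / 1000 ^+ 2) /\
  exists diamond : nat -> (nat -> R) -> {fset space3 R},
  [/\ (forall (N : nat) (theta : nat -> R), (241 <= N)%N ->
         diamond N theta = diamond_gen N theta),
      (forall (N : nat) (theta : nat -> R),
         (forall j, 0 <= theta j <= 2 * pi) ->
         [set` diamond N theta] `<=` sphere /\ #|` diamond N theta | = N),
      (exists (C : R) (N0 : nat), forall N : nat, (N0 <= N)%N ->
         forall (d : measure_display) (T : measurableType d)
           (P : probability T R) (theta : nat -> {RV P >-> R}),
         random_phases (2 * dM R N - 1)%N theta ->
         (`| 'E_P[fun w => log_energy (diamond N (fun j => theta j w))]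
             - (Wlog * N%:R ^+ 2 - 1 / 2 * N%:R * ln N%:R
                + c_diamond * N%:R)%:E |
           <= (C * (Num.sqrt N%:R * ln N%:R))%:E)%E) &
      (exists c1 c2 : R, [/\ 0 < c1, 0 < c2 &
         forall (N : nat) (theta : nat -> R), (0 < N)%N ->
         (forall j, 0 <= theta j <= 2 * pi) ->
         c1 / Num.sqrt N%:R <= cap_discrepancy (diamond N theta)
           <= c2 / Num.sqrt N%:R])].
Proof.
split; first exact: c_diamond_bounds.
exists diamond_set; split.
- by move=> N theta hN; rewrite /diamond_set hN.
- move=> N theta _; rewrite /diamond_set; case: ifP => hN.
    by split; [exact: diamond_sphere|exact: diamond_card].
  by split; [exact: equator_set_sphere|exact: card_equator_set].
(* The abstract bound [B] is now given its value 2155. *)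
- have [C hC] := @energy_asymptotics R _ (lexx 2155%N%:R).
  exists C, 241%N => N hN d T P theta hth; rewrite /diamond_set hN.
  rewrite diamond_gen_expectation // -EFinB abse_EFin lee_fin.
  exact: hC.
- exists (1 / 4), 4002; split; [by rewrite divr_gt0| by rewrite ltr0n|].
  by move=> N theta N0 _; exact: diamond_set_discrepancy.
Qed.
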